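(* There is an algorithm which, given as input a finite simple graph $G$ on $n$ vertices that contains no induced claw $K_{1,3}$, has no $K_5$-minor, and is not an odd cycle, outputs a 2-clique-coloring $\phi: V(G)\to\{r,g\}$ of $G$ in time $O(n^2)$.
   Context: A 2-clique-coloring of a graph $G$ is a map $\phi: V(G)\to\{r,g\}$ such that no maximal clique of $G$ with at least two vertices is monochromatic (a clique is a complete induced subgraph; it is maximal if not properly contained in another clique). A graph $H$ is a minor of $G$ if $H$ can be obtained from $G$ by deleting edges, deleting vertices and contracting edges.
   Formalization: For disconnected G the claim is false as written (C_5 plus an isolated vertex), so it is additionally assumed that no connected component of G is an odd cycle on more than 3 vertices; for connected G this follows from G not being an odd cycle. *)

(* Defs.v *)
From HB Require Import structures.
From mathcomp Require Import all_boot.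

Set Implicit Arguments.
Unset Strict Implicit.
Unset Printing Implicit Defensive.

(** * Finite simple graphs *)

Record sgraph := SGraph {
  vertex :> finType;
  adj : rel vertex;
  adj_sym : symmetric adj;
  adj_irr : irreflexive adj }.
Arguments SGraph [vertex adj] adj_sym adj_irr.
Arguments adj {s} x y.

Definition isomorphic (G H : sgraph) : Prop :=
  exists f : G -> H, bijective f /\ forall x y, adj (f x) (f y) = adj x y.

Definition contains_induced (H G : sgraph) : Prop :=
  exists f : H -> G, injective f /\ forall x y, adj (f x) (f y) = adj x y.

Section Induced.
Variables (G : sgraph) (S : {set G}).
Definition induced_adj : rel {x | x \in S} := fun x y => adj (val x) (val y).
Lemma induced_sym : symmetric induced_adj.
Proof. by move=> x y; apply: adj_sym. Qed.
Lemma induced_irr : irreflexive induced_adj.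
Proof. by move=> x; apply: adj_irr. Qed.
Definition induced : sgraph := SGraph induced_sym induced_irr.
End Induced.

Definition component (G : sgraph) (v : G) : sgraph :=
  induced [set x | connect adj v x].

(** ** The graphs [K_n], [K_{m,n}] and [C_n] *)

Section Complete.
Variable n : nat.
Definition complete_adj : rel 'I_n := fun x y => x != y.
Lemma complete_sym : symmetric complete_adj.
Proof. by move=> x y; rewrite /complete_adj eq_sym. Qed.
Lemma complete_irr : irreflexive complete_adj.
Proof. by move=> x; rewrite /complete_adj eqxx. Qed.
Definition complete : sgraph := SGraph complete_sym complete_irr.
End Complete.

Section CompleteBipartite.
Variables m n : nat.
Definition bipartite_adj : rel ('I_m + 'I_n)%type := fun x y =>
  match x, y with inl _, inr _ | inr _, inl _ => true | _, _ => false end.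
Lemma bipartite_sym : symmetric bipartite_adj.
Proof. by case=> x [] y. Qed.
Lemma bipartite_irr : irreflexive bipartite_adj.
Proof. by case. Qed.
Definition complete_bipartite : sgraph := SGraph bipartite_sym bipartite_irr.
End CompleteBipartite.

Definition claw : sgraph := complete_bipartite 1 3.

(* [ordS] is the cyclic successor on ['I_n]; this is the usual n-cycle only
   for [2 < n]. *)
Section Cycle.
Variable n : nat.
Definition cycle_adj : rel 'I_n := fun x y =>
  (x != y) && ((y == ordS x) || (x == ordS y)).
Lemma cycle_sym : symmetric cycle_adj.
Proof. by move=> x y; rewrite /cycle_adj eq_sym orbC. Qed.
Lemma cycle_irr : irreflexive cycle_adj.
Proof. by move=> x; rewrite /cycle_adj eqxx. Qed.
Definition cycle_graph : sgraph := SGraph cycle_sym cycle_irr.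
End Cycle.

Definition odd_cycle (G : sgraph) : Prop :=
  exists n, [/\ 2 < n, odd n & isomorphic G (cycle_graph n)].

(** ** Minors *)

Section DeleteEdge.
Variables (G : sgraph) (u v : G).
Definition del_edge_adj : rel G := fun x y =>
  adj x y && ([set x; y] != [set u; v]).
Lemma del_edge_sym : symmetric del_edge_adj.
Proof. by move=> x y; rewrite /del_edge_adj adj_sym setUC. Qed.
Lemma del_edge_irr : irreflexive del_edge_adj.
Proof. by move=> x; rewrite /del_edge_adj adj_irr. Qed.
Definition del_edge : sgraph := SGraph del_edge_sym del_edge_irr.
End DeleteEdge.

Definition del_vertex (G : sgraph) (v : G) : sgraph := induced [set~ v].

(* [v] is merged into [u], which keeps its name; parallel edges are identified
   and the loop at [u] is dropped. *)
Section Contract.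
Variables (G : sgraph) (u v : G).
Definition contract_adj : rel {x | x \in [set~ v]} := fun x y =>
  (x != y) && [|| adj (val x) (val y),
                  (val x == u) && adj v (val y) |
                  (val y == u) && adj v (val x)].
Lemma contract_sym : symmetric contract_adj.
Proof.
move=> x y; rewrite /contract_adj eq_sym (adj_sym (val x)); congr (_ && (_ || _)).
exact: orbC.
Qed.
Lemma contract_irr : irreflexive contract_adj.
Proof. by move=> x; rewrite /contract_adj eqxx. Qed.
Definition contract : sgraph := SGraph contract_sym contract_irr.
End Contract.

(* [minor H G]: [H] is a minor of [G]. *)
Inductive minor (H : sgraph) : sgraph -> Prop :=
| minor_iso (G : sgraph) : isomorphic G H -> minor H G
| minor_del_edge (G : sgraph) (u v : G) :
    adj u v -> minor H (del_edge u v) -> minor H G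
| minor_del_vertex (G : sgraph) (v : G) :
    minor H (del_vertex v) -> minor H G
| minor_contract (G : sgraph) (u v : G) :
    adj u v -> minor H (contract u v) -> minor H G.

(** ** 2-clique-colorings *)

Definition clique (G : sgraph) (K : {set G}) : bool :=
  [forall x in K, forall y in K, (x != y) ==> adj x y].

Definition maximal_clique (G : sgraph) (K : {set G}) : bool :=
  maxset (@clique G) K.

Inductive color := red | green.

Definition monochromatic (G : sgraph) (phi : G -> color) (K : {set G}) : Prop :=
  exists c, {in K, forall x, phi x = c}.

Definition clique_coloring2 (G : sgraph) (phi : G -> color) : Prop :=
  forall K : {set G}, maximal_clique K -> 1 < #|K| -> ~ monochromatic phi K.

(** * Algorithms: a word RAM with a structured instruction set

  A program uses finitely many registers and arrays, all holding natural
  numbers.  Every operation has unit cost.  [W] is the number of distinct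
  machine words: an execution in which some computed value (or address) is
  [>= W] is stuck. *)

Inductive expr :=
| Lit (m : nat)
| Reg (x : nat)
| Get (a : nat) (i : expr)
| Add (e1 e2 : expr)
| Sub (e1 e2 : expr)
| Mul (e1 e2 : expr)
| Lt (e1 e2 : expr)
| Eq (e1 e2 : expr).

Inductive cmd :=
| Skip
| Assign (x : nat) (e : expr)
| Store (a : nat) (i e : expr)
| Seq (c1 c2 : cmd)
| If (e : expr) (c1 c2 : cmd)
| While (e : expr) (c : cmd).

Record state := State { reg : nat -> nat; arr : nat -> nat -> nat }.

Fixpoint eval (s : state) (e : expr) : nat :=
  match e with
  | Lit m => m
  | Reg x => reg s x
  | Get a i => arr s a (eval s i)
  | Add e1 e2 => eval s e1 + eval s e2
  | Sub e1 e2 => eval s e1 - eval s e2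
  | Mul e1 e2 => eval s e1 * eval s e2
  | Lt e1 e2 => eval s e1 < eval s e2
  | Eq e1 e2 => eval s e1 == eval s e2
  end.

Fixpoint fits (W : nat) (s : state) (e : expr) : bool :=
  (eval s e < W) &&
  match e with
  | Lit _ | Reg _ => true
  | Get _ i => fits W s i
  | Add e1 e2 | Sub e1 e2 | Mul e1 e2 | Lt e1 e2 | Eq e1 e2 =>
      fits W s e1 && fits W s e2
  end.

Fixpoint cost (e : expr) : nat :=
  match e with
  | Lit _ | Reg _ => 1
  | Get _ i => (cost i).+1
  | Add e1 e2 | Sub e1 e2 | Mul e1 e2 | Lt e1 e2 | Eq e1 e2 =>
      (cost e1 + cost e2).+1
  end.

Definition set_reg (s : state) (x v : nat) : state :=
  State (fun y => if y == x then v else reg s y) (arr s).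

Definition set_arr (s : state) (a i v : nat) : state :=
  State (reg s)
        (fun b j => if (b == a) && (j == i) then v else arr s b j).

(* [exec W c s t s']: on [W] machine words, [c] started in [s] halts in [s']
   after [t] elementary steps. *)
Inductive exec (W : nat) : cmd -> state -> nat -> state -> Prop :=
| exec_skip s : exec W Skip s 1 s
| exec_assign s x e :
    fits W s e ->
    exec W (Assign x e) s (cost e).+1 (set_reg s x (eval s e))
| exec_store s a i e :
    fits W s i -> fits W s e ->
    exec W (Store a i e) s (cost i + cost e).+1
         (set_arr s a (eval s i) (eval s e))
| exec_seq c1 c2 s t1 s1 t2 s2 :
    exec W c1 s t1 s1 -> exec W c2 s1 t2 s2 ->
    exec W (Seq c1 c2) s (t1 + t2) s2
| exec_if e c1 c2 s t s' :
    fits W s e ->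
    exec W (if eval s e != 0 then c1 else c2) s t s' ->
    exec W (If e c1 c2) s ((cost e).+1 + t) s'
| exec_while_stop e c s :
    fits W s e -> eval s e = 0 ->
    exec W (While e c) s (cost e).+1 s
| exec_while_loop e c s t1 s1 t2 s2 :
    fits W s e -> eval s e <> 0 ->
    exec W c s t1 s1 -> exec W (While e c) s1 t2 s2 ->
    exec W (While e c) s ((cost e).+1 + t1 + t2) s2.

(* Input: [n] in register 0 and the adjacency matrix, row by row, in array 0. *)
Definition input (n : nat) (E : rel 'I_n) : state :=
  State (fun x => if x == 0 then n else 0)
        (fun a k => if a == 0
                    then [exists x : 'I_n, exists y : 'I_n,
                            (k == x * n + y) && E x y] : nat
                    else 0).

(* Output: the colors of the vertices [0, ..., n - 1], in array 1. *)
Definition color_code (c : color) : nat :=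
  match c with red => 0 | green => 1 end.

Definition outputs (n : nat) (s : state) (phi : 'I_n -> color) : Prop :=
  forall x : 'I_n, arr s 1 x = color_code (phi x).

Definition bigO (f g : nat -> nat) : Prop :=
  exists C N, forall n, N <= n -> f n <= C * g n.

(* Main.v *)
Require Import Defs.
From mathcomp Require Import all_boot zify.

(* Call a vertex blocked in a colour if its coloured neighbours contain a clique
   of that colour which is maximal in its neighbourhood; a colouring is valid if
   no vertex is blocked in its own colour.  The graph is reduced in two passes
   over the vertices, each deleted vertex being pushed on a stack.
   - A vertex [a] attached to a 4-wheel as in [pendant_config] can always be
     coloured after the rest of the graph.
   - The hub [v] of a 5-wheel: if some rim vertex [u] is dominated by [v], then
     [u] can be coloured last; otherwise [v] can, after flipping at most two
     vertices at distance at most 2, because every failing pattern of flips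
     produces a claw, a K5 minor or the previous configuration.
   These deletions never create a component that is an odd cycle of length at
   least 5, except in the situation of [guard], where one more vertex is deleted
   before [a].
   Without these two configurations, a vertex blocked in both colours has its
   neighbours covered by the two blocking cliques, so that the only uncoloured
   vertex, the hole, can be moved to any neighbour.  Move it along a path that
   never turns back inside a clique.  As long as no recolouring of at most two
   vertices near the hole succeeds, neighbourhoods look like those of a line
   graph and colours alternate along the path; hence the path closes up into an
   induced odd cycle, and going around it once more shows that this cycle has no
   other neighbours.  So the walk succeeds within [2 n] moves.
   By Ramsey's theorem degrees are at most 9, hence each local test takes
   constant time on neighbour lists, and the running time is quadratic. *)

Set Implicit Arguments.
Unset Strict Implicit.
Unset Printing Implicit Defensive.

(** * Complete minors from disjoint paths *)

(** The maximal cliques of an odd cycle of length at least 5 are its edges, so such a cycle has no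
    valid colouring, whereas a triangle has one; this is why deletions are controlled through odd
    holes that form whole components. The two deleted configurations are what appears around a
    vertex blocked in both colours when some neighbour lies in neither blocking clique. Deleting
    vertices only destroys configurations, so one pass is enough for each kind, and the second pass
    cannot bring back the first kind. A pendant configuration is K5 up to one missing edge, between
    [a] and the contracted edge [d e]; most facts about it come from a path that would supply this
    edge. The bound [2 n] stands for two turns around a closed path of at most [n + 1] vertices. A
    vertex off the path keeps its colour during both turns while the path vertices are seen with
    changed colours, so it cannot be adjacent to two consecutive ones. Each vertex of the reduced
    graph is coloured by one walk, in linear time; each deleted vertex returns by one local test. *)

Definition has_edge (T : Type) (e : rel T) (s t : seq T) : bool :=
  has (fun x => has (e x) t) s.

Definition K5_model (T : eqType) (e : rel T) (m : 'I_5 -> seq T) : Prop :=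
  [/\ forall i, if m i is x :: p then path e x p else false,
      forall i j x, x \in m i -> x \in m j -> i = j,
      forall i, uniq (m i)
    & forall i j, i != j -> has_edge e (m i) (m j)].

Lemma has_edgeP (T : eqType) (e : rel T) (s t : seq T) :
  reflect (exists x y, [/\ x \in s, y \in t & e x y]) (has_edge e s t).
Proof.
apply: (iffP hasP) => [[x xs /hasP[y yt exy]]|[x [y [xs yt exy]]]].
  by exists x, y.
by exists x => //; apply/hasP; exists y.
Qed.

(** Induction on the number of vertices: the first edge of a branch path with several vertices is
    contracted; failing that, a vertex outside all paths is deleted; failing that too, five single
    vertices exhaust the graph, which is then K5 itself. No edge ever has to be deleted. *)
Lemma complete_model (G : sgraph) (m : 'I_5 -> seq G) :
  K5_model adj m -> minor (complete 5) G.
Proof.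
have [k] := ubnP #|G|; elim: k G m => // k IH G m leGk mK.
have [mp mi mu me] := mK.
have del (x : G) : #|{: {z : G | z \in [set~ x]}}| < k.
  rewrite card_sig -ltnS (leq_trans _ leGk) // ltnS.
  by rewrite cardsC1 ltn_predL; apply/card_gt0P; exists x.
pose m' (x : G) i : seq {z | z \in [set~ x]} := pmap insub (m i).
have mem' x i (z : {z | z \in [set~ x]}) : (z \in m' x i) = (val z \in m i).
  by rewrite mem_pmap_sub.
have fil x i : map val (m' x i) = [seq z <- m i | z \in [set~ x]].
  by rewrite /m'; elim: (m i) => //= z s IHs; case: insubP => [u -> <-|/negPf->] //=; rewrite ?IHs.
have m'i x i j z : z \in m' x i -> z \in m' x j -> i = j.
  by rewrite !mem'; apply: mi.
have m'u x i : uniq (m' x i) by apply: pmap_sub_uniq.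
have [/existsP[i /andP[]]|/existsPn no2] :=
  boolP [exists i : 'I_5, (1 < size (m i)) && true].
  case def: (m i) (mp i) (mu i) => [|x [|y p]] //= /andP[xy yp] /andP[xp up] _ _.
  (* [contract y x] keeps [y]: the path loses its head [x], and [y] inherits the edges from [x] to
     the other paths. *)
  have yx : adj y x by rewrite adj_sym.
  apply: (minor_contract yx); apply: (IH (contract y x) (m' x) (del x)); split => //.
  - move=> j; have [->|ne] := eqVneq j i.
      have: map val (m' x i) = y :: p.
        rewrite fil def /= !inE eqxx /=; move: xp; rewrite inE negb_or => /andP[nxy xp].
        rewrite eq_sym nxy /=; congr (_ :: _); apply/all_filterP/allP => z zp.
        by rewrite !inE; apply: contraNneq xp => <-.
      case: (m' x i) => // z q /= [zy qe].
      move: yp; rewrite -qe -zy path_map; apply: sub_path => a b /= ab.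
      by rewrite /contract_adj ab /= andbT; apply: contraTneq ab => ->; rewrite adj_irr.
    have: map val (m' x j) = m j.
      rewrite fil; apply/all_filterP/allP => z zp; rewrite !inE.
      by apply: contraNneq ne => zx; apply/eqP/(mi _ _ z) => //; rewrite zx def inE eqxx.
    move: (mp j); case: (m j) => [|z q] //.
    case: (m' x j) => // w q' /= zq [wz qe].
    move: zq; rewrite -wz -qe path_map; apply: sub_path => a b /= ab.
    by rewrite /contract_adj ab /= andbT; apply: contraTneq ab => ->; rewrite adj_irr.
  - exact: m'i.
  - exact: m'u.
  - have yin : y \in [set~ x] by rewrite !inE; apply: contraTneq xy => ->; rewrite adj_irr.
    have lift (j l : 'I_5) (a : G) : a \in m j -> a != x -> exists a', [/\ a' \in m' x j & val a' = a].
      by move=> am ax; have ain : a \in [set~ x] by [rewrite !inE]; exists (exist _ a ain); rewrite mem'.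
    move=> j l jl; have /has_edgeP[a [b [am bm ab]]] := me _ _ jl.
    apply/has_edgeP.
    have [ax|ax] := eqVneq a x; have [bx|bx] := eqVneq b x.
    + by rewrite ax bx adj_irr in ab.
    + have ji : j = i by apply: (mi _ _ x); rewrite ?def ?inE ?eqxx // -ax.
      have [b' [b'm b'e]] := lift l l b bm bx.
      have y'm : exist _ y yin \in m' x j by rewrite mem' /= ji def !inE eqxx orbT.
      exists (exist _ y yin), b'; split => //.
      apply/andP; split; last by have xb : adj x b by [rewrite -ax]; rewrite /= eqxx b'e xb orbT.
      by apply: contraNneq jl => e; apply/eqP/(m'i x _ _ b') => //; rewrite -e.
    + have ji : l = i by apply: (mi _ _ x); rewrite ?def ?inE ?eqxx // -bx.
      have [b' [b'm b'e]] := lift j j a am ax.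
      have y'm : exist _ y yin \in m' x l by rewrite mem' /= ji def !inE eqxx orbT.
      exists b', (exist _ y yin); split => //.
      apply/andP; split; last by have xa : adj x a by [rewrite adj_sym -bx]; rewrite /= eqxx b'e xa !orbT.
      by apply: contraNneq jl => e; apply/eqP/(m'i x _ _ b') => //; rewrite e.
    + have [a' [a'm a'e]] := lift j j a am ax; have [b' [b'm b'e]] := lift l l b bm bx.
      exists a', b'; split=> //; rewrite /= /contract_adj a'e b'e ab andbT.
      by apply: contraTneq ab => e; rewrite -a'e e b'e adj_irr.
have sz1 i : size (m i) = 1.
  by move: (no2 i) (mp i); rewrite andbT -leqNgt; case: (m i) => [|? []].
have [/existsP[x /forallP xm]|/existsPn nox] :=
  boolP [exists x, [forall i : 'I_5, x \notin m i]].
  apply: (minor_del_vertex (v := x)); apply: (IH (del_vertex x) (m' x) (del x)); split => //.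
  - move=> j; have: map val (m' x j) = m j.
      rewrite fil; apply/all_filterP/allP => z zp; rewrite !inE.
      by apply: contraNneq (xm j) => <-.
    move: (mp j); case: (m j) => [|z q] //.
    case: (m' x j) => // w q' /= zq [wz qe].
    by move: zq; rewrite -wz -qe path_map.
  - exact: m'i.
  - exact: m'u.
  - move=> j l jl; have /has_edgeP[a [b [am bm ab]]] := me _ _ jl.
    have lift (k' : 'I_5) (c : G) : c \in m k' -> exists a', [/\ a' \in m' x k' & val a' = c].
      move=> cm; have cin : c \in [set~ x].
        by rewrite !inE; apply: contraNneq (xm k') => <-.
      by exists (exist _ c cin); rewrite mem'.
    have [a' [a'm a'e]] := lift _ _ am; have [b' [b'm b'e]] := lift _ _ bm.
    by apply/has_edgeP; exists a', b'; split => //; rewrite /= /induced_adj a'e b'e.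
apply: minor_iso.
have ix (x : G) : {i : 'I_5 | x \in m i}.
  by apply: sigW; move: (nox x); rewrite negb_forall => /existsP[i]; rewrite negbK; exists i.
have x0 : G by move: (mp ord0); case: (m ord0).
have m1 i x : x \in m i -> m i = [:: x].
  by move: (sz1 i); case: (m i) => [|z []] //= _; rewrite inE => /eqP ->.
exists (fun x => sval (ix x)); split.
  exists (fun i => head x0 (m i)) => [x|i].
    by rewrite (m1 _ _ (svalP (ix x))).
  have hi : head x0 (m i) \in m i by move: (sz1 i); case: (m i) => //= z s _; rewrite inE eqxx.
  exact: mi (svalP (ix _)) hi.
move=> x y; case: (ix x) (ix y) => [i xi] [j yj] /=; rewrite /complete_adj.
have [ij|ij] := eqVneq i j.
  by move: xi yj; rewrite ij => /m1 ->; rewrite inE => /eqP ->; rewrite adj_irr.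
have /has_edgeP[a [b []]] := me _ _ ij.
by rewrite (m1 _ _ xi) (m1 _ _ yj) !inE => /eqP -> /eqP ->.
Qed.

Lemma adj_neq (G : sgraph) (x y : G) : adj x y -> x != y.
Proof. by apply: contraTneq => ->; rewrite adj_irr. Qed.

Lemma adj_sep (G : sgraph) (x y z : G) : adj x z -> ~~ adj y z -> x != y.
Proof. by move=> xz; apply: contraNneq => <-. Qed.

Ltac adj_goal :=
  match goal with
  | A : is_true (adj ?x ?y) |- is_true (adj ?x ?y) => exact A
  | A : is_true (adj ?y ?x) |- is_true (adj ?x ?y) => by rewrite adj_sym
  | A : is_true (~~ adj ?x ?y) |- is_true (~~ adj ?x ?y) => exact A
  | A : is_true (~~ adj ?y ?x) |- is_true (~~ adj ?x ?y) => by rewrite adj_sym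
  end.

Ltac neq_side x y :=
  match goal with
  | A : is_true (x != y) |- _ => exact A
  | A : is_true (adj x y) |- _ => exact: adj_neq A
  | A : is_true (adj x ?z), B : is_true (~~ adj y ?z) |- _ => exact: adj_sep A B
  | A : is_true (adj x ?z), B : is_true (~~ adj ?z y) |- _ =>
      apply: (adj_sep A); rewrite adj_sym; exact B
  | A : is_true (adj ?z x), B : is_true (~~ adj y ?z) |- _ =>
      apply: (fun A' => adj_sep A' B); rewrite adj_sym; exact A
  | A : is_true (adj ?z x), B : is_true (~~ adj ?z y) |- _ =>
      apply: (@adj_sep _ x y z); rewrite adj_sym; [exact A | exact B]
  | A : ?g x = ?c, B : ?g y = ?d |- _ =>
      solve [let e := fresh in apply/eqP => e; move: A; rewrite e B; (by [] || by case: (c) || by case: (d))]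
  end.

(* Proves [x != y] by separating [x] from [y] with adjacency or colour facts
   of the context. *)
Ltac adj_neq :=
  match goal with
  | |- is_true (?x != ?y) => solve [neq_side x y | rewrite eq_sym; neq_side y x]
  end.

Ltac adj_auto := solve [adj_goal | adj_neq | done].

Ltac adj_eval := repeat match goal with
  | H : is_true (adj ?x ?y) |- context [adj ?x ?y] => rewrite H
  | H : is_true (adj ?x ?y) |- context [adj ?y ?x] => rewrite (adj_sym y x) H
  end.

Lemma contains_claw (G : sgraph) (v x y z : G) :
  adj v x -> adj v y -> adj v z -> x != y -> y != z -> x != z ->
  ~~ adj x y -> ~~ adj y z -> ~~ adj x z -> contains_induced claw G.
Proof.
move=> vx vy vz xy yz xz nxy nyz nxz.
pose t := [:: x; y; z].
exists (fun w : claw => match w with inl _ => v | inr i => nth v t i end); split.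
  have nv (i : 'I_3) : v != nth v t i by case: i => [[|[|[]]]] //= _; adj_neq.
  move=> [i|i] [j|j].
  - by rewrite !ord1.
  - by move=> e; have := nv j; rewrite -e eqxx.
  - by move=> e; have := nv i; rewrite e eqxx.
  - move=> e; congr inr; apply/val_inj/eqP.
    by rewrite -(nth_uniq v (s := t)) ?ltn_ord ?e //= !inE negb_or xy yz xz.
move=> [i|i] [j|j] /=; rewrite ?adj_irr //.
- by case: j => [[|[|[]]]].
- by rewrite adj_sym; case: i => [[|[|[]]]].
- by case: i => [[|[|[]]]] //= _; case: j => [[|[|[]]]] //= _;
    rewrite ?adj_irr // ?(negbTE nxy) ?(negbTE nyz) ?(negbTE nxz) // adj_sym;
    apply/negbTE.
Qed.

(** All conditions are boolean on an explicit list, so [model_of] can discharge them by rewriting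
    with the adjacencies of the context. *)
Lemma minor_of_paths (G : sgraph) (l : seq (seq G)) :
  size l = 5 -> all (fun s => if s is x :: p then path adj x p else false) l ->
  uniq (flatten l) -> pairwise (has_edge adj) l -> minor (complete 5) G.
Proof.
move=> sz /allP ps ul /(pairwiseP [::]) pw.
have ln (i : 'I_5) : i < size l by rewrite sz.
have he_sym (s t : seq G) : has_edge adj s t = has_edge adj t s.
  by apply/has_edgeP/has_edgeP => -[x [y [xs yt xy]]]; exists y, x; split=> //; rewrite adj_sym.
apply: (complete_model (m := fun i : 'I_5 => nth [::] l i)); split.
- by move=> i; exact: (ps (nth [::] l i) (mem_nth _ (ln i))).
- have dis (i j : nat) (x : G) : i < j -> j < size l ->
      x \in nth [::] l i -> x \in nth [::] l j -> False.
    move=> ij jl xi xj; move: ul; rewrite -(cat_take_drop j l) flatten_cat cat_uniq.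
    case/and3P => _ /hasPn no _; have := no x.
    rewrite (drop_nth [::] jl) /= mem_cat xj => /(_ isT)/negP; apply.
    apply/flattenP; exists (nth [::] l i) => //.
    by rewrite -(nth_take [::] ij) mem_nth // size_take jl.
  move=> i j x xi xj; apply/val_inj; case: (ltngtP i j) => // lt; exfalso.
    exact: dis lt (ln j) xi xj.
  exact: dis lt (ln i) xj xi.
- move=> i; move: ul; rewrite -{1}(cat_take_drop i l) (drop_nth [::] (ln i)).
  by rewrite flatten_cat /= !cat_uniq => /and5P[].
- move=> i j; rewrite -val_eqE neq_ltn => /orP[] lt; first by apply: pw; rewrite ?inE ?unfold_in ?ln.
  by rewrite he_sym; apply: pw; rewrite ?inE ?ln.
Qed.

Ltac model_of l :=
  apply: (@minor_of_paths _ l);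
  [ by [] | by rewrite /=; adj_eval
  | rewrite /= ?inE ?negb_or; repeat (apply/andP; split); (adj_neq || done)
  | by rewrite /= /has_edge /=; adj_eval; rewrite ?orbT ].

(** * Blocked vertices and valid colourings *)

Section Blocks.
Variable G : sgraph.
Implicit Types (h v w x y z : G) (P C K : {set G}) (f : G -> bool).

(* [P] is the set of the vertices present, [C] that of the coloured ones: colouring
   [h] with [c] would make [h |: K] a monochromatic maximal clique. *)
Definition block P C f h c K :=
  [&& K != set0,
      [forall x in K, [&& x \in P, x \in C, adj h x & f x == c]],
      [forall x in K, forall y in K, (x != y) ==> adj x y] &
      [forall w in P, adj h w ==> [exists k in K, ~~ adj w k]]].

Definition blocked P C f h c := [exists K : {set G}, block P C f h c K].

Definition valid P C f := [forall u in P, (u \in C) ==> ~~ blocked P C f u (f u)].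

Lemma blockP P C f h c K :
  reflect [/\ exists x, x \in K,
              forall x, x \in K -> [/\ x \in P, x \in C, adj h x & f x = c],
              forall x y, x \in K -> y \in K -> x != y -> adj x y
            & forall w, w \in P -> adj h w -> exists2 k, k \in K & ~~ adj w k]
          (block P C f h c K).
Proof.
apply: (iffP and4P) => -[K0 KC Kc Km]; split.
- exact/set0Pn.
- by move=> x xK; have /and4P[? ? ? /eqP ?] := forall_inP KC x xK.
- by move=> x y xK yK; have /forall_inP/(_ y yK)/implyP := forall_inP Kc x xK.
- move=> w wP hw; have /implyP/(_ hw)/exists_inP[k kK wk] := forall_inP Km w wP.
  by exists k.
- exact/set0Pn.
- by apply/forall_inP => x /KC[-> -> -> ->]; rewrite /= eqxx.
- by apply/forall_inP => x xK; apply/forall_inP => y yK; apply/implyP; apply: Kc.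
- apply/forall_inP => w wP; apply/implyP => hw; apply/exists_inP.
  by case: (Km w wP hw) => k; exists k.
Qed.

Lemma blockedP P C f h c : reflect (exists K, block P C f h c K) (blocked P C f h c).
Proof. exact: existsP. Qed.

Lemma validP P C f :
  reflect (forall u, u \in P -> u \in C -> ~~ blocked P C f u (f u)) (valid P C f).
Proof.
apply: (iffP forall_inP) => H u uP; first by move/implyP: (H u uP).
by apply/implyP; apply: H.
Qed.

(** The monochromatic clique [u |: K] is the same one seen from [p]: a neighbour of [p] is missed by
    [u], or else by a member of [K], which cannot be [p]. *)
Lemma block_exchange P C f u K p :
  u \in P -> u \in C -> block P C f u (f u) K -> p \in K ->
  block P C f p (f p) (u |: K :\ p).
Proof.
move=> uP uC /blockP[_ Ka Kc Km] pK; have [pP pC up fp] := Ka p pK.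
apply/blockP; split.
- by exists u; rewrite !inE eqxx.
- move=> x; rewrite !inE => /orP[/eqP->|/andP[xp xK]].
    by rewrite adj_sym up fp.
  have [xP xC ux fx] := Ka x xK; split=> //; last by rewrite fx fp.
  by apply: Kc; rewrite // eq_sym.
- move=> x y; rewrite !inE => /orP[/eqP->|/andP[xp xK]] /orP[/eqP->|/andP[yp yK]].
  + by rewrite eqxx.
  + by have [_ _ ->] := Ka y yK.
  + by have [_ _] := Ka x xK; rewrite adj_sym => ->.
  + exact: Kc.
move=> w wP pw; have [uw|uw] := boolP (adj u w).
  have [k kK wk] := Km w wP uw.
  by exists k => //; rewrite !inE kK andbT; apply/orP; right; apply: contraNneq wk => ->; rewrite adj_sym.
by exists u; rewrite ?inE ?eqxx // adj_sym.
Qed.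

(* Only the changed vertices have to be checked, since a monochromatic maximal
   clique through a changed vertex blocks that vertex as well. *)
Lemma valid_change P C C' f f' (D : {set G}) :
  valid P C f -> C' :\: D \subset C -> {in C' :\: D, f =1 f'} ->
  (forall u, u \in P -> u \in C' -> u \in D -> ~~ blocked P C' f' u (f' u)) ->
  valid P C' f'.
Proof.
move=> /validP vf /subsetP CD ff' chk; apply/validP => u uP uC'.
have [uD|uD] := boolP (u \in D); first exact: chk.
apply/negP => /blockedP[K bK]; have /blockP[K0 Ka Kc Km] := bK.
have [/exists_inP[p pK pD]|/exists_inPn noD] := boolP [exists p in K, p \in D].
  have [pP pC' _ _] := Ka p pK; move/negP: (chk p pP pC' pD); apply.
  by apply/blockedP; exists (u |: K :\ p); apply: block_exchange.
have uCD : u \in C' :\: D by rewrite inE uD.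
move/negP: (vf u uP (CD u uCD)); apply; apply/blockedP; exists K; apply/blockP.
split=> // x xK; have [xP xC' ux fx] := Ka x xK.
have xCD : x \in C' :\: D by rewrite inE xC' noD.
by rewrite ux xP CD // !ff' // fx.
Qed.

Definition upd f h (c : bool) : G -> bool := fun x => if x == h then c else f x.

Lemma valid_colour P C f h c :
  valid P C f -> h \notin C -> ~~ blocked P C f h c -> valid P (h |: C) (upd f h c).
Proof.
move=> vf hC nb; apply: (valid_change (D := [set h]) vf).
- by apply/subsetP => x; rewrite !inE => /andP[/negPf->].
- by move=> x; rewrite !inE /upd => /andP[/negPf->].
move=> u uP _; rewrite inE => /eqP-> ; rewrite /upd eqxx; apply: contra nb.
case/blockedP => K /blockP[K0 Ka Kc Km]; apply/blockedP; exists K; apply/blockP; split=> //.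
move=> x /Ka[xP]; rewrite !inE; have [->|_] := eqVneq x h; first by rewrite adj_irr.
by move=> /= xC hx fx.
Qed.

(** A vertex that is present but not coloured only strengthens the maximality required of a blocking
    clique. *)
Lemma valid_reinsert P f h : valid (P :\ h) (P :\ h) f -> valid P (P :\ h) f.
Proof.
move=> /validP vf; apply/validP => u uP uPh.
apply: contra (vf u uPh uPh) => /blockedP[K /blockP[K0 Ka Kc Km]].
apply/blockedP; exists K; apply/blockP; split=> //.
  by move=> x /Ka[xP xPh ux fx].
by move=> w; rewrite !inE => /andP[_]; apply: Km.
Qed.

Lemma block_color P C f h c K x : block P C f h c K -> x \in K -> f x = c.
Proof. by case/blockP=> _ + _ _ xK => /(_ x xK)[]. Qed.

End Blocks.

(** * Two blocking cliques cover the neighbourhood of a vertex *)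

Section ClawFree.
Variable G : sgraph.
Hypothesis noclaw : ~ contains_induced claw G.
Implicit Types (a b c d e h u v w x y z p : G) (P C K : {set G}) (f : G -> bool).

Lemma claw_free v x y z : adj v x -> adj v y -> adj v z ->
  x != y -> y != z -> x != z -> ~~ adj x y -> ~~ adj y z -> adj x z.
Proof.
by move=> *; apply/negPn/negP => nxz; apply: noclaw; apply: (@contains_claw _ v x y z).
Qed.

(* The cycle [b c d e] and its hub [v] form an induced 4-wheel; [a] is attached to
   the triangle [v b c]. *)
Definition pendant_config v a b c d e :=
  [&& adj a v, adj a b, adj a c, adj v b, adj v c, adj v d, adj v e,
      adj b c, adj c d, adj d e, adj e b,
      ~~ adj a d, ~~ adj a e, ~~ adj b d & ~~ adj c e].

Definition wheel_config v u1 u2 u3 u4 u5 :=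
  [&& adj v u1, adj v u2, adj v u3, adj v u4, adj v u5,
      adj u1 u2, adj u2 u3, adj u3 u4, adj u4 u5, adj u5 u1 &
      [&& ~~ adj u1 u3, ~~ adj u2 u4, ~~ adj u3 u5, ~~ adj u4 u1 & ~~ adj u5 u2]].

Definition pendant_free P := forall v a b c d e,
  v \in P -> a \in P -> b \in P -> c \in P -> d \in P -> e \in P ->
  ~~ pendant_config v a b c d e.

Definition wheel_free P := forall v u1 u2 u3 u4 u5,
  v \in P -> u1 \in P -> u2 \in P -> u3 \in P -> u4 \in P -> u5 \in P ->
  ~~ wheel_config v u1 u2 u3 u4 u5.

Definition tame P := pendant_free P /\ wheel_free P.

(** Let [z] lie outside both cliques, with non-neighbours [k1] and [k2] in them. Claws at [h] make
    [k1] and [k2] adjacent, and make [z] adjacent to the members [j1], [j2] that miss [k2], [k1]. If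
    [j1] and [j2] are adjacent, [z] is pendant on the 4-wheel with rim [j1 j2 k2 k1]; otherwise
    [z j1 k1 k2 j2] is the rim of a 5-wheel. Both have hub [h]. *)
Lemma tame_cover P C f h K1 K2 (q : bool) z :
  tame P -> h \in P -> block P C f h q K1 -> block P C f h (~~ q) K2 ->
  z \in P -> adj h z -> z \in K1 :|: K2.
Proof.
move=> [pf wf] hP b1 b2 zP hz; rewrite inE; apply/negPn/negP.
rewrite negb_or => /andP[z1 z2].
have [_ a1 c1 m1] := blockP _ _ _ _ _ _ b1; have [_ a2 c2 m2] := blockP _ _ _ _ _ _ b2.
have [k1 k1K zk1] := m1 z zP hz; have [k2 k2K zk2] := m2 z zP hz.
have [k1P _ hk1 f1] := a1 _ k1K; have [k2P _ hk2 f2] := a2 _ k2K.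
have nz k K : z \notin K -> k \in K -> z != k by move=> zK; apply: contraTneq => <-.
have zk1' := nz _ _ z1 k1K; have zk2' := nz _ _ z2 k2K.
have k12 : adj k1 k2 by apply: (claw_free hk1 hz hk2); adj_auto.
have [j1 j1K j1k2] := m1 k2 k2P hk2; have [j2 j2K j2k1] := m2 k1 k1P hk1.
have [j1P _ hj1 g1] := a1 _ j1K; have [j2P _ hj2 g2] := a2 _ j2K.
have j1k1 : adj j1 k1 by apply: c1 => //; adj_neq.
have j2k2 : adj j2 k2 by apply: c2 => //; adj_neq.
have zj1 : adj z j1 by apply: (claw_free hz hk2 hj1); adj_auto.
have zj2 : adj z j2 by apply: (claw_free hz hk1 hj2); adj_auto.
have [j12|j12] := boolP (adj j1 j2).
  move/negP: (pf h z j1 j2 k2 k1 hP zP j1P j2P k2P k1P); apply.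
  by rewrite /pendant_config; adj_eval; rewrite /= zk1 zk2 (adj_sym j1) j1k2 (adj_sym j2).
move/negP: (wf h z j1 k1 k2 j2 hP zP j1P k1P k2P j2P); apply.
by rewrite /wheel_config; adj_eval; rewrite /= (adj_sym j1) j1k2 j2k1 (adj_sym k2) zk1 zk2 (adj_sym j2) j12.
Qed.

End ClawFree.

Ltac use_pendant H :=
  have /and5P[av ab ac vb /and5P[vc vd ve bc /and5P[cd de eb ad /and3P[ae bd ce]]]] := H.

Ltac use_wheel H :=
  have /and5P[v1 v2 v3 v4 /and5P[v5 u12 u23 u34 /and3P[u45 u51 /and5P[n13 n24 n35 n41 n52]]]] := H.

(** * Pendant vertices and odd holes *)

(* [odd_hole P M c]: the vertices [c 0, ..., c (M - 1)] form an induced cycle of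
   odd length [M >= 5] which is a component of the subgraph induced by [P]. *)
Definition odd_hole (G : sgraph) (P : {set G}) (M : nat) (c : nat -> G) :=
  [/\ odd M, 3 < M, {in gtn M &, injective c}, forall i, i < M -> c i \in P
    & forall i y, i < M -> y \in P ->
        adj (c i) y = (y == c (i.+1 %% M)) || (y == c ((i + M.-1) %% M))].

Definition no_odd_hole (G : sgraph) (P : {set G}) :=
  forall M c, ~ odd_hole P M c.

Section PendantVertices.
Variable G : sgraph.
Hypotheses (noclaw : ~ contains_induced claw G) (noK5 : ~ minor (complete 5) G).
Implicit Types (a b c d e h u v w x y z p : G) (P C K : {set G}) (f : G -> bool).

Let claw_free := claw_free noclaw.

Lemma pendant_configC v a b c d e :
  pendant_config v a b c d e -> pendant_config v a c b e d.
Proof.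
case/and5P=> av ab ac vb /and5P[vc vd ve bc /and5P[cd de eb ad /and3P[ae bd ce]]].
by rewrite /pendant_config; adj_eval; rewrite ae ad ce bd.
Qed.

(** The vertices [a], [b], [c], [v] and the contracted edge [d e] form K5 without one edge; the path
    [a x d] would complete it. *)
Lemma pendant_far v a b c d e x :
  pendant_config v a b c d e -> adj a x -> x != v -> x != b -> x != c -> ~~ adj x d.
Proof.
move=> H ax xv xb xc; use_pendant H.
apply/negP => xd; apply: noK5.
by model_of [:: [:: a; x]; [:: b]; [:: c]; [:: v]; [:: d; e]].
Qed.

(** If [x] were adjacent to [v], then, since it misses [d] and [e], claws at [v] would make it
    adjacent to [b] and [c], and [x a b c v] would be K5. *)
Lemma pendant_hub v a b c d e x :
  pendant_config v a b c d e -> adj a x -> x != b -> x != c -> ~~ adj x v.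
Proof.
move=> H ax xb xc; use_pendant H.
have [->|xv] := eqVneq x v; first by rewrite adj_irr.
have xd := pendant_far H ax xv xb xc.
have xe := pendant_far (pendant_configC H) ax xv xc xb.
apply/negP => nxv.
have vx : adj v x by rewrite adj_sym.
have xB : adj x b by apply: (claw_free vx vd vb); adj_auto.
have xC : adj x c by apply: (claw_free vx ve vc); adj_auto.
by apply: noK5; model_of [:: [:: x]; [:: a]; [:: b]; [:: c]; [:: v]].
Qed.

Lemma pendant_outer_clique v a b c d e x y :
  pendant_config v a b c d e -> adj a x -> adj a y -> ~~ adj x v -> ~~ adj y v ->
  x != v -> y != v -> x != y -> adj x y.
Proof.
move=> H ax ay xv yv xv' yv' xy; use_pendant H.
by apply: (claw_free ax av ay); adj_auto.
Qed.

Lemma pendant_outer v a b c d e x :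
  pendant_config v a b c d e -> adj a x -> ~~ adj x v -> x != v ->
  adj x b -> adj x c.
Proof.
move=> H ax xv xv' xb; use_pendant H.
have xe : ~~ adj x e by apply: (pendant_far (pendant_configC H)); adj_auto.
have bx : adj b x by rewrite adj_sym.
have be : adj b e by rewrite adj_sym.
by apply: (claw_free bx be bc); adj_auto.
Qed.

(** Hence, once [a] is deleted, the triangle [v b c] is a maximal clique and no valid colouring
    makes it monochromatic. *)
Lemma pendant_triangle v a b c d e z :
  pendant_config v a b c d e -> z != a -> adj v z -> adj b z -> ~~ adj c z.
Proof.
move=> H za vz bz; use_pendant H; apply/negP => cz.
have [az|az] := boolP (adj a z).
  have : ~~ adj z v by apply: (pendant_hub H); adj_auto.
  by rewrite adj_sym vz.
have va : adj v a by rewrite adj_sym.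
have zd : adj z d by apply: (claw_free vz va vd); adj_auto.
by apply: noK5; model_of [:: [:: z]; [:: b]; [:: c]; [:: v]; [:: d; e]].
Qed.

(** Suppose both colours are blocked. A blocking clique through [v] would also contain [b] and [c],
    against [pendant_triangle]. So each one has a member not adjacent to [v]. All neighbours of [a]
    of this kind are pairwise adjacent, so non-adjacencies between the two cliques involve [b] and
    [c]; but by [pendant_outer] such a neighbour sees both of these or neither. *)
Lemma pendant_colourable P f v a b c d e :
  a \in P -> v \in P -> b \in P -> c \in P -> pendant_config v a b c d e ->
  valid (P :\ a) (P :\ a) f ->
  exists q, ~~ blocked P (P :\ a) f a q.
Proof.
move=> aP vP bP cP H /validP vf; use_pendant H.
have [b1|] := boolP (blocked P (P :\ a) f a true); last by exists true.
have [b2|] := boolP (blocked P (P :\ a) f a false); last by exists false.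
have nmono : f v = f b -> f v = f c -> False.
  move=> fb fc.
  have va : v != a by adj_neq.
  have vPa : v \in P :\ a by rewrite !inE va.
  have /negP := vf v vPa vPa; apply; apply/blockedP; exists [set b; c].
  apply/blockP; split.
  - by exists b; rewrite !inE eqxx.
  - by move=> x; rewrite !inE => /orP[]/eqP->; split=> //; rewrite ?bP ?cP andbT; adj_neq.
  - by move=> x y; rewrite !inE => /orP[]/eqP-> /orP[]/eqP->; rewrite ?eqxx // adj_sym.
  move=> w; rewrite inE => /andP[]; rewrite inE => wa wP vw.
  have [bw|bw] := boolP (adj b w).
    exists c; rewrite ?inE ?eqxx ?orbT // adj_sym.
    exact: pendant_triangle H wa vw bw.
  by exists b; rewrite ?inE ?eqxx // adj_sym.
have outer q K : block P (P :\ a) f a q K -> forall k, k \in K -> k != v.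
  case/blockP => _ Ka Kc Km k kK; apply: contraTneq kK => ->; apply/negP => vK.
  have Kin x : x \in K -> [|| x == v, x == b | x == c].
    move=> xK; have [_ _ ax _] := Ka x xK.
    have [//|xv] := eqVneq x v; have [//|xb] := eqVneq x b; have [//|xc] := eqVneq x c.
    have := pendant_hub H ax xb xc; rewrite Kc //.
  have [k1 k1K bk1] := Km b bP ab; have [k2 k2K ck2] := Km c cP ac.
  have bK : b \in K.
    by case/or3P: (Kin _ k1K) => /eqP ek; move: bk1 k1K; rewrite ek ?bc // adj_sym vb.
  have cK : c \in K.
    by case/or3P: (Kin _ k2K) => /eqP ek; move: ck2 k2K; rewrite ek // adj_sym ?bc ?vc.
  have [_ _ _ fv] := Ka v vK; have [_ _ _ fb] := Ka b bK; have [_ _ _ fc] := Ka c cK.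
  by apply: nmono; rewrite fv ?fb ?fc.
have [K1 B1] := blockedP _ _ _ _ _ b1; have [K2 B2] := blockedP _ _ _ _ _ b2.
have far q K : block P (P :\ a) f a q K -> exists2 k, k \in K & [/\ k != v, ~~ adj k v & adj a k].
  move=> B; have [_ Ka Kc Km] := blockP _ _ _ _ _ _ B.
  have [k kK vk] := Km v vP av; exists k => //; have [_ _ ak _] := Ka k kK.
  by split=> //; [apply: outer B k kK | rewrite adj_sym].
have [k1 k1K [k1v k1v' ak1]] := far _ _ B1; have [k2 k2K [k2v k2v' ak2]] := far _ _ B2.
have [_ a1 c1 m1] := blockP _ _ _ _ _ _ B1; have [_ a2 c2 m2] := blockP _ _ _ _ _ _ B2.
have [k1P _ _ f1] := a1 _ k1K; have [k2P _ _ f2] := a2 _ k2K.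
have [j1 j1K k2j1] := m1 _ k2P ak2; have [j2 j2K k1j2] := m2 _ k1P ak1.
have [_ _ aj1 g1] := a1 _ j1K; have [_ _ aj2 g2] := a2 _ j2K.
have j12 : j1 != j2 by adj_neq.
have inbc j k : adj a j -> j != v -> adj a k -> k != v -> ~~ adj k v -> ~~ adj k j -> j != k ->
    (j == b) || (j == c).
  move=> aj jv ak kv kv' kj jk; have [//|jb] := eqVneq j b; have [//|jc] := eqVneq j c.
  have jv' := pendant_hub H aj jb jc.
  by rewrite adj_sym (pendant_outer_clique H aj ak) in kj.
have j1v := outer _ _ B1 _ j1K; have j2v := outer _ _ B2 _ j2K.
have j1k2 : j1 != k2 by adj_neq.
have j2k1 : j2 != k1 by adj_neq.
have j1bc := inbc _ _ aj1 j1v ak2 k2v k2v' k2j1 j1k2.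
have j2bc := inbc _ _ aj2 j2v ak1 k1v k1v' k1j2 j2k1.
have k1j1 : adj k1 j1 by apply: c1 => //; apply: contraTneq j1bc => <-; rewrite negb_or; apply/andP; split; adj_neq.
case/orP: j1bc j12 k1j1 => /eqP-> j12 k1j1; case/orP: j2bc j12 k1j2 => /eqP->; rewrite ?eqxx // => _.
  by rewrite (pendant_outer H ak1).
by rewrite (pendant_outer (pendant_configC H) ak1).
Qed.

(* When deleting the pendant vertex [a] would leave an odd hole attached to [a]
   along its edge [xy], the vertex [x] is deleted before [a]. *)
Definition guard P a b v x y p :=
  [&& adj a x, adj a y, adj x y, adj x p, ~~ adj x v, ~~ adj y v, ~~ adj x b, ~~ adj y b &
    [&& ~~ adj p a, ~~ adj p y & [forall w in P, adj x w ==> [|| w == a, w == y | w == p]]]].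

(** The neighbours of [a] away from [v] are pairwise adjacent, and [x] has no neighbours in [P] but
    [a], [y] and [p]. *)
Lemma guard_unique P v a b c d e x y p w :
  pendant_config v a b c d e -> guard P a b v x y p ->
  w \in P -> adj a w -> ~~ adj w v -> w != v -> w != x -> w = y.
Proof.
move=> H /and5P[ax ay xy xp /and5P[xv yv xb yb /and3P[pa py /forall_inP dx]]] wP aw wv wv' wx.
use_pendant H.
have xw : adj x w by apply: (pendant_outer_clique H); adj_auto.
have /implyP/(_ xw)/or3P[/eqP wa|/eqP //|/eqP wp] := dx w wP.
  by rewrite wa adj_irr in aw.
by rewrite wp adj_sym (negbTE pa) in aw.
Qed.

(** The maximal cliques around [x] are [{a, y}] and [{p}]. After the deletion of [x] the edge [a y]
    is itself a maximal clique, hence not monochromatic; so every clique blocking [x] contains [p],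
    which has only one colour. *)
Lemma guard_colourable P f v a b c d e x y p :
  a \in P -> y \in P -> x \in P -> pendant_config v a b c d e -> guard P a b v x y p ->
  valid (P :\ x) (P :\ x) f ->
  exists q, ~~ blocked P (P :\ x) f x q.
Proof.
move=> aP yP xP H Hg /validP vf; use_pendant H.
have /and5P[ax ay xy xp /and5P[xv yv xb yb /and3P[pa py /forall_inP dx]]] := Hg.
have [b1|] := boolP (blocked P (P :\ x) f x true); last by exists true.
have [b2|] := boolP (blocked P (P :\ x) f x false); last by exists false.
have fay : f a = f y -> False.
  move=> fay; have aPx : a \in P :\ x by rewrite !inE aP andbT; adj_neq.
  have yPx : y \in P :\ x by rewrite !inE yP andbT; adj_neq.
  have /negP := vf a aPx aPx; apply; apply/blockedP; exists [set y]; apply/blockP; split.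
  - by exists y; rewrite inE.
  - by move=> z; rewrite inE => /eqP->.
  - by move=> z t; rewrite !inE => /eqP-> /eqP->; rewrite eqxx.
  move=> w; rewrite 2!inE => /andP[wx wP] aw; exists y; rewrite ?inE //.
  have yv' : y != v by adj_neq.
  have yc : ~~ adj y c by apply: contra yb; apply: (pendant_outer (pendant_configC H)).
  have [->|wb] := eqVneq w b; first by rewrite adj_sym.
  have [->|wc] := eqVneq w c; first by rewrite adj_sym.
  have [->|wv] := eqVneq w v; first by rewrite adj_sym.
  have wv' := pendant_hub H aw wb wc.
  by rewrite (guard_unique H Hg wP aw) ?adj_irr.
have hasp q : blocked P (P :\ x) f x q -> f p = q.
  case/blockedP => K /blockP[_ Ka Kc Km].
  have Kin k : k \in K -> [|| k == a, k == y | k == p].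
    by move=> /Ka[kP _ xk _]; have /implyP := dx k kP; apply.
  have xa : adj x a by rewrite adj_sym.
  have [k kK ak] := Km a aP xa; have [j jK yj] := Km y yP xy.
  have [_ _ _ fk] := Ka k kK; have [_ _ _ fj] := Ka j jK.
  case/or3P: (Kin k kK) => /eqP ek; last by rewrite -ek.
    case/or3P: (Kin j jK) => /eqP ej; last by rewrite -ej.
      by rewrite ej adj_sym ay in yj.
    by case: fay; rewrite -ek -ej fk.
  by rewrite ek ay in ak.
by have := hasp _ b1; rewrite (hasp _ b2).
Qed.

Section OddHoles.
Variables (P : {set G}) (M : nat) (c : nat -> G).
Hypothesis hole : odd_hole P M c.

Lemma odd_hole_nbrs i : i < M -> exists l r,
  [/\ exists2 j, j < M & c j = l, exists2 j, j < M & c j = r, l != r,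
      ~~ adj l r & forall w, w \in P -> adj (c i) w = (w == l) || (w == r)].
Proof.
case: hole => oM M3 ci cP cadj iM; have M0 : 0 < M by case: (M) M3.
exists (c (i.+1 %% M)), (c ((i + M.-1) %% M)).
have neq j k : j < M -> k < M -> j != k -> (i + j) %% M != (i + k) %% M.
  by move=> jM kM; rewrite eqn_modDl !modn_small.
have cneq j k : j < M -> k < M -> j != k -> c ((i + j) %% M) != c ((i + k) %% M).
  move=> jM kM jk; apply: contraNneq (neq _ _ jM kM jk) => /ci.
  by rewrite !inE !ltn_mod M0 => ->.
have M1 : M.-1 < M by rewrite ltn_predL.
have e1 : i.+1 = i + 1 by rewrite addn1.
split.
- by exists (i.+1 %% M); rewrite ?ltn_mod.
- by exists ((i + M.-1) %% M); rewrite ?ltn_mod.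
- rewrite e1; apply: cneq => //; first by case: (M) M3 => // -[].
  by case: (M) M3 => // -[|[]].
- rewrite cadj ?cP ?ltn_mod // negb_or; apply/andP; split.
    rewrite -addn1 modnDml e1 -addnA; apply: cneq => //; first by case: (M) M3 => // -[|[|[]]].
    by case: (M) M3 => // -[|[|[|[]]]].
  rewrite modnDml e1 -addnA add1n prednK // modnDr.
  have /(cneq M.-1 0 M1 M0): M.-1 != 0 by case: (M) M3 => // -[].
  by rewrite addn0.
- by move=> w wP; apply: cadj.
Qed.

Lemma odd_hole_closed i w : i < M -> w \in P -> adj (c i) w -> exists2 j, j < M & c j = w.
Proof.
move=> iM wP; have [l [r [[j jM <-] [k kM <-] _ _ ->]]] := odd_hole_nbrs iM => //.
by case/orP=> /eqP ->; [exists j | exists k].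
Qed.

Lemma odd_hole_triangle i w1 w2 : i < M -> w1 \in P -> w2 \in P ->
  adj (c i) w1 -> adj (c i) w2 -> ~~ adj w1 w2.
Proof.
move=> iM w1P w2P; have [l [r [_ _ _ lr ad]]] := odd_hole_nbrs iM.
rewrite !ad // => /orP[]/eqP-> /orP[]/eqP->; rewrite ?adj_irr //.
by rewrite adj_sym.
Qed.
End OddHoles.

End PendantVertices.

(** * Effect of the deletions on odd holes *)

Section Deletion.
Variable G : sgraph.
Hypotheses (noclaw : ~ contains_induced claw G) (noK5 : ~ minor (complete 5) G).
Implicit Types (a b d e h u v w x y z p : G) (P C K : {set G}) (f : G -> bool).

Let claw_free := claw_free noclaw.

(** A claw at a hole vertex adjacent to [z] forces [z] to be adjacent to one of its two hole
    neighbours as well. *)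
Lemma odd_hole_attached P z M c :
  no_odd_hole P -> odd_hole (P :\ z) M c ->
  exists i j k, [/\ [&& i < M, j < M & k < M],
    [&& adj z (c i), adj z (c j) & adj (c i) (c j)],
    [&& adj (c i) (c k), ~~ adj (c j) (c k) & c j != c k]
   & forall w, w \in P :\ z -> adj (c i) w -> (w == c j) || (w == c k)].
Proof.
move=> nP hole; have [oM M3 ci cP cadj] := hole.
have [/existsP[i zi]|/existsPn nz] := boolP [exists i : 'I_M, adj z (c i)].
  have [l [r [[j jM jl] [k kM kr] nlr lr ad]]] := odd_hole_nbrs hole (ltn_ord i).
  have lP : l \in P :\ z by rewrite -jl cP.
  have rP : r \in P :\ z by rewrite -kr cP.
  have il : adj (c i) l by rewrite ad // eqxx.
  have ir : adj (c i) r by rewrite ad // eqxx orbT.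
  have iz : adj (c i) z by rewrite adj_sym.
  have /andP[lz _] : (l != z) && (l \in P) by rewrite -in_setD1.
  have /andP[rz _] : (r != z) && (r \in P) by rewrite -in_setD1.
  have rl : ~~ adj r l by rewrite adj_sym.
  have [zl|zl] := boolP (adj z l).
    exists i, j, k; rewrite jl kr ltn_ord jM kM zi zl il ir lr nlr; split=> // w wP.
    by rewrite ad.
  have zr : adj z r.
    by rewrite adj_sym; apply/negPn/negP => nzr; move/negP: lr; apply;
       apply: (claw_free il iz ir); adj_auto.
  exists i, k, j; rewrite jl kr ltn_ord jM kM zi zr il ir rl eq_sym nlr; split=> // w wP.
  by rewrite ad // orbC.
(* With no edge from [z], the hole of [P :\ z] would already be a hole of [P]. *)
case: (nP M c); split=> // i.
  by move=> iM; have := cP i iM; rewrite inE => /andP[].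
move=> y iM yP; have [->|yz] := eqVneq y z.
  rewrite adj_sym (negbTE (nz (Ordinal iM))).
  have M0 : 0 < M by case: (M) iM.
  have nz' k : k < M -> (z == c k) = false.
    by move=> kM; apply/negbTE; have := cP k kM; rewrite in_setD1 => /andP[]; rewrite eq_sym.
  by rewrite !nz' ?ltn_mod.
by apply: cadj => //; rewrite in_setD1 yz.
Qed.

(** The triangle [v b cc] survives the deletion, so the hole avoids it. The hole edge along which
    [a] is attached gives [x] and [y], and the other hole neighbour of [x] gives [p]. *)
Lemma pendant_hole_guard P v a b cc d e M c :
  v \in P -> b \in P -> cc \in P ->
  pendant_config v a b cc d e -> no_odd_hole P -> odd_hole (P :\ a) M c ->
  exists x y p, [/\ x \in P :\ a, y \in P :\ a, p \in P & guard P a b v x y p].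
Proof.
move=> vP bP cP H nP hole; use_pendant H.
have [i [j [k [/and3P[iM jM kM] /and3P[zi zj ij] /and3P[ik jk njk] dx]]]] :=
  odd_hole_attached nP hole.
have [_ _ _ hP _] := hole.
have vPa : v \in P :\ a by rewrite !inE vP andbT; adj_neq.
have bPa : b \in P :\ a by rewrite !inE bP andbT; adj_neq.
have cPa : cc \in P :\ a by rewrite !inE cP andbT; adj_neq.
have vn l : l < M -> c l != v.
  by move=> lM; apply/eqP => e'; have := odd_hole_triangle hole lM bPa cPa; rewrite e' vb vc bc => /(_ isT isT).
have bv : adj b v by rewrite adj_sym.
have cb : adj cc b by rewrite adj_sym.
have cv : adj cc v by rewrite adj_sym.
have bn l : l < M -> c l != b.
  by move=> lM; apply/eqP => e'; have := odd_hole_triangle hole lM vPa cPa; rewrite e' bv bc vc => /(_ isT isT).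
have cn l : l < M -> c l != cc.
  by move=> lM; apply/eqP => e'; have := odd_hole_triangle hole lM vPa bPa; rewrite e' cv cb vb => /(_ isT isT).
have nv l : l < M -> adj a (c l) -> ~~ adj (c l) v.
  by move=> lM al; apply: (pendant_hub noclaw noK5 H); rewrite ?bn ?cn.
have nb l : l < M -> adj a (c l) -> ~~ adj (c l) b.
  move=> lM al; apply/negP => lb.
  have lc := pendant_outer noclaw noK5 H al (nv l lM al) (vn l lM) lb.
  by have := odd_hole_triangle hole lM bPa cPa; rewrite lb lc bc => /(_ isT isT).
have pa : ~~ adj (c k) a.
  apply/negP => ka; rewrite adj_sym in ka.
  by rewrite (pendant_outer_clique noclaw H zj ka) ?nv ?vn in jk.
exists (c i), (c j), (c k).
split; rewrite ?hP //; first by have := hP k kM; rewrite inE => /andP[].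
rewrite /guard zi zj ij ik !nv // !nb // pa adj_sym jk /=.
apply/forall_inP => w wP; apply/implyP => iw; have [//|wa] := eqVneq w a.
by apply: dx; rewrite // !inE wa.
Qed.

(** A new hole avoids [a], which lies in the triangle [a b cc], and hence avoids the neighbour [y]
    of [a]. It can then meet the neighbourhood of [x] only in [p], although it must be attached to
    [x] along an edge. *)
Lemma guard_no_odd_hole P v a b cc d e x y p :
  a \in P -> b \in P -> cc \in P -> y \in P -> p \in P ->
  pendant_config v a b cc d e -> guard P a b v x y p -> no_odd_hole P ->
  no_odd_hole (P :\ x).
Proof.
move=> aP bP cP yP pP H Hg nP M c hole; use_pendant H.
have /and5P[ax ay xy xp /and5P[xv yv xb yb /and3P[pa py /forall_inP dx]]] := Hg.
have [i [j [k [/and3P[iM jM kM] /and3P[zi zj ij] _ _]]]] := odd_hole_attached nP hole.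
have [_ _ _ hP _] := hole.
have aPx : a \in P :\ x by rewrite !inE aP andbT; adj_neq.
have bPx : b \in P :\ x by rewrite !inE bP andbT; adj_neq.
have xc : ~~ adj x cc.
  by apply: contra xb; apply: (pendant_outer noclaw noK5 (pendant_configC H)); adj_auto.
have cPx : cc \in P :\ x by rewrite !inE cP andbT; adj_neq.
have na l : l < M -> c l != a.
  by move=> lM; apply/eqP => el; have := odd_hole_triangle hole lM bPx cPx; rewrite el ab ac bc => /(_ isT isT).
have np l : l < M -> adj x (c l) -> c l = p.
  move=> lM xl; have lP : c l \in P by have := hP l lM; rewrite inE => /andP[].
  have /implyP/(_ xl)/or3P[/eqP el|/eqP el|/eqP //] := dx _ lP.
    by have := na l lM; rewrite el eqxx.
  have ya : adj (c l) a by rewrite el adj_sym.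
  by have [m mM em] := odd_hole_closed hole lM aPx ya; have := na m mM; rewrite em eqxx.
by move: ij; rewrite (np i) // (np j) // adj_irr.
Qed.

(** A hole created by deleting [a] would need two neighbours of [a] away from the wheel, and only
    [y] is left. *)
Lemma guarded_no_odd_hole P v a b cc d e x y p :
  v \in P -> b \in P -> cc \in P ->
  pendant_config v a b cc d e -> guard P a b v x y p ->
  no_odd_hole (P :\ x) -> no_odd_hole (P :\ x :\ a).
Proof.
move=> vP bP cP H Hg nP M c hole; use_pendant H.
have /and5P[ax ay xy xp /and5P[xv yv xb yb /and3P[pa py /forall_inP dx]]] := Hg.
have xc : ~~ adj x cc.
  by apply: contra xb; apply: (pendant_outer noclaw noK5 (pendant_configC H)); adj_auto.
have vPx : v \in P :\ x by rewrite !inE vP andbT; adj_neq.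
have bPx : b \in P :\ x by rewrite !inE bP andbT; adj_neq.
have cPx : cc \in P :\ x by rewrite !inE cP andbT; adj_neq.
have [x' [y' [p' [x'P y'P p'P /and5P[ax' ay' xy' xp' /and5P[xv' yv' xb' yb' _]]]]]] :=
  pendant_hole_guard vPx bPx cPx H nP hole.
have out w : w \in P :\ x :\ a -> adj a w -> ~~ adj w v -> ~~ adj w b -> w = y.
  rewrite !inE => /and3P[wa wx wP] aw wv wb.
  by apply: (guard_unique noclaw H Hg); adj_auto.
by move: xy'; rewrite (out x') // (out y') // adj_irr.
Qed.

Definition dominated P u v :=
  adj v u && [forall w in P, adj u w ==> (w == v) || adj v w].

(** A clique blocking [u] needs a member not adjacent to [v]; by domination this is [v] itself, so
    the colour opposite to that of [v] is free. *)
Lemma dominated_colourable P f u v :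
  v \in P -> dominated P u v -> exists q, ~~ blocked P (P :\ u) f u q.
Proof.
move=> vP /andP[vu /forall_inP dom]; exists (~~ f v).
apply/blockedP => -[K /blockP[_ Ka Kc Km]].
have uv : adj u v by rewrite adj_sym.
have [k kK vk] := Km v vP uv; have [kP _ uk fk] := Ka k kK.
have /implyP/(_ uk)/orP[/eqP kv|] := dom k kP; last by rewrite (negbTE vk).
by move: fk; rewrite kv; case: (f v).
Qed.

(** A new hole is attached to [u], so by domination it contains [v]. Since [v] then lies in no
    triangle of [P :\ u], the disjoint rim edges [u1 u2] and [u3 u4] would both have to contain
    [u]. *)
Lemma dominated_no_odd_hole P u v u1 u2 u3 u4 u5 :
  v \in P -> u1 \in P -> u2 \in P -> u3 \in P -> u4 \in P -> u5 \in P ->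
  wheel_config v u1 u2 u3 u4 u5 -> dominated P u v ->
  no_odd_hole P -> no_odd_hole (P :\ u).
Proof.
move=> vP P1 P2 P3 P4 P5 H /andP[vu /forall_inP dom] nP M c hole; use_wheel H.
have [i [j [k [/and3P[iM jM kM] /and3P[zi zj ij] _ _]]]] := odd_hole_attached nP hole.
have vPu : v \in P :\ u by rewrite !inE vP andbT; adj_neq.
have [_ _ _ hP _] := hole.
have [l lM lv] : exists2 l, l < M & c l = v.
  have iP : c i \in P by have := hP i iM; rewrite inE => /andP[].
  have /implyP/(_ zi)/orP[/eqP iv|vi] := dom _ iP; first by exists i.
  by apply: (odd_hole_closed hole iM vPu); rewrite adj_sym.
have tri w1 w2 : w1 \in P -> w2 \in P -> adj v w1 -> adj v w2 -> adj w1 w2 ->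
    (w1 == u) || (w2 == u).
  move=> w1P w2P vw1 vw2 w12; rewrite -[_ || _]negbK negb_or; apply/negP => /andP[n1 n2].
  have w1P' : w1 \in P :\ u by rewrite in_setD1 n1.
  have w2P' : w2 \in P :\ u by rewrite in_setD1 n2.
  by have := odd_hole_triangle hole lM w1P' w2P'; rewrite lv vw1 vw2 w12 => /(_ isT isT).
have t1 := tri _ _ P1 P2 v1 v2 u12; have t3 := tri _ _ P3 P4 v3 v4 u34.
case/orP: t1 => /eqP e1; case/orP: t3 => /eqP e3.
- by move: n41; rewrite e1 -e3 adj_sym u34.
- by move: n13; rewrite e1 -e3 adj_sym u34.
- by move: u23; rewrite e1 -e3 adj_irr.
- by move: n41; rewrite e3 -e1 adj_sym u12.
Qed.

Lemma wheel_rot v u1 u2 u3 u4 u5 :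
  wheel_config v u1 u2 u3 u4 u5 -> wheel_config v u2 u3 u4 u5 u1.
Proof.
move=> H; use_wheel H; rewrite /wheel_config; adj_eval.
by rewrite n24 n35 n41 n52.
Qed.

Lemma wheel_rev v u1 u2 u3 u4 u5 :
  wheel_config v u1 u2 u3 u4 u5 -> wheel_config v u3 u2 u1 u5 u4.
Proof.
move=> H; use_wheel H; rewrite /wheel_config; adj_eval.
by rewrite (adj_sym u3) n13 (adj_sym u2) n52 (adj_sym u1) n41 (adj_sym u5) n35 (adj_sym u4) n24.
Qed.

Lemma wheel_rim3 v u1 u2 u3 u4 u5 x :
  wheel_config v u1 u2 u3 u4 u5 -> adj v x -> x \notin [:: u1; u2; u3; u4; u5] ->
  ~~ [&& adj x u1, adj x u2 & adj x u3].
Proof.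
move=> H vx; rewrite !inE !negb_or => /and5P[x1 x2 x3 x4 x5]; use_wheel H.
apply/and3P => -[a1 a2 a3]; apply: noK5.
by model_of [:: [:: v]; [:: x]; [:: u1]; [:: u2]; [:: u3; u4; u5]].
Qed.

(** By claw-freeness the rim vertices that [x] misses are pairwise adjacent, so [x] would see three
    consecutive ones, against [wheel_rim3]. The rim is thus the whole neighbourhood of the hub in
    [G], whatever the set [P]. *)
Lemma wheel_rim v u1 u2 u3 u4 u5 x :
  wheel_config v u1 u2 u3 u4 u5 -> adj v x -> x \in [:: u1; u2; u3; u4; u5].
Proof.
move=> H vx; apply/negPn/negP => nx.
have rot1 (t1 t2 t3 t4 t5 : G) : x \notin [:: t1; t2; t3; t4; t5] -> x \notin [:: t2; t3; t4; t5; t1].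
  by rewrite !inE !negb_or => /and5P[-> -> -> -> ->].
have H2 := wheel_rot H; have H3 := wheel_rot H2; have H4 := wheel_rot H3; have H5 := wheel_rot H4.
have x2 := rot1 _ _ _ _ _ nx; have x3 := rot1 _ _ _ _ _ x2.
have x4 := rot1 _ _ _ _ _ x3; have x5 := rot1 _ _ _ _ _ x4.
have c1 := wheel_rim3 H vx nx; have c2 := wheel_rim3 H2 vx x2.
have c3 := wheel_rim3 H3 vx x3; have c4 := wheel_rim3 H4 vx x4.
have c5 := wheel_rim3 H5 vx x5; use_wheel H.
move: (nx); rewrite !inE !negb_or => /and5P[y1 y2 y3 y4 y5].
have nb (s t : G) : adj v s -> adj v t -> x != s -> x != t -> s != t -> ~~ adj s t ->
    adj x s || adj x t.
  move=> vs vt xs xt st nst; rewrite -[_ || _]negbK negb_or; apply/negP => /andP[ns nt].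
  by move/negP: nst; apply; apply: (claw_free vs vx vt); adj_auto.
have o13 : adj x u1 || adj x u3 by apply: nb; adj_auto.
have o24 : adj x u2 || adj x u4 by apply: nb; adj_auto.
have o35 : adj x u3 || adj x u5 by apply: nb; adj_auto.
have o41 : adj x u4 || adj x u1 by apply: nb; adj_auto.
have o52 : adj x u5 || adj x u2 by apply: nb; adj_auto.
move: o13 o24 o35 o41 o52 c1 c2 c3 c4 c5.
by case: (adj x u1); case: (adj x u2); case: (adj x u3); case: (adj x u4); case: (adj x u5).
Qed.

(** The hole vertex [c i] attached to [v] is on the rim. Besides its two rim neighbours it has, not
    being dominated, a neighbour outside the neighbourhood of [v]: too many for a hole vertex. *)
Lemma wheel_no_odd_hole P v u1 u2 u3 u4 u5 :
  v \in P -> u1 \in P -> u2 \in P -> u3 \in P -> u4 \in P -> u5 \in P ->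
  wheel_config v u1 u2 u3 u4 u5 ->
  (forall u, u \in P -> ~~ dominated P u v) -> no_odd_hole P -> no_odd_hole (P :\ v).
Proof.
move=> vP P1 P2 P3 P4 P5 H ndom nP M c hole.
have [i [j [k [/and3P[iM jM kM] /and3P[zi zj ij] /and3P[ik jk njk] dx]]]] :=
  odd_hole_attached nP hole.
have [_ _ _ hP _] := hole; use_wheel H.
have iP : c i \in P by have := hP i iM; rewrite inE => /andP[].
have [l [r [_ _ nlr lr ad]]] := odd_hole_nbrs hole iM.
have Pv u : u \in P -> adj v u -> u \in P :\ v by move=> uP vu; rewrite !inE uP andbT; adj_neq.
have tri w1 w2 w3 : w1 \in P :\ v -> w2 \in P :\ v -> w3 \in P :\ v ->
  adj (c i) w1 -> adj (c i) w2 -> adj (c i) w3 -> [|| w1 == w2, w2 == w3 | w1 == w3].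
  by move=> p1 p2 p3; rewrite !ad // => /orP[]/eqP-> /orP[]/eqP-> /orP[]/eqP->; rewrite eqxx ?orbT.
have [w wP [iw [wv vw]]] : exists2 w, w \in P & adj (c i) w /\ w != v /\ ~~ adj v w.
  have := ndom _ iP; rewrite /dominated zi /= => /forall_inPn[w wP].
  by rewrite negb_imply negb_or => /and3P[iw wv vw]; exists w.
have wPv : w \in P :\ v by rewrite !inE wv.
have nb s t : s \in P -> t \in P -> adj v s -> adj v t -> adj (c i) s -> adj (c i) t ->
    s != t -> False.
  move=> sP tP vs vt si ti st; have := tri s t w (Pv s sP vs) (Pv t tP vt) wPv si ti iw.
  rewrite (negbTE st) /= => /orP[]/eqP e; first by rewrite -e vt in vw.
  by rewrite -e vs in vw.
have := wheel_rim H zi; rewrite !inE => /or4P[/eqP e|/eqP e|/eqP e|/orP[]/eqP e];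
  [apply: (nb u2 u5) | apply: (nb u1 u3) | apply: (nb u2 u4) | apply: (nb u3 u5) | apply: (nb u4 u1)];
  rewrite ?e; adj_auto.
Qed.

End Deletion.

(** * Colouring the hub of a 5-wheel *)

Section Recolouring.
Variable G : sgraph.
Implicit Types (h u v p q : G) (P C K : {set G}) (f : G -> bool).

(** The disjunction makes [p = q] a single flip, and [h] receives [c] even if it equals [p] or
    [q]. *)
Definition recolour f h (c : bool) p q : G -> bool :=
  fun x => if x == h then c else f x (+) ((x == p) || (x == q)).

Lemma recolour_blocked P f h c p q :
  h \in P -> valid P (P :\ h) f -> ~~ valid P P (recolour f h c p q) ->
  exists u, [/\ u \in P, [|| u == h, u == p | u == q]
    & blocked P P (recolour f h c p q) u (recolour f h c p q u)].
Proof.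
move=> hP vf nv.
have [/exists_inP[u uP /andP[uD bu]]|/exists_inPn none] := boolP [exists u in P,
    [|| u == h, u == p | u == q] && blocked P P (recolour f h c p q) u (recolour f h c p q u)].
  by exists u.
case/negP: nv; apply: (valid_change (D := [set x | [|| x == h, x == p | x == q]]) vf).
- by apply/subsetP => x; rewrite !inE => /andP[]; rewrite negb_or => /andP[-> _].
- by move=> x; rewrite !inE /recolour => /andP[]; case: (x == h) => //= /negPf-> _; rewrite addbF.
by move=> u uP _; rewrite inE => uD; have := none u uP; rewrite uD.
Qed.

End Recolouring.

Section WheelRecolouring.
Variable G : sgraph.
Hypotheses (noclaw : ~ contains_induced claw G) (noK5 : ~ minor (complete 5) G).
Implicit Types (a b d e h u v w x y z p q k : G) (P C K : {set G}) (f g : G -> bool).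

Let claw_free := claw_free noclaw.

Section Rim.
Variables v u1 u2 u3 u4 u5 : G.
Hypothesis H : wheel_config v u1 u2 u3 u4 u5.

Lemma wheel_outer_side x : adj u2 x -> ~~ adj v x -> x != v -> ~~ adj x u1 -> adj x u3.
Proof.
use_wheel H => ax vx xv nx; have u21 : adj u2 u1 by rewrite adj_sym.
by apply: (claw_free ax u21 u23); adj_auto.
Qed.

Lemma wheel_outer_clique x y : adj u2 x -> adj u2 y -> ~~ adj v x -> ~~ adj v y ->
  x != v -> y != v -> x != y -> adj x y.
Proof.
use_wheel H => ax ay vx vy xv yv xy; have u2v : adj u2 v by rewrite adj_sym.
by apply: (claw_free ax u2v ay); adj_auto.
Qed.

(** Three such vertices form K4 with [u2], and each of them is adjacent to the path [u1 v u3] by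
    [wheel_outer_side]: a K5 minor. *)
Lemma wheel_outer2 x y z : adj u2 x -> adj u2 y -> adj u2 z ->
  ~~ adj v x -> ~~ adj v y -> ~~ adj v z -> x != v -> y != v -> z != v ->
  x != y -> z != x -> z = y.
Proof.
move=> ax ay az vx vy vz xv yv zv xy zx; apply/eqP/negPn/negP => zy; use_wheel H.
have xy' := wheel_outer_clique ax ay vx vy xv yv xy.
have zx' := wheel_outer_clique az ax vz vx zv xv zx.
have zy' := wheel_outer_clique az ay vz vy zv yv zy.
have side t (at_ : adj u2 t) (vt : ~~ adj v t) (tv : t != v) :
    has_edge adj [:: t] [:: u1; v; u3].
  rewrite /has_edge /=; case: (boolP (adj t u1)) => //= t1.
  by rewrite (wheel_outer_side at_ vt tv t1) orbT.
have := side x ax vx xv; have := side y ay vy yv; have := side z az vz zv => sz sy sx.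
apply: noK5; apply: (@minor_of_paths _ [:: [:: u2]; [:: x]; [:: y]; [:: z]; [:: u1; v; u3]]).
- by [].
- by rewrite /=; adj_eval.
- by rewrite /= ?inE ?negb_or; repeat (apply/andP; split); (done || adj_neq).
by move: sx sy sz; rewrite /has_edge /=; adj_eval; move=> -> -> ->; rewrite ?orbT.
Qed.

End Rim.

(* The hub [v] is blocked in both colours exactly for the cyclic rim pattern
   [r r r ~r ~r]; the hypothesis [stuck] says that no recolouring helps. *)
Section Stuck.
Variables (P : {set G}) (f : G -> bool) (r : bool) (v : G).
Hypotheses (pf : pendant_free P) (vP : v \in P)
  (vf : valid (P :\ v) (P :\ v) f)
  (stuck : forall c p q, p \in P -> q \in P -> adj v p -> (q == p) || adj p q ->
     ~~ valid P P (recolour f v c p q)).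

Let vf' := valid_reinsert vf.

Section Pattern.
Variables u1 u2 u3 u4 u5 : G.
Hypothesis H : wheel_config v u1 u2 u3 u4 u5.
Hypotheses (P1 : u1 \in P) (P2 : u2 \in P) (P3 : u3 \in P) (P4 : u4 \in P) (P5 : u5 \in P).
Hypotheses (f1 : f u1 = r) (f2 : f u2 = r) (f3 : f u3 = r) (f4 : f u4 = ~~ r) (f5 : f u5 = ~~ r).

Let rim x : adj v x -> x \in [:: u1; u2; u3; u4; u5].
Proof. exact: wheel_rim. Qed.

(** The attempt colours [v] with [r] and flips [u2]. The hub is then free, as [u1] and [u3] are both
    adjacent to [u2]; so [u2] is blocked, by a clique away from the wheel whose members missing [u3]
    and [u1] are [x] and [y]. *)
Lemma stuck_junction : exists x y,
  [/\ [/\ x \in P, y \in P, f x = ~~ r & f y = ~~ r],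
      [/\ ~~ adj v x, ~~ adj v y, x != v & y != v],
      [/\ adj u2 x, adj u2 y & adj x y]
    & [/\ adj x u1, ~~ adj x u3, adj y u3 & ~~ adj y u1]].
Proof.
use_wheel H.
have [u [uP uD]] := recolour_blocked vP vf' (stuck r P2 P2 v2 (introT orP (or_introl (eqxx _)))).
have n42 : u4 != u2 by adj_neq.
have n52' : u5 != u2 by adj_neq.
have ne2 : u2 == v = false by apply/negbTE; adj_neq.
rewrite orbb in uD; case/orP: uD => /eqP ->; rewrite {2}/recolour ?eqxx ?ne2 /=.
  case/blockedP => K /blockP[_ Ka Kc Km]; exfalso.
  have [k kK k2] := Km u2 P2 v2; have [kP _ vk gk] := Ka k kK.
  have := rim vk; rewrite !inE => /or4P[/eqP e|/eqP e|/eqP e|/orP[]/eqP e]; move: gk;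
    rewrite /recolour e.
  - by rewrite e adj_sym u12 in k2.
  - by rewrite ne2 eqxx f2; case: (r).
  - by rewrite e u23 in k2.
  - by rewrite ifN ?f4 ?(negbTE n42) /=; [case: (r) | adj_neq].
  - by rewrite ifN ?f5 ?(negbTE n52') /=; [case: (r) | adj_neq].
rewrite f2 addbT => /blockedP[K /blockP[_ Ka Kc Km]].
have u21 : adj u2 u1 by rewrite adj_sym.
have [y yK y1] := Km u1 P1 u21; have [x xK x3] := Km u3 P3 u23.
have out k : k \in K -> [/\ k \in P, adj u2 k, f k = ~~ r, k != v & ~~ adj v k].
  move=> kK; have [kP _ uk] := Ka k kK; rewrite /recolour.
  have [->|kv] := eqVneq k v; first by case: (r).
  have ku2 : k != u2 by adj_neq.
  rewrite orbb (negbTE ku2) addbF => fk; split=> //; apply/negP => /rim.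
  rewrite !inE => /or4P[/eqP e|/eqP e|/eqP e|/orP[]/eqP e]; move: fk uk; rewrite e ?f1 ?f2 ?f3.
  - by case: (r).
  - by case: (r).
  - by case: (r).
  - by rewrite (negbTE n24).
  - by rewrite adj_sym (negbTE n52).
have [xP ux fx xv vx] := out x xK; have [yP uy fy yv vy] := out y yK.
have y1' : ~~ adj y u1 by rewrite adj_sym.
have x3' : ~~ adj x u3 by rewrite adj_sym.
have y3 := wheel_outer_side H uy vy yv y1'.
have x1 := wheel_outer_side (wheel_rev H) ux vx xv x3'.
have xy : x != y by adj_neq.
by exists x, y; do !split=> //; apply: (wheel_outer_clique H).
Qed.

Lemma far_hub_free g : g u1 = r -> g u2 = r -> g u3 = r -> g u4 = r ->
  ~~ blocked P P g v (~~ r).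
Proof.
use_wheel H => g1 g2 g3 g4; apply/blockedP => -[K /blockP[_ Ka Kc Km]].
have [k kK k1] := Km u1 P1 v1; have [_ _ vk gk] := Ka k kK.
have := rim vk; rewrite !inE => /or4P[/eqP e|/eqP e|/eqP e|/orP[]/eqP e]; move: gk; rewrite e.
- by rewrite g1; case: (r).
- by rewrite g2; case: (r).
- by rewrite g3; case: (r).
- by rewrite g4; case: (r).
by rewrite e adj_sym u51 in k1.
Qed.

(** The clique has a member missing [v]. If that member also misses [u3], claw-freeness at [u4]
    makes it adjacent to [u5]; then the member that misses [u5] is adjacent to [u3]. *)
Lemma far_block g K : g v = ~~ r -> g u5 = ~~ r -> block P P g u4 r K ->
  exists2 w, w \in K & [/\ w \in P, adj u4 w, adj u3 w, ~~ adj v w & w != v].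
Proof.
use_wheel H => gv g5 /blockP[_ Ka Kc Km].
have u4v : adj u4 v by rewrite adj_sym.
have u43 : adj u4 u3 by rewrite adj_sym.
have out k : k \in K -> k != u3 -> [/\ ~~ adj v k, k != v & k != u5].
  move=> kK k3; have [kP _ uk gk] := Ka k kK.
  have kv : k != v by apply/eqP => e; move: gk; rewrite e gv; case: (r).
  have k5 : k != u5 by apply/eqP => e; move: gk; rewrite e g5; case: (r).
  split=> //; apply/negP => /rim.
  rewrite !inE (negbTE k3) (negbTE k5) !orbF /= => /or3P[]/eqP e; move: uk; rewrite e ?adj_irr //.
    by rewrite (negbTE n41).
  by rewrite adj_sym (negbTE n24).
have [k kK vk] := Km v vP u4v; have [kP _ uk gk] := Ka k kK.
have k3 : k != u3 by adj_neq.
have [_ kv k5] := out k kK k3.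
have [uk3|uk3] := boolP (adj u3 k); first by exists k.
have k5' : adj k u5 by rewrite adj_sym; apply: (claw_free u45 u43 uk); adj_auto.
have [j jK j5] := Km u5 P5 u45; have [jP _ uj gj] := Ka j jK.
have jk : j != k by adj_neq.
have j3 : j != u3.
  apply/eqP => e; move: (Kc j k jK kK jk); rewrite e; exact/negP.
have [vj jv j5'] := out j jK j3.
by exists j => //; split=> //; rewrite adj_sym; apply: (claw_free uj u45 u43); adj_auto.
Qed.

Lemma stuck_side : exists w,
  [/\ w \in P, f w = r, adj u4 w, adj u3 w & ~~ adj v w /\ w != v].
Proof.
use_wheel H.
have [u [uP uD]] := recolour_blocked vP vf' (stuck (~~ r) P4 P4 v4 (introT orP (or_introl (eqxx _)))).
set g := recolour _ _ _ _ _.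
have gE x : x != v -> x != u4 -> g x = f x.
  by move=> xv x4; rewrite /g /recolour (negbTE xv) (negbTE x4) addbF.
have gv : g v = ~~ r by rewrite /g /recolour eqxx.
have g4 : g u4 = r.
  have n4v : u4 != v by adj_neq.
  by rewrite /g /recolour (negbTE n4v) eqxx f4 addbT negbK.
have g5 : g u5 = ~~ r by rewrite gE // ; adj_neq.
rewrite orbb in uD; case/orP: uD => /eqP ->.
  have g1 : g u1 = r by rewrite gE //; adj_neq.
  have g2 : g u2 = r by rewrite gE //; adj_neq.
  have g3 : g u3 = r by rewrite gE //; adj_neq.
  by rewrite gv (negbTE (far_hub_free g1 g2 g3 g4)).
rewrite g4 => /blockedP[K bK]; have [w wK [wP w4 w3 vw wv]] := far_block gv g5 bK.
exists w; split=> //; rewrite -gE //; last by adj_neq.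
exact: block_color bK wK.
Qed.

(** By [wheel_outer2], the neighbours of [u2] away from the hub are [x] and [y], and those of [u3]
    are [y] and [w]. If [y] saw [u4], then [w] would be pendant on the 4-wheel with hub [u3]. The
    attempt colours [v] with [~~ r] and flips [u4] and [w]; it can fail only at [w], and the clique
    blocking [w] turns out to contain [x]. *)
Lemma stuck_cross x y w z :
  [/\ x \in P, y \in P, f x = ~~ r & f y = ~~ r] ->
  [/\ ~~ adj v x, ~~ adj v y, x != v & y != v] ->
  [/\ adj u2 x, adj u2 y & adj x y] ->
  [/\ adj x u1, ~~ adj x u3, adj y u3 & ~~ adj y u1] ->
  [/\ w \in P, f w = r, adj u4 w, adj u3 w & ~~ adj v w /\ w != v] ->
  [/\ z \in P, f z = r, adj u5 z, adj u1 z & ~~ adj v z /\ z != v] ->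
  ~~ adj y u4 /\ adj x w.
Proof.
move=> [xP yP fx fy] [vx vy xv yv] [ux uy xy] [x1 x3 y3 y1].
move=> [wP fw w4 w3 [vw wv]] [zP fz z5 z1 [vz zv]]; use_wheel H.
have H3 := wheel_rot H.
have u3y : adj u3 y by rewrite adj_sym.
have wy : w != y by adj_neq.
have yw : adj y w by apply: (wheel_outer_clique H3); adj_auto.
have u2w : ~~ adj u2 w.
  apply/negP => h; move: wy; apply/negP; rewrite negbK; apply/eqP.
  by apply: (wheel_outer2 H ux uy h) => //; adj_neq.
have y4 : ~~ adj y u4.
  apply/negP => h; move/negP: (pf P3 wP yP P4 vP P2); apply.
  rewrite /pendant_config; adj_eval.
  by rewrite /= (adj_sym w v) vw (adj_sym w) u2w (adj_sym y) vy (adj_sym u4) n24.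
split=> //.
have X2 t : t \in P -> t != v -> ~~ adj v t -> adj u2 t -> t != x -> t = y.
  by move=> tP tv vt u2t tx; apply: (wheel_outer2 H ux uy u2t) => //; adj_neq.
have X3 t : t \in P -> t != v -> ~~ adj v t -> adj u3 t -> t != y -> t = w.
  by move=> tP tv vt u3t ty; apply: (wheel_outer2 H3 u3y w3 u3t) => //; adj_neq.
have y5 : ~~ adj y u5.
  apply/negP => h; have h' : adj u5 y by rewrite adj_sym.
  have u54 : adj u5 u4 by rewrite adj_sym.
  by move/negP: n41; apply; apply: (claw_free u54 h' u51); adj_auto.
have [u [uP uD]] := recolour_blocked vP vf'
  (stuck (~~ r) P4 wP v4 (introT orP (or_intror w4))).
set g := recolour _ _ _ _ _.
have gE t : t != v -> t != u4 -> t != w -> g t = f t.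
  by move=> tv t4 tw; rewrite /g /recolour (negbTE tv) (negbTE t4) (negbTE tw) addbF.
have gv : g v = ~~ r by rewrite /g /recolour eqxx.
have g4 : g u4 = r.
  have n4v : u4 != v by adj_neq.
  by rewrite /g /recolour (negbTE n4v) eqxx f4 addbT negbK.
have gw : g w = ~~ r by rewrite /g /recolour (negbTE wv) eqxx orbT fw addbT.
have g1 : g u1 = r by rewrite gE //; adj_neq.
have g2 : g u2 = r by rewrite gE //; adj_neq.
have g3 : g u3 = r by rewrite gE //; adj_neq.
have g5 : g u5 = ~~ r by rewrite gE //; adj_neq.
case/or3P: uD => /eqP ->.
- by rewrite gv (negbTE (far_hub_free g1 g2 g3 g4)).
- rewrite g4 => /blockedP[K bK]; exfalso.
  have [t tK [tP t4 t3 vt tv]] := far_block gv g5 bK.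
  have := block_color bK tK.
  have [->|tw] := eqVneq t w; first by rewrite gw; case: (r).
  have ty : t != y by adj_neq.
  by rewrite (X3 t) // gw; case: (r).
rewrite gw => /blockedP[K bK]; have [_ Ka Kc Km] := blockP _ _ _ _ _ _ bK.
have w3' : adj w u3 by rewrite adj_sym.
have w4' : adj w u4 by rewrite adj_sym.
have w_y : adj w y by rewrite adj_sym.
(* Another such [k] would be adjacent to [x]. Then [x] and [k] would block [y] already under [f],
   unless some [t] is adjacent to both, which gives a K5 minor. *)
have near k : k \in K -> k != y -> adj k y -> k = x.
  move=> kK ky ky'; have [kP _ wk gk] := Ka k kK.
  have [//|kx] := eqVneq k x; exfalso.
  have kw : k != w by adj_neq.
  have kv : k != v by adj_neq.
  have k4 : k != u4 by adj_neq.
  have fk : f k = ~~ r by rewrite -gE.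
  have vk : ~~ adj v k.
    apply/negP => /rim; rewrite !inE => /or4P[/eqP e|/eqP e|/eqP e|/orP[]/eqP e].
    - by move: fk; rewrite e f1; case: (r).
    - by move: fk; rewrite e f2; case: (r).
    - by move: fk; rewrite e f3; case: (r).
    - by rewrite e eqxx in k4.
    - by move: ky'; rewrite e adj_sym (negbTE y5).
  have k2 : ~~ adj u2 k by apply: contraNN ky => h; rewrite (X2 k).
  have k3 : ~~ adj u3 k by apply: contraNN kw => h; rewrite (X3 k).
  have yk : adj y k by rewrite adj_sym.
  have yx : adj y x by rewrite adj_sym.
  have kx' : adj k x by apply: (claw_free yk y3 yx); adj_auto.
  have wnx : ~~ adj w x.
    apply/negP => h; move/negP: (pf yP kP xP wP P3 P2); apply.
    rewrite /pendant_config; adj_eval.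
    by rewrite /= (adj_sym k) k3 (adj_sym k) k2 x3 (adj_sym w) u2w.
  have yPv : y \in P :\ v by rewrite !inE yv.
  have /negP := validP _ _ _ vf y yPv yPv; apply.
  apply/blockedP; exists [set x; k]; apply/blockP; split.
  - by exists x; rewrite !inE eqxx.
  - move=> t; rewrite !inE => /orP[]/eqP->; split; rewrite ?xv ?kv //= ?fy //.
  - by move=> s t; rewrite !inE => /orP[]/eqP-> /orP[]/eqP->; rewrite ?eqxx // => _; rewrite // adj_sym.
  move=> t; rewrite !inE => /andP[tv tP] yt.
  have [tx|tx] := boolP (adj t x); last by exists x; rewrite ?inE ?eqxx.
  have [tk|tk] := boolP (adj t k); last by exists k; rewrite ?inE ?eqxx ?orbT.
  exfalso.
  have vt : ~~ adj v t.
    apply/negP => /rim; rewrite !inE => /or4P[/eqP e|/eqP e|/eqP e|/orP[]/eqP e]; move: yt tx tk; rewrite e.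
    - by rewrite (negbTE y1).
    - by rewrite (negbTE k2).
    - by rewrite (negbTE k3).
    - by rewrite (negbTE y4).
    - by rewrite (negbTE y5).
  have t2 : ~~ adj u2 t.
    apply/negP => h; have tx' : t != x by adj_neq.
    by move: yt; rewrite (X2 t) // adj_irr.
  have t3 : ~~ adj u3 t.
    apply/negP => h; have ty' : t != y by adj_neq.
    by move: tx; rewrite (X3 t) // (negbTE wnx).
  have yu2 : adj y u2 by rewrite adj_sym.
  have tw' : adj t w by apply: (claw_free yt yu2 yw); adj_auto.
  by apply: noK5; model_of [:: [:: y]; [:: t]; [:: k]; [:: x]; [:: u2; u3; w]].
have far k : k \in K -> k != y -> ~~ adj k y -> adj k u4.
  move=> kK ky nky; have [kP _ wk gk] := Ka k kK.
  by apply: (claw_free wk w_y w4'); adj_auto.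
suff xK : x \in K by rewrite adj_sym; have [_ _ ->] := Ka x xK.
have [k kK k3] := Km u3 P3 w3'; have ky : k != y by adj_neq.
have [ky'|ky'] := boolP (adj k y); first by rewrite -(near k).
have [j jK j4] := Km u4 P4 w4'.
have [jy|jy] := eqVneq j y.
  by move: (Kc k j kK jK); rewrite jy ky (negbTE ky') => /(_ isT).
have [jy'|jy'] := boolP (adj j y); first by rewrite -(near j).
by move: j4; rewrite adj_sym (far j).
Qed.

End Pattern.

(** Applying [stuck_cross] to the wheel and to its mirror image makes [x] the hub of a 4-wheel with
    rim [z y u2 u1], on which [w] is pendant. *)
Lemma stuck_pattern u1 u2 u3 u4 u5 :
  wheel_config v u1 u2 u3 u4 u5 ->
  u1 \in P -> u2 \in P -> u3 \in P -> u4 \in P -> u5 \in P ->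
  f u1 = r -> f u2 = r -> f u3 = r -> f u4 = ~~ r -> f u5 = ~~ r -> False.
Proof.
move=> H P1 P2 P3 P4 P5 f1 f2 f3 f4 f5; use_wheel H.
have [x [y [xyP xyv xyu xyn]]] := stuck_junction H P1 P2 P3 f1 f2 f3 f4 f5.
have [w hw] := stuck_side H P1 P4 P5 f1 f2 f3 f4 f5.
have Hr := wheel_rev H.
have [z hz] := stuck_side Hr P3 P5 P4 f3 f2 f1 f5 f4.
have [y4 xw] := stuck_cross H P1 P2 P3 P4 P5 f1 f2 f3 f4 f5 xyP xyv xyu xyn hw hz.
have [x5 yz] : ~~ adj x u5 /\ adj y z.
  case: xyP xyv xyu xyn => xP yP fx fy [vx vy xv yv] [ux uy xy] [x1 x3 y3 y1].
  apply: (stuck_cross Hr P3 P2 P1 P5 P4 f3 f2 f1 f5 f4 (z := w)); [by split | by split | | by split | exact: hz | exact: hw].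
  by split=> //; rewrite adj_sym.
case: xyP xyv xyu xyn => xP yP fx fy [vx vy xv yv] [ux uy xy] [x1 x3 y3 y1].
case: hw => wP fw w4 w3 [vw wv]; case: hz => zP fz z5 z1 [vz zv].
have u1x : adj u1 x by rewrite adj_sym.
have H3 := wheel_rot H; have H1 := wheel_rot (wheel_rot (wheel_rot H3)).
have wy : w != y by adj_neq.
have zy : z != y by adj_neq.
have yw : adj y w by apply: (wheel_outer_clique H3); adj_auto.
have xz : adj x z by apply: (wheel_outer_clique H1); adj_auto.
have u2w : ~~ adj u2 w.
  apply/negP => h; move: wy; apply/negP; rewrite negbK; apply/eqP.
  by apply: (wheel_outer2 H ux uy h) => //; adj_neq.
have u2z : ~~ adj u2 z.
  apply/negP => h; move: zy; apply/negP; rewrite negbK; apply/eqP.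
  by apply: (wheel_outer2 H ux uy h) => //; adj_neq.
have wz : w != z.
  apply/eqP => e; rewrite -e in z5 z1.
  have wx' : adj w x by rewrite adj_sym.
  have w3' : adj w u3 by rewrite adj_sym.
  have w5' : adj w u5 by rewrite adj_sym.
  by move/negP: x3; apply; rewrite adj_sym; apply: (claw_free w3' w5' wx'); adj_auto.
have u1w : ~~ adj u1 w.
  apply/negP => h; move: wz; apply/negP; rewrite negbK; apply/eqP.
  by apply: (wheel_outer2 H1 u1x z1 h) => //; adj_neq.
have xu2 : adj x u2 by rewrite adj_sym.
have wz' : adj w z by apply: (claw_free xw xu2 xz); adj_auto.
move/negP: (pf xP wP zP yP P2 P1); apply.
rewrite /pendant_config; adj_eval.
by rewrite /= (adj_sym w) u2w (adj_sym w) u1w (adj_sym z) u2z y1.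
Qed.

End Stuck.
End WheelRecolouring.

Section Resolvable.
Variable G : sgraph.
Implicit Types (h u v p q : G) (P C K : {set G}) (f : G -> bool).

(* The cases [p = h] and [q = p] describe fewer than two flips. *)
Definition resolvable P C f h := [exists c : bool, exists p in C, exists q in C,
  [&& (p == h) || adj h p, (q == p) || adj p q & valid P C (recolour f h c p q)]].

Lemma resolvableP P C f h :
  reflect (exists c p q, [/\ p \in C, q \in C, (p == h) || adj h p, (q == p) || adj p q
                         & valid P C (recolour f h c p q)]) (resolvable P C f h).
Proof.
apply: (iffP existsP) => [[c /exists_inP[p pC /exists_inP[q qC /and3P[]]]]|].
  by exists c, p, q.
move=> [c [p [q [pC qC hp pq vq]]]]; exists c; apply/exists_inP; exists p => //.
by apply/exists_inP; exists q; rewrite ?hp ?pq.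
Qed.

Lemma eq_valid P C f g : f =1 g -> valid P C f = valid P C g.
Proof.
move=> fg; apply: eq_forallb => u; congr (_ ==> (_ ==> ~~ _)); rewrite /blocked fg.
apply: eq_existsb => K; rewrite /block; congr [&& _, _, _ & _].
by apply: eq_forallb => x; rewrite fg.
Qed.

Lemma colourable_resolvable P C f h c : h \in C ->
  valid P (C :\ h) f -> ~~ blocked P (C :\ h) f h c -> resolvable P C f h.
Proof.
move=> hC vf nb; apply/resolvableP; exists c, h, h; rewrite !eqxx; split=> //.
have := valid_colour vf _ nb; rewrite setD11 => /(_ isT); rewrite setD1K //.
by rewrite (@eq_valid _ _ _ (recolour f h c h h)) // => x; rewrite /recolour /upd orbb; case: eqP; rewrite ?addbF.
Qed.

End Resolvable.

Section Wheel.
Variable G : sgraph.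
Hypotheses (noclaw : ~ contains_induced claw G) (noK5 : ~ minor (complete 5) G).
Implicit Types (h u v p q k : G) (P C K : {set G}) (f : G -> bool).

(** A blocking clique consists of rim vertices, and by maximality it is an edge of the induced
    5-cycle. *)
Lemma wheel_blocked P C f v c u1 u2 u3 u4 u5 : wheel_config v u1 u2 u3 u4 u5 ->
  u1 \in P -> u2 \in P -> u3 \in P -> u4 \in P -> u5 \in P -> blocked P C f v c ->
  [|| (f u1 == c) && (f u2 == c), (f u2 == c) && (f u3 == c), (f u3 == c) && (f u4 == c),
      (f u4 == c) && (f u5 == c) | (f u5 == c) && (f u1 == c)].
Proof.
move=> H P1 P2 P3 P4 P5 /blockedP[K /blockP[[k kK] Ka Kc Km]]; use_wheel H.
have rim x : x \in K -> x \in [:: u1; u2; u3; u4; u5].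
  by move=> /Ka[_ _ vx _]; apply: (wheel_rim noclaw noK5 H).
have n_in x y : ~~ adj x y -> x != y -> x \in K -> y \in K -> False.
  by move=> nxy xy xK yK; rewrite Kc in nxy.
have fc x : x \in K -> f x == c by case/Ka => _ _ _ ->.
have nxt x y : y \in P -> adj v y -> adj y x -> x \in K -> exists2 z, z \in K & z != x /\ adj x z.
  move=> yP vy yx xK; have [z zK yz] := Km y yP vy.
  have zx : z != x by apply: contraNneq yz => ->.
  by exists z; rewrite // zx Kc // eq_sym.
have [z zK [zk kz]] : exists2 z, z \in K & z != k /\ adj k z.
  have := rim k kK; rewrite !inE => /or4P[/eqP e|/eqP e|/eqP e|/orP[]/eqP e].
  - by apply: (nxt k u2) => //; rewrite e; adj_auto.
  - by apply: (nxt k u3) => //; rewrite e; adj_auto.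
  - by apply: (nxt k u4) => //; rewrite e; adj_auto.
  - by apply: (nxt k u5) => //; rewrite e; adj_auto.
  - by apply: (nxt k u1) => //; rewrite e; adj_auto.
have := fc k kK; have := fc z zK; have := rim z zK; have := rim k kK.
rewrite !inE => /or4P[/eqP e|/eqP e|/eqP e|/orP[]/eqP e];
 move=> /or4P[/eqP e'|/eqP e'|/eqP e'|/orP[]/eqP e'];
 move: kz zk; rewrite e e' ?eqxx ?(negbTE n13) ?(negbTE n24) ?(negbTE n35) ?(negbTE n41) ?(negbTE n52);
 rewrite ?(adj_sym u3 u1) ?(adj_sym u4 u2) ?(adj_sym u5 u3) ?(adj_sym u1 u4) ?(adj_sym u2 u5);
 rewrite ?(negbTE n13) ?(negbTE n24) ?(negbTE n35) ?(negbTE n41) ?(negbTE n52) //;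
 by move=> _ _ -> ->; rewrite ?orbT.
Qed.

Lemma wheel_resolvable P f v u1 u2 u3 u4 u5 : wheel_config v u1 u2 u3 u4 u5 ->
  v \in P -> u1 \in P -> u2 \in P -> u3 \in P -> u4 \in P -> u5 \in P ->
  pendant_free P -> valid (P :\ v) (P :\ v) f -> resolvable P P f v.
Proof.
move=> H vP P1 P2 P3 P4 P5 pf vf; have [//|nres] := boolP (resolvable P P f v); exfalso.
have vf' := valid_reinsert vf.
have bl c : blocked P (P :\ v) f v c.
  have [//|nb] := boolP (blocked P (P :\ v) f v c); case/negP: nres.
  exact (colourable_resolvable vP vf' nb).
have stuck c p q : p \in P -> q \in P -> adj v p -> (q == p) || adj p q ->
    ~~ valid P P (recolour f v c p q).
  move=> pP qP vp pq; apply: contra nres => vr; apply/resolvableP.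
  by exists c, p, q; rewrite vp orbT.
have H2 := wheel_rot H; have H3 := wheel_rot H2; have H4 := wheel_rot H3; have H5 := wheel_rot H4.
have pat r w1 w2 w3 w4 w5 := @stuck_pattern _ noclaw noK5 P f r v pf vP vf stuck w1 w2 w3 w4 w5.
have := wheel_blocked H P1 P2 P3 P4 P5 (bl true).
have := wheel_blocked H P1 P2 P3 P4 P5 (bl false).
have t1 r := pat r _ _ _ _ _ H P1 P2 P3 P4 P5.
have t2 r := pat r _ _ _ _ _ H2 P2 P3 P4 P5 P1.
have t3 r := pat r _ _ _ _ _ H3 P3 P4 P5 P1 P2.
have t4 r := pat r _ _ _ _ _ H4 P4 P5 P1 P2 P3.
have t5 r := pat r _ _ _ _ _ H5 P5 P1 P2 P3 P4.
(* Two consecutive rim vertices of each colour leave only three consecutive ones of one colour and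
   two of the other: five rotations times two colours, the ten hypotheses [s1] to [s10]. *)
case e1: (f u1) (t1 true) (t1 false) (t2 true) (t2 false) (t3 true) (t3 false) (t4 true) (t4 false) (t5 true) (t5 false);
case e2: (f u2); case e3: (f u3); case e4: (f u4); case e5: (f u5) => //= s1 s2 s3 s4 s5 s6 s7 s8 s9 s10 _ _;
by (exact: s1 || exact: s2 || exact: s3 || exact: s4 || exact: s5 || exact: s6 || exact: s7 || exact: s8 || exact: s9 || exact: s10).
Qed.

End Wheel.

(** * Moving the hole *)

Section Tame.
Variable G : sgraph.
Hypothesis noclaw : ~ contains_induced claw G.
Implicit Types (h u v w x y b e a k : G) (P C K : {set G}) (f : G -> bool).

Lemma tame_same P C f h c K x : tame P -> h \in P -> blocked P C f h true ->
  blocked P C f h false -> block P C f h c K ->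
  x \in P -> adj h x -> f x = c -> x \in K.
Proof.
move=> tP hP bt bf bK xP hx fx; have [L bL] : exists L, block P C f h (~~ c) L.
  by apply/blockedP; case: (c).
have := tame_cover noclaw tP hP bK bL xP hx; rewrite inE => /orP[//|xL].
by have := block_color bL xL; rewrite fx; case: (c).
Qed.

(** Since [f] is total, [f x] makes sense even for an uncoloured [x]; the blocking clique of that
    colour must contain [x], and its members are coloured. *)
Lemma tame_coloured P C f h x : tame P -> h \in P -> blocked P C f h true ->
  blocked P C f h false -> x \in P -> adj h x -> x \in C.
Proof.
move=> tP hP bt bf xP hx; have [K bK] : exists K, block P C f h (f x) K.
  by apply/blockedP; case: (f x).
have xK := tame_same tP hP bt bf bK xP hx erefl.
by have [_ Ka _ _] := blockP _ _ _ _ _ _ bK; have [] := Ka x xK.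
Qed.

(* Every neighbour of the hole [h] with the colour of [a] lies in the same block
   as [a], hence is adjacent to [a]; so [a], no longer coloured, prevents [h] from
   being blocked in that colour. *)
Lemma tame_move P C f h a : tame P -> h \in P -> h \in C -> valid P (C :\ h) f ->
  blocked P (C :\ h) f h true -> blocked P (C :\ h) f h false -> a \in P -> adj h a ->
  valid P (C :\ a) (upd f h (f a)).
Proof.
move=> tP hP hC vf bt bf aP ha; apply: (valid_change (D := [set h]) vf).
- by apply/subsetP => x; rewrite !inE => /and3P[-> _ ->].
- by move=> x; rewrite !inE /upd => /andP[/negPf->].
move=> u uP uC; rewrite inE => /eqP ->; rewrite {2}/upd eqxx.
apply/blockedP => -[K /blockP[_ Ka Kc Km]].
have [L bL] : exists L, block P (C :\ h) f h (f a) L by apply/blockedP; case: (f a).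
have aL := tame_same tP hP bt bf bL aP ha erefl.
have [k kK ak] := Km a aP ha; have [kP kC hk] := Ka k kK.
have kh : k != h by adj_neq.
rewrite /upd (negbTE kh) => fk.
have kL := tame_same tP hP bt bf bL kP hk fk.
have [_ _ Lc _] := blockP _ _ _ _ _ _ bL.
have ka : k != a by move: kC; rewrite !inE => /andP[].
by rewrite Lc // eq_sym in ak.
Qed.

Definition line_like P C f h :=
  [/\ forall x, x \in P -> adj h x -> x \in C,
      forall x y, x \in P -> y \in P -> adj h x -> adj h y -> x != y ->
        adj x y = (f x == f y)
    & forall c : bool, exists2 x, x \in P & adj h x /\ f x = c].

Lemma unresolvable_blocked P C f h c : h \in C -> valid P (C :\ h) f ->
  ~~ resolvable P C f h -> blocked P (C :\ h) f h c.
Proof.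
by move=> hC vf; apply: contraNT; apply: colourable_resolvable.
Qed.

(** Suppose neighbours [b], [e] of [h] with different colours are adjacent. The hole is sent around
    the triangle [h b e], which ends with the colours of [b] and [e] exchanged. If some position can
    be coloured on the way, the result differs from [f] by flips of [b] and [e] at most, so [h] is
    resolvable. *)
Lemma stuck_line_like P C f h : tame P -> C \subset P -> h \in C ->
  valid P (C :\ h) f -> ~~ resolvable P C f h -> line_like P C f h.
Proof.
move=> tP /subsetP CP hC vf nres; have hP := CP h hC.
have bl c : blocked P (C :\ h) f h c by apply: unresolvable_blocked.
have [bt bf] := (bl true, bl false).
have colC x (xP : x \in P) (hx : adj h x) : x \in C.
  by have := tame_coloured tP hP bt bf xP hx; rewrite inE => /andP[].
split=> //; last first.
  move=> c; have [K /blockP[[x xK] Ka _ _]] := blockedP _ _ _ _ _ (bl c).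
  by exists x; have [] := Ka x xK.
move=> b e bP eP hb he be; have [fbe|fbe] := eqVneq (f b) (f e).
  have [K bK] := blockedP _ _ _ _ _ (bl (f b)).
  have [_ _ Kc _] := blockP _ _ _ _ _ _ bK.
  by apply: Kc => //; apply: (tame_same tP hP bt bf bK).
have fe : f e = ~~ f b by case: (f b) (f e) fbe => [] [].
apply/negbTE/negP => adbe; move/negP: nres; apply.
have bC := colC b bP hb; have eC := colC e eP he.
have bh : b != h by adj_neq.
have eh : e != h by adj_neq.
pose f1 := upd f h (f b); have v1 : valid P (C :\ b) f1 by apply: tame_move.
have f1e : f1 e = f e by rewrite /f1 /upd (negbTE eh).
have res c p q g : p \in C -> q \in C -> (p == h) || adj h p -> (q == p) || adj p q ->
    valid P C g -> g =1 recolour f h c p q -> resolvable P C f h.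
  by move=> pC qC hp pq vg gE; apply/resolvableP; exists c, p, q; rewrite -(eq_valid _ _ gE).
have [/existsP[c nb]|/existsPn b1] := boolP [exists c, ~~ blocked P (C :\ b) f1 b c].
  have := valid_colour v1 _ nb; rewrite setD11 setD1K // => /(_ isT) v1'.
  have [cb|cb] := eqVneq c (f b).
    apply: (res (f b) h h _ hC hC _ _ v1'); rewrite ?eqxx // => x.
    rewrite /upd /f1 /upd /recolour orbb cb; have [->|xb] := eqVneq x b.
      by rewrite (negbTE bh) addbF.
    by case: ifP; rewrite ?addbF.
  apply: (res (f b) b b _ bC bC _ _ v1'); rewrite ?hb ?orbT ?eqxx // => x.
  rewrite /upd /f1 /upd /recolour orbb; have [->|xb] := eqVneq x b.
    by rewrite (negbTE bh) addbT; case: (c) (f b) cb => [] [].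
  by case: ifP; rewrite ?addbF.
have bl1 c : blocked P (C :\ b) f1 b c by rewrite -[blocked _ _ _ _ _]negbK b1.
pose f2 := upd f1 b (f1 e); have v2 : valid P (C :\ e) f2.
  by apply: (tame_move tP bP bC v1).
have f2h : f2 h = f b by rewrite /f2 /f1 /upd (eq_sym h b) (negbTE bh) eqxx.
have [/existsP[c nb]|/existsPn e1] := boolP [exists c, ~~ blocked P (C :\ e) f2 e c].
  have := valid_colour v2 _ nb; rewrite setD11 setD1K // => /(_ isT) v2'.
  have [ce|ce] := eqVneq c (f e).
    apply: (res (f b) b b _ bC bC _ _ v2'); rewrite ?hb ?orbT ?eqxx // => x.
    rewrite /f2 /f1 /upd /recolour orbb; have [->|xe] := eqVneq x e.
      by rewrite (negbTE eh) eq_sym (negbTE be) addbF ce.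
    have [->|xb] := eqVneq x b; first by rewrite (negbTE eh) (negbTE bh) fe addbT.
    by case: ifP; rewrite ?addbF.
  apply: (res (f b) b e _ bC eC _ _ v2'); rewrite ?hb ?adbe ?orbT // => x.
  rewrite /f2 /f1 /upd /recolour; have [->|xe] := eqVneq x e.
    by rewrite (negbTE eh) orbT addbT; case: (c) (f e) ce => [] [].
  have [->|xb] := eqVneq x b; first by rewrite (negbTE eh) (negbTE bh) fe addbT.
  by case: ifP; rewrite ?addbF.
have bl2 c : blocked P (C :\ e) f2 e c by rewrite -[blocked _ _ _ _ _]negbK e1.
have eh' : adj e h by rewrite adj_sym.
pose f3 := upd f2 e (f2 h); have v3 : valid P (C :\ h) f3.
  by apply: (tame_move tP eP eC v2).
have f3b : f3 b = f e by rewrite /f3 /f2 /upd (negbTE be) eqxx f1e.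
have f3e : f3 e = f b by rewrite /f3 /upd eqxx.
have f3x x : x != h -> x != b -> x != e -> f3 x = f x.
  by move=> xh xb xe; rewrite /f3 /f2 /f1 /upd (negbTE xh) (negbTE xb) (negbTE xe).
have [/existsP[c nb]|/existsPn h1] := boolP [exists c, ~~ blocked P (C :\ h) f3 h c].
  have := valid_colour v3 _ nb; rewrite setD11 setD1K // => /(_ isT) v3'.
  apply: (res c b e _ bC eC _ _ v3'); rewrite ?hb ?adbe ?orbT // => x.
  rewrite /recolour {1}/upd; have [//|xh] := eqVneq x h.
  have [->|xb] := eqVneq x b; first by rewrite f3b addbT.
  have [->|xe] := eqVneq x e; first by rewrite f3e addbT fe negbK.
  by rewrite f3x // addbF.
have bl3 c : blocked P (C :\ h) f3 h c by rewrite -[blocked _ _ _ _ _]negbK h1.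
(* In the old block of colour [f b], some [k] misses [e]. After the round [e] has that colour too,
   and [k] has kept it, so both lie in the new block and are adjacent. *)
have [K bK] := blockedP _ _ _ _ _ (bl (f b)).
have [L bL] := blockedP _ _ _ _ _ (bl3 (f b)).
have [_ Ka _ Km] := blockP _ _ _ _ _ _ bK; have [_ _ Lc _] := blockP _ _ _ _ _ _ bL.
have eL : e \in L by apply: (tame_same tP hP (bl3 true) (bl3 false) bL).
have [k kK ek] := Km e eP he; have [kP kC hk fk] := Ka k kK.
have kb : k != b by apply: contraNneq ek => ->; rewrite adj_sym.
have ke : k != e by apply/eqP => E; move: fk; rewrite E fe; case: (f b).
have kh : k != h by adj_neq.
have kL : k \in L by apply: (tame_same tP hP (bl3 true) (bl3 false) bL) => //; rewrite f3x.
by rewrite Lc // eq_sym in ek.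
Qed.

End Tame.

(* [lia] restricted to the arithmetic part of the context: zify is slow on the rest. *)
Ltac nlia :=
  repeat match goal with
  | H : ?T |- _ =>
      lazymatch T with
      | is_true (leq _ _) => fail
      | is_true (leq _ _ && leq _ _) => fail
      | @eq nat _ _ => fail
      | @eq bool (odd _) _ => fail
      | is_true (odd _) => fail
      | is_true (~~ odd _) => fail
      | is_true (@eq_op _ _ _) => fail
      | is_true (~~ (@eq_op _ _ _)) => fail
      | nat => fail
      | _ => clear H
      end
  end; lia.

(* [c i] is the hole and [F i] the colouring before step [i]. *)
Section Walk.
Variables (G : sgraph) (P C : {set G}) (L : nat) (c : nat -> G) (F : nat -> G -> bool).
Hypothesis LL : forall i, i < L -> line_like P C (F i) (c i).
Hypothesis cP : forall i, i <= L -> c i \in P.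
Hypothesis cadj : forall i, i < L -> adj (c i) (c i.+1).
Hypothesis cstraight : forall i, i.+1 < L ->
  ~~ adj (c i) (c i.+2) && (c i != c i.+2).
Hypothesis Fstep : forall i, i < L -> F i.+1 =1 upd (F i) (c i) (F i (c i.+1)).
Hypothesis long : 2 * #|G| < L.

(** The colour left on [c i] when the hole moves on. *)
Let g i := F i (c i.+1).

Lemma walk_same i x y : i < L -> x \in P -> y \in P -> adj (c i) x -> adj (c i) y ->
  x != y -> adj x y = (F i x == F i y).
Proof. by move=> /LL[_ + _]; apply. Qed.

Lemma walk_visit i j : i < j -> j <= L -> (forall l, i < l -> l < j -> c l != c i) ->
  F j (c i) = g i.
Proof.
elim: j => // j IH; rewrite ltnS leq_eqVlt => /orP[/eqP<-|ij] jL no.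
  by rewrite Fstep // /upd eqxx.
rewrite Fstep // /upd eq_sym (negbTE (no j ij _)) // IH //; first exact: ltnW.
by move=> l il lj; apply: no => //; apply: ltnW.
Qed.

Lemma walk_unvisited j x : j <= L -> (forall l, l < j -> c l != x) -> F j x = F 0 x.
Proof.
elim: j => // j IH jL no; rewrite Fstep // /upd eq_sym (negbTE (no j _)) // IH //; first exact: ltnW.
by move=> l lj; apply: no; apply: ltnW.
Qed.

(** When the hole is at [c i.+1], the vertices [c i] and [c i.+2] are non-adjacent neighbours of it
    and so have different colours. *)
Lemma walk_alternates i : i.+1 < L -> g i.+1 = ~~ g i.
Proof.
move=> iL; have /andP[na ne] := cstraight iL.
have iL' := ltnW iL; have ac := cadj iL; have ac' := cadj iL'.
have E := @walk_same i.+1 (c i) (c i.+2) iL (cP (ltnW iL')) (cP iL).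
move: E; rewrite adj_sym ac' ac (negbTE na) ne => /(_ isT isT isT) /esym/eqP.
rewrite (@walk_visit i i.+1) //; last by move=> l; nlia.
by rewrite /g; case: (F i.+1 _) (F i _) => [] [].
Qed.

Lemma walk_parity i : i < L -> g i = g 0 (+) odd i.
Proof.
elim: i => [|i IH] iL; first by rewrite addbF.
by rewrite walk_alternates // IH ?(ltnW iL) //= addbN.
Qed.

Definition induced_path k := forall i j, i < j -> j <= k ->
  (c i != c j) && (adj (c i) (c j) == (j == i.+1)).

(** Here [m] is the least index at which the walk stops being an induced path; repetition among more
    than [#|G|] positions bounds it. What remains is to see that the only irregularity is the edge
    from [c m] to [c 0]. *)
Lemma walk_closes : exists m,
  [/\ 2 < m <= #|G|, induced_path m.-1, (forall i, i < m -> c i != c m),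
      adj (c 0) (c m) & forall i, 0 < i -> i.+1 < m -> ~~ adj (c i) (c m)].
Proof.
pose pred k := [exists i : 'I_k.+1, exists j : 'I_k.+1,
   (i < j) && ~~ ((c i != c j) && (adj (c i) (c j) == (j == i.+1 :> nat)))].
have predP k : ~~ pred k -> induced_path k.
  move=> np i j ij jk; apply: contraNT np => h.
  have ik : i < k.+1 by nlia.
  by apply/existsP; exists (Ordinal ik); apply/existsP; exists (Ordinal (jk : j < k.+1)); rewrite ij.
have predG : pred #|G|.
  have [//|/predP ip] := boolP (pred #|G|).
  have : injective (fun i : 'I_#|G|.+1 => c i).
    move=> i j e; apply/val_inj; case: (ltngtP i j) => // lt.
      by have := ip i j lt (leq_ord j); rewrite e eqxx.
    by have := ip j i lt (leq_ord i); rewrite e eqxx.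
  by move/leq_card; rewrite card_ord ltnn.
have ex : exists k, pred k by exists #|G|.
have [m pm min] := ex_minnP ex; have mG := min _ predG.
have m0 : 0 < m.
  case: (m) pm => // /existsP[[i ?]] /existsP[[j ?]] /=; nlia.
have ip : induced_path m.-1 by apply: predP; apply/negP => /min; nlia.
have [i im nip] : exists2 i, i < m & ~~ ((c i != c m) && (adj (c i) (c m) == (m == i.+1))).
  move: pm => /existsP[i /existsP[j /andP[ij nij]]].
  have [jm|jm] := ltnP j m; first by rewrite ip in nij => //; nlia.
  have ejm : j = m :> nat by have := ltn_ord j; nlia.
  by rewrite ejm in ij nij; exists i.
have mL : m < L by nlia.
have mL1 : m.-1 < L by nlia.
have am : adj (c m.-1) (c m) by have := cadj mL1; rewrite prednK.
have m1 : 1 < m.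
  case: (ltngtP m 1) => // [|m1]; first by nlia.
  move: nip; have -> : i = 0 by nlia.
  rewrite m1; rewrite m1 /= in am; rewrite am eqxx andbT negbK => /eqP e.
  by rewrite e adj_irr in am.
have [na2 ne2] : ~~ adj (c m.-2) (c m) /\ c m.-2 != c m.
  have mL2 : m.-2.+1 < L by nlia.
  by have /andP[] := cstraight mL2; have -> : m.-2.+2 = m by nlia.
have ne j : j < m -> c j != c m.
  move=> jm; have [->|j1] := eqVneq j m.-1; first by apply: adj_neq.
  have [->//|j2] := eqVneq j m.-2; apply/eqP => e.
  have h1 : j < m.-1 by nlia.
  have /andP[_ /eqP] := ip j m.-1 h1 (leqnn _); rewrite e adj_sym am; nlia.
have vis l : l < m.-1 -> F m (c l) = g l.
    move=> lm; have lm' : l < m by nlia.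
    apply: (@walk_visit l m lm' (ltnW mL)) => t l1 l2.
    have tm : t <= m.-1 by nlia.
    by rewrite eq_sym; have /andP[] := ip l t l1 tm.
(* Seen from [c j], the vertices before and after it are in different colour classes, so [c m] is
   adjacent to one of them. It then sees two consecutive path vertices, adjacent but left with
   different colours. *)
have amid j : 0 < j -> j.+1 < m -> ~~ adj (c j) (c m).
  move=> j0 jm; apply/negP => ajm.
  have j2 : j != m.-2 by apply: contraNneq na2 => <-.
  have bad k : k.+1 < m.-1 -> adj (c k) (c m) -> adj (c k.+1) (c m) -> False.
    move=> km a1 a2; have kL : k <= L by nlia.
    have kL1 : k.+1 <= L by nlia.
    have k1 : k < k.+1 by [].
    have kL2 : k.+1 <= m.-1 by nlia.
    have /andP[nk _] := ip k k.+1 k1 kL2.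
    have v1 : F m (c k) = g k by apply: vis; nlia.
    have v2 := vis _ km.
    have km' : k < L by nlia.
    have gk := @walk_alternates k; have {}gk := gk (leq_ltn_trans kL2 mL1).
    have E := @walk_same m (c k) (c k.+1) mL (cP kL) (cP kL1).
    move: E; rewrite !(adj_sym (c m)) a1 a2 nk (cadj km').
    move=> /(_ isT isT isT)/esym/eqP.
    by rewrite v1 v2 gk; case: (g k).
  have jL : j < L by nlia.
  have j1L : j.-1 < L by nlia.
  have a1 : adj (c j) (c j.-1) by rewrite adj_sym; have := cadj j1L; rewrite prednK.
  have a2 := cadj jL.
  have /andP[na n3] : ~~ adj (c j.-1) (c j.+1) && (c j.-1 != c j.+1).
    have h : j.-1.+1 < L by nlia.
    by have := cstraight h; rewrite prednK.
  have pP : c j.-1 \in P by apply: cP; nlia.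
  have nP : c j.+1 \in P by apply: cP; nlia.
  have mP : c m \in P by apply: cP; nlia.
  have := walk_same jL pP nP a1 a2 n3; rewrite (negbTE na) => /esym/negbT n4.
  have n5 : c j.-1 != c m by apply: ne; nlia.
  have n6 : c j.+1 != c m by apply: ne; nlia.
  have E1 := walk_same jL pP mP a1 ajm n5; have E2 := walk_same jL nP mP a2 ajm n6.
  have : adj (c j.-1) (c m) || adj (c j.+1) (c m).
    by rewrite E1 E2; case: (F j (c j.-1)) (F j (c j.+1)) (F j (c m)) n4 => [] [] [].
  case/orP => h; last by apply: (bad j) => //; nlia.
  by apply: (bad j.-1); rewrite ?prednK //; nlia.
have i3 : i.+1 < m by move: nip; rewrite ne // /=; have [->|] := eqVneq i m.-1; [rewrite am; nlia | nlia].
have ai : adj (c i) (c m) by move: nip; rewrite ne //=; nlia.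
have i0 : i = 0 by apply/eqP; rewrite -leqn0 leqNgt; apply/negP => h; move/negP: (amid i h i3).
exists m; split=> //; last by rewrite -i0.
rewrite mG andbT.
case: (ltngtP m 2) => [|//|m2]; first by nlia.
by move: na2 ai; rewrite i0 m2 /= => /negbTE ->.
Qed.

(* The path [c 0, ..., c m] is induced except for the edge [c m, c 0]; since
   its length is odd, the second turn around it sees the opposite colours on it,
   which excludes any further neighbour. *)
Lemma walk_odd_hole : exists M d, odd_hole P M d.
Proof.
have [m [/andP[m2 mG] ip ne a0m amid]] := walk_closes.
have mL : m < L by nlia.
have cne i j : i <= m -> j <= m -> i != j -> c i != c j.
  move=> im jm; case: (ltngtP i j) => // lt _.
    have [->|jm'] := eqVneq j m; first by apply: ne; nlia.
    have j1 : j <= m.-1 by nlia.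
    by have /andP[] := ip i j lt j1.
  rewrite eq_sym; have [->|im'] := eqVneq i m; first by apply: ne; nlia.
  have i1 : i <= m.-1 by nlia.
  by have /andP[] := ip j i lt i1.
have cycadj i j : i < j -> j <= m -> adj (c i) (c j) = (j == i.+1) || ((i == 0) && (j == m)).
  move=> ij jm; have [ejm|jm'] := eqVneq j m; last first.
    have j1 : j <= m.-1 by nlia.
    by have /andP[_ /eqP ->] := ip i j ij j1; rewrite andbF orbF.
  rewrite ejm andbT; have [ei|i0] := posnP i; first by rewrite ei a0m orbT.
  have [ei|ei] := eqVneq m i.+1.
    have iL : i < L by nlia.
    by rewrite ei (cadj iL).
  by apply/negbTE/amid => //; nlia.
have inP i : i <= m -> c i \in P by move=> im; apply: cP; nlia.
have a_step i : i < m -> adj (c i) (c i.+1) by move=> im; apply: cadj; nlia.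
have m1L : m.-1 < L by nlia.
have m0 : 0 < m by nlia.
have amm : adj (c m) (c m.-1) by rewrite adj_sym -[X in adj _ (c X)](prednK m0) a_step //; nlia.
have am0 : adj (c m) (c 0) by rewrite adj_sym.
have a01 : adj (c 0) (c 1) by apply: a_step.
have n0m1 : ~~ adj (c m.-1) (c 0).
  by rewrite adj_sym cycadj; nlia.
have visit i : i < m -> F m (c i) = g i.
  move=> im; apply: walk_visit; [exact: im | exact: ltnW | move=> l il lm].
  by apply: cne; nlia.
have unvisited t y : t <= L -> (forall l, l <= m -> c l != y) ->
    (forall l, l < t -> exists2 j, j <= m & c l = c j) -> F t y = F 0 y.
  move=> tL ny vis; apply: walk_unvisited => // l lt.
  by have [j jm ->] := vis l lt; apply: ny.
have nc0m1 : c m.-1 != c 0 by apply: cne; nlia.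
(* When the hole is at [c m], its non-adjacent neighbours [c m.-1] and [c 0] carry different
   colours, so [m.-1] is odd. *)
have par : odd m = false.
  have m1m : m.-1 <= m by nlia.
  have E := walk_same mL (inP _ m1m) (inP 0 (leq0n m)) amm am0 nc0m1.
  have m1m' : m.-1 < m by nlia.
  move: E; rewrite (negbTE n0m1) (visit _ m1m') (visit _ m0) (walk_parity m1L).
  have -> : odd m = ~~ odd m.-1 by rewrite -[in LHS](prednK m0).
  by case: (g 0); case: (odd m.-1).
(* A common neighbour [y] of [c m] and [c 0] would be unvisited, hence of constant colour. At time 0
   it agrees with [c m] and so differs from [c 1]; at time [m] it agrees with [c 0], which has
   received the colour of [c 1]. *)
have E0 y : y \in P -> adj (c m) y -> ~~ adj y (c 0).
  move=> yP my; apply/negP => y0.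
  have yc l : l <= m -> c l != y.
    move=> lm; apply/eqP => e; have [lm'|lm'] := eqVneq l m.
      by move: my; rewrite -e lm' adj_irr.
    have [l0|l0] := posnP l; first by move: y0; rewrite -e l0 adj_irr.
    have ltlm : l < m by nlia.
    move: my y0; rewrite -e adj_sym cycadj // [adj (c l) _]adj_sym cycadj //; nlia.
  have Fy : F m y = F 0 y.
    apply: unvisited => //; first exact: ltnW.
    by move=> l lm; exists l => //; nlia.
  have y0' : c 0 != y by apply: yc.
  have ym' : c m != y by apply: yc.
  have E1 := walk_same mL (inP 0 (leq0n m)) yP am0 my y0'.
  have L0 : 0 < L by nlia.
  have ay0 : adj (c 0) y by rewrite adj_sym.
  have E2 := walk_same L0 (inP m (leqnn m)) yP a0m ay0 ym'.
  have ne1m : c 1 != c m by apply: cne; nlia.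
  have E3 := walk_same L0 (inP 1 m0) (inP m (leqnn m)) a01 a0m ne1m.
  move: E1 E2 E3; rewrite ay0 my (visit _ m0) Fy cycadj //; try nlia.
  have -> : (m == 2) || (1 == 0) && (m == m) = false by nlia.
  rewrite {1}/g; case: (F 0 y); case: (F 0 (c 1)) => //; case: (F 0 (c m)) => //.
(* The second turn repeats the first. Two possible continuations would be adjacent to each other,
   and the absence of common neighbours just established forbids this. In turn, an outside [y]
   adjacent to [c i] and [c i.+1] would share the colour of [c i.+1] both at time [i] and one turn
   later, when it has changed. *)
have S i : i <= m -> c (m.+1 + i) = c i /\
    (i < m -> forall y, y \in P -> adj (c i) y -> ~~ adj y (c i.+1)).
  elim/ltn_ind: i => i IH im.
  have back l : l < m.+1 + i -> exists2 j, j <= m & c l = c j.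
    move=> li; have [lm|lm] := leqP l m; first by exists l.
    have h : l - m.+1 < i by nlia.
    have hm : l - m.+1 <= m by nlia.
    by exists (l - m.+1) => //; have [<- _] := IH _ h hm; congr c; nlia.
  have ci : c (m.+1 + i) = c i.
    case: i IH im back => [|i] IH im back.
      rewrite addn0; apply/eqP.
      have mm : m.-1.+1 < L by nlia.
      have /andP[s1 s2] := cstraight mm.
      have em : m.-1.+2 = m.+1 by nlia.
      rewrite em in s1 s2.
      have cm1P : c m.+1 \in P by apply: cP; nlia.
      have amn := cadj mL.
      have m1m : m.-1 <= m by nlia.
      have E1 := walk_same mL (inP _ m1m) cm1P amm amn s2.
      have E2 := walk_same mL (inP _ m1m) (inP 0 (leq0n m)) amm am0 nc0m1.
      have [//|nee] := eqVneq (c m.+1) (c 0).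
      have E3 := walk_same mL cm1P (inP 0 (leq0n m)) amn am0 nee.
      have := E0 _ cm1P amn; rewrite E3.
      move: E1 E2; rewrite (negbTE s1) (negbTE n0m1).
      by case: (F m _); case: (F m _); case: (F m _).
    have [ci Ei] := IH i (ltnSn i) (ltnW im); have {}Ei := Ei im.
    rewrite addnS; apply/eqP.
    have tL : m.+1 + i < L by nlia.
    have t1L : (m + i).+1 < L by nlia.
    have /andP[s1 s2] := cstraight t1L.
    have et : (m + i).+2 = (m.+1 + i).+1 by nlia.
    rewrite et in s1 s2.
    have nP : c (m.+1 + i).+1 \in P by apply: cP; nlia.
    have an := cadj tL; have pi1 : c i.+1 \in P by apply: inP.
    have ai := a_step _ im.
    pose q := if i is i'.+1 then i' else m.
    have eq_ : c (m + i) = c q.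
      rewrite /q; case: (i) IH im => [|j] IH jm; first by rewrite addn0.
      have jm' : j <= m by nlia.
      by rewrite addnS -addSn; have [] := IH j (leqnSn _) jm'.
    have [nq1 nq2] : c q != c i.+1 /\ ~~ adj (c q) (c i.+1).
      rewrite /q; case: (i) im => [|j] jm.
        by rewrite adj_sym cycadj ?cne; nlia.
      by rewrite cycadj ?cne; nlia.
    have pP : c (m + i) \in P by apply: cP; nlia.
    have ap : adj (c i) (c (m + i)).
      rewrite adj_sym -ci; have -> : m.+1 + i = (m + i).+1 by nlia.
      by apply: cadj; nlia.
    rewrite -ci in ap ai *; rewrite eq_ in pP ap s1 s2.
    have E1 := walk_same tL pP nP ap an s2.
    have E2 := walk_same tL pP pi1 ap ai nq1.
    have [//|nee] := eqVneq (c (m.+1 + i).+1) (c i.+1).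
    have E3 := walk_same tL nP pi1 an ai nee.
    rewrite ci in an; have := Ei _ nP an; rewrite E3.
    move: E1 E2; rewrite (negbTE s1) (negbTE nq2).
    by case: (F _ (c q)); case: (F _ (c _)); case: (F _ (c _)).
  split=> // im' y yP iy; apply/negP => yi.
  have iL : i < L by nlia.
  have tL : m.+1 + i < L by nlia.
  have pi1 : c i.+1 \in P by apply: inP.
  have ai := a_step _ im'.
  have yi1 : y != c i.+1 by apply: adj_neq.
  have yc l : l <= m -> c l != y.
    move=> lm; apply/eqP => e; move: iy yi; rewrite -e.
    case: (ltngtP l i) => [li|li|->]; last by rewrite adj_irr.
    - rewrite adj_sym cycadj // cycadj; nlia.
    rewrite cycadj //; have [->|li1] := eqVneq l i.+1; first by rewrite adj_irr.
    rewrite adj_sym cycadj; nlia.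
  have Fi : F i y = F 0 y.
    by apply: unvisited => //; [nlia | move=> l li; exists l => //; nlia].
  have Ft : F (m.+1 + i) y = F 0 y by apply: unvisited => //; exact: ltnW.
  have Fv : F (m.+1 + i) (c i.+1) = g i.+1.
    apply: walk_visit; [nlia | exact: ltnW | move=> l il lt].
    have [lm|lm] := leqP l m; first by apply: cne; nlia.
    have h : l - m.+1 < i by nlia.
    have hm : l - m.+1 <= m by nlia.
    have [e _] := IH _ h hm; have -> : l = m.+1 + (l - m.+1) by nlia.
    by rewrite e; apply: cne; nlia.
  have E1 := walk_same iL yP pi1 iy ai yi1.
  rewrite -ci in iy ai.
  have E2 := walk_same tL yP pi1 iy ai yi1.
  have i1L : i.+1 < L by nlia.
  move: E1 E2; rewrite yi Fi Ft Fv (walk_alternates i1L) /g.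
  by case: (F 0 y); case: (F i _).
pose nx i := if i == m then 0 else i.+1.
pose pv i := if i == 0 then m else i.-1.
have E i y : i <= m -> y \in P -> adj (c i) y -> ~~ adj y (c (nx i)).
  rewrite /nx => im; have [->|im'] := eqVneq i m; first exact: E0.
  have lt : i < m by nlia.
  by have [_] := S i im; apply.
have nxm i : i <= m -> nx i <= m by rewrite /nx; case: eqVneq => //; nlia.
have pvm i : i <= m -> pv i <= m by rewrite /pv; case: eqVneq => //; nlia.
have nxa i : i <= m -> adj (c i) (c (nx i)).
  rewrite /nx => im; have [->|im'] := eqVneq i m; first exact: am0.
  by apply: a_step; nlia.
have pvK i : i <= m -> nx (pv i) = i.
  rewrite /nx /pv => im; have [->|i0] := eqVneq i 0; first by rewrite eqxx.
  by case: eqVneq => //; nlia.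
have pva i : i <= m -> adj (c i) (c (pv i)).
  by move=> im; rewrite adj_sym -{2}(pvK i im); apply/nxa/pvm.
exists m.+1, c; split.
- by rewrite /= par.
- by nlia.
- move=> i j; rewrite !inE !ltnS => im jm e; apply/eqP/negPn/negP => ij.
  by have := cne i j im jm ij; rewrite e eqxx.
- by move=> i; rewrite ltnS; apply: inP.
move=> i y; rewrite ltnS => im yP.
have -> : i.+1 %% m.+1 = nx i.
  rewrite /nx; have [->|im'] := eqVneq i m; first by rewrite modnn.
  by rewrite modn_small //; nlia.
have -> : (i + m.+1.-1) %% m.+1 = pv i.
  rewrite /pv /=; have [->|i0] := eqVneq i 0; first by rewrite add0n modn_small.
  have -> : i + m = i.-1 + m.+1 by nlia.
  by rewrite modnDr modn_small //; nlia.
(* A neighbour [y] of [c i] has the colour of the next or of the previous cycle vertex, so it is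
   adjacent to that one or equal to it; adjacency is excluded by [E]. *)
apply/idP/orP => [iy|[/eqP->|/eqP->]]; [| exact: nxa | exact: pva].
have iL : i < L by nlia.
have nnp : c (nx i) != c (pv i).
  apply: cne; rewrite ?nxm ?pvm // /nx /pv; have [->|im'] := eqVneq i m.
    have -> : (m == 0) = false by nlia.
    by nlia.
  by case: (eqVneq i 0); nlia.
have np : ~~ adj (c (nx i)) (c (pv i)).
  rewrite /nx /pv; have [->|im'] := eqVneq i m.
    have -> : (m == 0) = false by nlia.
    by rewrite adj_sym.
  have [->|i0] := eqVneq i 0; first by rewrite cycadj; nlia.
  by rewrite adj_sym cycadj; nlia.
have [_|yn] := eqVneq y (c (nx i)); first by left.
have [_|yp] := eqVneq y (c (pv i)); first by right.
have E1 := walk_same iL (inP _ (nxm i im)) (inP _ (pvm i im)) (nxa i im) (pva i im) nnp.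
have E2 := walk_same iL yP (inP _ (nxm i im)) iy (nxa i im) yn.
have E3 := walk_same iL yP (inP _ (pvm i im)) iy (pva i im) yp.
have n2 := E i y im yP iy.
have n3 : ~~ adj y (c (pv i)).
  apply/negP => yp'; have := E (pv i) y (pvm i im) yP.
  by rewrite pvK // [adj y (c i)]adj_sym iy adj_sym yp' => /(_ isT).
move: E1 E2 E3; rewrite (negbTE np) (negbTE n2) (negbTE n3).
by case: (F i y); case: (F i (c (nx i))); case: (F i (c (pv i))).
Qed.
End Walk.

(** * Bounded degree and local tests *)

Section CliqueSize.
Variable G : sgraph.
Hypotheses (noclaw : ~ contains_induced claw G) (noK5 : ~ minor (complete 5) G).
Implicit Types (u v x y z : G) (K S : {set G}).

Lemma clique_card K : {in K &, forall x y, x != y -> adj x y} -> #|K| <= 4.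
Proof.
move=> Kc; rewrite leqNgt; apply/negP => K5; apply: noK5.
pose l := take 5 (enum K).
have sl : size l = 5 by rewrite size_takel // -cardE.
have lK x : x \in l -> x \in K by move/mem_take; rewrite mem_enum.
have ul : uniq l by rewrite take_uniq ?enum_uniq.
apply: (@minor_of_paths _ [seq [:: x] | x <- l]); rewrite ?size_map //.
- by apply/allP => s /mapP[x _ ->].
- by rewrite flatten_map1 map_id.
rewrite pairwise_map; apply: (@sub_in_pairwise _ [in K] (fun x y => x != y)).
- by move=> x y xK yK xy; rewrite /= /has_edge /= Kc.
- by apply/allP.
by rewrite -uniq_pairwise.
Qed.

(** With ten neighbours: at most 3 of them miss a given [x], as these form a clique with [u]; among
    the at least 6 adjacent to [x], at most 2 miss a given [y], as these form a clique with [u] and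
    [x]. At least 3 common neighbours remain: two adjacent ones give K5, three independent ones a
    claw at [u]. *)
Lemma degree_bound u : #|[set x | adj u x]| <= 9.
Proof.
set S := [set x | _]; rewrite leqNgt; apply/negP => S10.
have co (T : {set G}) x : T \subset S -> x \in T -> {in [set z in T | (z != x) && ~~ adj x z] &, forall y z, y != z -> adj y z}.
  move=> /subsetP TS xT y z; rewrite !inE => /and3P[yT yx xy] /and3P[zT zx xz] yz.
  have := TS _ xT; have := TS _ yT; have := TS _ zT; rewrite !inE => uz uy ux.
  by apply: (claw_free noclaw uy ux uz) => //; rewrite 1?eq_sym // adj_sym.
have split3 (T : {set G}) x : x \in T ->
    #|T| = 1 + (#|[set z in T | (z != x) && ~~ adj x z]| + #|[set z in T | adj x z]|).
  move=> xT; rewrite (cardsD1 x) xT -(cardsID [set z | adj x z] (T :\ x)); congr (_ + _).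
  rewrite addnC; congr (_ + _); apply: eq_card => z; rewrite !inE.
    by case: (adj x z); rewrite /= ?andbF ?andbT // andbC.
  by case: eqVneq => [->|_]; rewrite ?adj_irr ?andbF //= andbC.
have [x xS] : exists x, x \in S by apply/card_gt0P; lia.
have ux : adj u x by rewrite inE in xS.
pose A := [set z in S | (z != x) && ~~ adj x z]; pose T := [set z in S | adj x z].
have cA : #|u |: A| <= 4.
  apply: clique_card => y z; rewrite !in_setU1 => /orP[/eqP->|yA] /orP[/eqP->|zA].
  - by rewrite eqxx.
  - by move: zA; rewrite !inE => /andP[].
  - by rewrite adj_sym; move: yA; rewrite !inE => /andP[].
  by apply: (co S x (subxx _) xS).
have uA : u \notin A by rewrite !inE adj_irr.
rewrite cardsU1 uA in cA; have := split3 S x xS; rewrite -/A -/T => cS.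
have [y yT] : exists y, y \in T by apply/card_gt0P; lia.
have TS : T \subset S by apply/subsetP => z; rewrite !inE => /andP[].
have /andP[uy xy] : adj u y && adj x y by move: yT; rewrite !inE.
pose B := [set z in T | (z != y) && ~~ adj y z]; pose U := [set z in T | adj y z].
have cB : #|u |: (x |: B)| <= 4.
  apply: clique_card => a b; rewrite !in_setU1 => /or3P[/eqP->|/eqP->|aB] /or3P[/eqP->|/eqP->|bB];
    rewrite ?eqxx //.
  - by move: bB; rewrite !inE => /andP[/andP[]].
  - by rewrite adj_sym.
  - by move: bB; rewrite !inE => /andP[/andP[]].
  - by rewrite adj_sym; move: aB; rewrite !inE => /andP[/andP[]].
  - by rewrite adj_sym; move: aB; rewrite !inE => /andP[/andP[]].
  exact: (co T y TS yT).
have uB : u \notin x |: B by rewrite !inE adj_irr orbF; apply: adj_neq.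
have xB : x \notin B by rewrite !inE adj_irr andbF.
rewrite !cardsU1 uB xB in cB; have := split3 T y yT; rewrite -/B -/U => cT.
have [a [b [c [aU bU cU [ab bc ac]]]]] : exists a b c, [/\ a \in U, b \in U, c \in U & [/\ a != b, b != c & a != c]].
  have : 2 < #|U| by lia.
  by case/card_gt2P => a [b [c [[aU bU cU] [ab bc ca]]]]; exists a, b, c; rewrite (eq_sym a c).
have prop z : z \in U -> [/\ adj u z, adj x z & adj y z].
  by rewrite !inE => /andP[/andP[-> ->] ->].
have nadj z t : z \in U -> t \in U -> z != t -> ~~ adj z t.
  move=> /prop[uz xz yz] /prop[ut xt yt] zt; apply/negP => azt.
  by apply: noK5; model_of [:: [:: u]; [:: x]; [:: y]; [:: z]; [:: t]].
have [ua _ _] := prop a aU; have [ub _ _] := prop b bU; have [uc _ _] := prop c cU.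
have := claw_free noclaw ua ub uc ab bc ac (nadj _ _ aU bU ab) (nadj _ _ bU cU bc).
by rewrite (negbTE (nadj _ _ aU cU ac)).
Qed.

End CliqueSize.

Section LocalTests.
Variable G : sgraph.
Implicit Types (u v w x y z a b c d e p h : G) (P C : {set G}) (f : G -> bool).

Definition exN P u (B : pred G) := [exists x in P, adj u x && B x].

Lemma exNP P u (B : pred G) : reflect (exists x, [/\ x \in P, adj u x & B x]) (exN P u B).
Proof.
apply: (iffP exists_inP) => [[x xP /andP[]]|[x [xP ux Bx]]]; first by exists x.
by exists x => //; rewrite ux.
Qed.

Definition exPendant P a (B : G -> G -> pred G) :=
  exN P a (fun v => exN P a (fun b => exN P a (fun c => exN P v (fun d => exN P v (fun e =>
    pendant_config v a b c d e && B v b c))))).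

Lemma exPendantP P a (B : G -> G -> pred G) : reflect
  (exists v b c d e, [/\ [/\ v \in P, b \in P, c \in P, d \in P & e \in P],
                         pendant_config v a b c d e & B v b c])
  (exPendant P a B).
Proof.
apply: (iffP (exNP _ _ _)) => [[v [vP _ /exNP[b [bP _ /exNP[c [cP _ /exNP[d [dP _ /exNP[e [eP _ /andP[]]]]]]]]]]]|].
  by exists v, b, c, d, e.
move=> [v [b [c [d [e [[vP bP cP dP eP] H Bv]]]]]].
have /and5P[av ab ac vb /and5P[vc vd ve bc _]] := H.
exists v; split=> //; apply/exNP; exists b; split=> //; apply/exNP; exists c; split=> //.
apply/exNP; exists d; split=> //; apply/exNP; exists e; split=> //.
by rewrite H.
Qed.

Definition pendant_test P a := exPendant P a (fun _ _ _ => true).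

Definition guard_test P a x :=
  [&& x \in P, adj a x & exPendant P a (fun v b _ =>
    exN P a (fun y => exN P x (fun p => guard P a b v x y p)))].

Definition wheel_test P v :=
  exN P v (fun u1 => exN P v (fun u2 => exN P v (fun u3 => exN P v (fun u4 => exN P v (fun u5 =>
    wheel_config v u1 u2 u3 u4 u5))))).

Lemma wheel_testP P v : reflect
  (exists u1 u2 u3 u4 u5, [/\ u1 \in P, u2 \in P, u3 \in P, u4 \in P & u5 \in P] /\
                          wheel_config v u1 u2 u3 u4 u5)
  (wheel_test P v).
Proof.
apply: (iffP (exNP _ _ _)) => [[v1 [P1 _ /exNP[v2 [P2 _ /exNP[v3 [P3 _ /exNP[v4 [P4 _ /exNP[v5 [P5 _ H]]]]]]]]]]|].
  by exists v1, v2, v3, v4, v5.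
move=> [u1 [u2 [u3 [u4 [u5 [[P1 P2 P3 P4 P5] H]]]]]].
have /and5P[v1 v2 v3 v4 /andP[v5 _]] := H.
exists u1; split=> //; apply/exNP; exists u2; split=> //; apply/exNP; exists u3; split=> //.
by apply/exNP; exists u4; split=> //; apply/exNP; exists u5.
Qed.

Definition same_or_adj x y := (x == y) || adj x y.

(** Three vertices, possibly equal, describe every blocking clique, since together with [u] it has
    at most four vertices. *)
Definition block_test P C f u (q : bool) :=
  exN P u (fun x => exN P u (fun y => exN P u (fun z =>
    [&& x \in C, y \in C, z \in C, f x == q, f y == q, f z == q,
        same_or_adj x y, same_or_adj y z, same_or_adj x z &
        ~~ exN P u (fun w => [&& adj w x, adj w y & adj w z])]))).

Lemma block_testE P C f u q : ~ minor (complete 5) G ->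
  blocked P C f u q = block_test P C f u q.
Proof.
move=> noK5; apply/idP/idP.
  case/blockedP => K /blockP[K0 Ka Kc Km].
  have cK : #|K| <= 3.
    have : #|u |: K| <= 4.
      apply: (clique_card noK5) => x y; rewrite !in_setU1 => /orP[/eqP->|xK] /orP[/eqP->|yK].
      - by rewrite eqxx.
      - by have [] := Ka y yK.
      - by rewrite adj_sym; have [] := Ka x xK.
      exact: Kc.
    rewrite cardsU1; suff -> : u \notin K by [].
    by apply/negP => /Ka[_ _]; rewrite adj_irr.
  have [x [y [z [xK yK zK cov]]]] : exists x y z, [/\ x \in K, y \in K, z \in K &
      forall k, k \in K -> [|| k == x, k == y | k == z]].
    have mK k : (k \in K) = (k \in enum K) by rewrite mem_enum.
    rewrite cardE in cK; case: (enum K) mK cK => [|x [|y [|z [|? ?]]]] mK //= _.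
    - by case: K0 => k; rewrite mK.
    - by exists x, x, x; split=> [|||k]; rewrite !mK !inE ?eqxx // => ->.
    - by exists x, y, y; split=> [|||k]; rewrite !mK !inE ?eqxx ?orbT // => /orP[] ->; rewrite ?orbT.
    by exists x, y, z; split=> [|||k]; rewrite !mK !inE ?eqxx ?orbT.
  have soa s t : s \in K -> t \in K -> same_or_adj s t.
    by move=> sK tK; rewrite /same_or_adj; case: eqVneq => //= st; apply: Kc.
  have [xP xC ux fx] := Ka x xK; have [yP yC uy fy] := Ka y yK; have [zP zC uz fz] := Ka z zK.
  apply/exNP; exists x; split=> //; apply/exNP; exists y; split=> //; apply/exNP; exists z; split=> //.
  rewrite xC yC zC fx fy fz !eqxx !soa //=; apply/exNP => -[w [wP uw /and3P[wx wy wz]]].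
  have [k kK wk] := Km w wP uw.
  by case/or3P: (cov k kK) => /eqP e; rewrite e ?wx ?wy ?wz in wk.
case/exNP => x [xP ux /exNP[y [yP uy /exNP[z [zP uz]]]]].
case/and5P => xC yC zC fx /and5P[fy fz xy yz /andP[xz max]].
apply/blockedP; exists [set x; y; z]; apply/blockP; split.
- by exists x; rewrite !inE eqxx.
- by move=> k; rewrite !inE => /orP[/orP[]|] /eqP ->; split=> //; exact/eqP.
- move=> s t; rewrite !inE => /orP[/orP[]|] /eqP -> /orP[/orP[]|] /eqP ->; rewrite ?eqxx //;
    move: xy yz xz; rewrite /same_or_adj => xy yz xz.
  + by move/negPf => e; rewrite e in xy.
  + by move/negPf => e; rewrite e in xz.
  + by rewrite eq_sym adj_sym => /negPf e; rewrite e in xy.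
  + by move/negPf => e; rewrite e in yz.
  + by rewrite eq_sym adj_sym => /negPf e; rewrite e in xz.
  + by rewrite eq_sym adj_sym => /negPf e; rewrite e in yz.
move=> w wP uw; move/exNP: max => max.
have [wx|wx] := boolP (adj w x); last by exists x; rewrite ?inE ?eqxx.
have [wy|wy] := boolP (adj w y); last by exists y; rewrite ?inE ?eqxx ?orbT.
have [wz|wz] := boolP (adj w z); last by exists z; rewrite ?inE ?eqxx ?orbT.
by case: max; exists w; rewrite wx wy.
Qed.

End LocalTests.

(** * Safe deletions, expressed through the local tests *)

Section Elimination.
Variable G : sgraph.
Hypotheses (noclaw : ~ contains_induced claw G) (noK5 : ~ minor (complete 5) G).
Implicit Types (u v w x y z a b c d e p h : G) (P C : {set G}) (f : G -> bool).

Definition reinsertable P z :=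
  z \in P /\ forall f, valid (P :\ z) (P :\ z) f -> resolvable P P f z.

Lemma colourable_reinsertable P z : z \in P ->
  (forall f, valid (P :\ z) (P :\ z) f -> exists q, ~~ blocked P (P :\ z) f z q) ->
  reinsertable P z.
Proof.
move=> zP H; split=> // f vf; have [q nb] := H f vf.
exact: colourable_resolvable zP (valid_reinsert vf) nb.
Qed.

Lemma guard_step P a x : a \in P -> no_odd_hole P -> guard_test P a x ->
  [/\ x != a, no_odd_hole (P :\ x), reinsertable P x,
      reinsertable (P :\ x) a & no_odd_hole (P :\ x :\ a)].
Proof.
move=> aP nP /and3P[xP ax /exPendantP[v [b [c [d [e [[vP bP cP dP eP] H]]]]]]].
case/exNP => y [yP ay /exNP[p [pP xp Hg]]].
have /and5P[_ _ xy _ /and5P[xv yv xb yb _]] := Hg.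
have /and5P[av ab ac vb /and5P[vc vd ve bc /and5P[cd de eb ad /and3P[ae bd ce]]]] := H.
have bx : b != x by adj_neq.
have vx : v != x by adj_neq.
have xc : ~~ adj x c.
  by apply: contra xb; apply: (pendant_outer noclaw noK5 (pendant_configC H)); adj_auto.
have cx : c != x by adj_neq.
have xa : x != a by adj_neq.
have n1 : no_odd_hole (P :\ x) by apply: (guard_no_odd_hole noclaw noK5 aP bP cP yP pP H Hg).
split=> //.
- apply: colourable_reinsertable => // f; exact: (guard_colourable noclaw noK5 aP yP xP H Hg).
- apply: colourable_reinsertable; first by rewrite !inE eq_sym xa.
  by move=> f; apply: (pendant_colourable noclaw noK5 _ _ _ _ H); rewrite !inE ?vx ?bx ?cx // eq_sym xa.
exact: (guarded_no_odd_hole noclaw noK5 vP bP cP H Hg).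
Qed.

Lemma pendant_step P a : a \in P -> no_odd_hole P -> pendant_test P a ->
  (forall x, ~~ guard_test P a x) -> reinsertable P a /\ no_odd_hole (P :\ a).
Proof.
move=> aP nP /exPendantP[v [b [c [d [e [[vP bP cP dP eP] H _]]]]]] ng; split.
  apply: colourable_reinsertable => // f; exact: (pendant_colourable noclaw noK5 aP vP bP cP H).
move=> M s /(pendant_hole_guard noclaw noK5 vP bP cP H nP)[x [y [p [xP yP pP Hg]]]].
have /and5P[ax ay xy xp _] := Hg.
have out t : t \in P :\ a -> t \in P by rewrite inE => /andP[].
move/negP: (ng x); apply; apply/and3P; split=> //; first exact: out.
apply/exPendantP; exists v, b, c, d, e; split=> //; apply/exNP; exists y; split=> //; first exact: out.
by apply/exNP; exists p.
Qed.

Lemma dominated_step P u v : u \in P -> v \in P -> no_odd_hole P -> wheel_test P v ->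
  dominated P u v -> reinsertable P u /\ no_odd_hole (P :\ u).
Proof.
move=> uP vP nP /wheel_testP[u1 [u2 [u3 [u4 [u5 [[P1 P2 P3 P4 P5] H]]]]]] dom; split.
  apply: colourable_reinsertable => // f _; exact: dominated_colourable vP dom.
exact: (dominated_no_odd_hole noclaw vP P1 P2 P3 P4 P5 H dom).
Qed.

Lemma wheel_step P v : v \in P -> no_odd_hole P -> pendant_free P -> wheel_test P v ->
  (forall u, u \in P -> ~~ dominated P u v) -> reinsertable P v /\ no_odd_hole (P :\ v).
Proof.
move=> vP nP pf /wheel_testP[u1 [u2 [u3 [u4 [u5 [[P1 P2 P3 P4 P5] H]]]]]] nd; split.
  split=> // f; exact: (wheel_resolvable noclaw noK5 H vP P1 P2 P3 P4 P5 pf).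
exact: (wheel_no_odd_hole noclaw noK5 vP P1 P2 P3 P4 P5 H nd).
Qed.

Lemma pendant_free_test P : (forall a, a \in P -> ~~ pendant_test P a) -> pendant_free P.
Proof.
move=> H v a b c d e vP aP bP cP dP eP; apply: contra (H a aP) => cfg.
by apply/exPendantP; exists v, b, c, d, e.
Qed.

Lemma wheel_free_test P : (forall v, v \in P -> ~~ wheel_test P v) -> wheel_free P.
Proof.
move=> H v u1 u2 u3 u4 u5 vP P1 P2 P3 P4 P5; apply: contra (H v vP) => cfg.
by apply/wheel_testP; exists u1, u2, u3, u4, u5.
Qed.

Lemma pendant_test_sub P P' a : P' \subset P -> pendant_test P' a -> pendant_test P a.
Proof.
move=> /subsetP s /exPendantP[v [b [c [d [e [[vP bP cP dP eP] H _]]]]]].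
by apply/exPendantP; exists v, b, c, d, e; split=> //; split; apply: s.
Qed.

Lemma wheel_test_sub P P' v : P' \subset P -> wheel_test P' v -> wheel_test P v.
Proof.
move=> /subsetP s /wheel_testP[u1 [u2 [u3 [u4 [u5 [[P1 P2 P3 P4 P5] H]]]]]].
by apply/wheel_testP; exists u1, u2, u3, u4, u5; split=> //; split; apply: s.
Qed.

(** Every 5-wheel with hub [v] uses all the neighbours of [v] in its rim, so deleting one of them
    destroys all these wheels. *)
Lemma wheel_test_del P u v : adj v u -> wheel_test P v -> ~~ wheel_test (P :\ u) v.
Proof.
move=> vu /wheel_testP[u1 [u2 [u3 [u4 [u5 [_ H]]]]]].
apply/wheel_testP => -[w1 [w2 [w3 [w4 [w5 [[P1 P2 P3 P4 P5] H']]]]]].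
have := wheel_rim noclaw noK5 H' vu.
by rewrite !inE => /or4P[|||/orP[]] /eqP e; move: P1 P2 P3 P4 P5; rewrite e !inE eqxx.
Qed.

End Elimination.

(** * The walk of the hole ends *)

Section WalkTermination.
Variables (G : sgraph) (P C : {set G}) (nxt : G -> G -> G).
Hypotheses (noclaw : ~ contains_induced claw G).
Hypotheses (tP : tame P) (nP : no_odd_hole P) (CP : C \subset P).

(** [prev = h] marks the start of a walk, when there is no previous position. *)
Definition next_test prev h x :=
  [&& x \in P, adj h x & (prev == h) || ~~ same_or_adj prev x].

Hypothesis nxtP : forall prev h x, next_test prev h x -> next_test prev h (nxt prev h).

Definition walk_step (s : (G -> bool) * G * G) :=
  let: (f, h, prev) := s in let x := nxt prev h in (upd f h (f x), x, h).

Definition walk_ok (s : (G -> bool) * G * G) :=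
  [&& s.1.2 \in C, valid P (C :\ s.1.2) s.1.1 &
      (s.2 == s.1.2) || (s.2 \in P) && adj s.1.2 s.2].

Lemma walk_next s : walk_ok s -> ~~ resolvable P C s.1.1 s.1.2 ->
  walk_ok (walk_step s) /\ next_test s.2 s.1.2 (nxt s.2 s.1.2).
Proof.
case: s => [[f h] prev] /and3P[/= hC vf hp] nres.
have [llC lls llc] := stuck_line_like noclaw tP CP hC vf nres.
have nx : next_test prev h (nxt prev h).
  case/orP: hp => [/eqP->|/andP[pP ap]].
    have [x xP [hx _]] := llc true.
    by apply: (nxtP (x := x)); rewrite /next_test xP hx eqxx.
  have [x xP [hx fx]] := llc (~~ f prev).
  have px : prev != x by apply: contra_eq_neq fx => ->; case: (f x).
  apply: (nxtP (x := x)); rewrite /next_test xP hx /same_or_adj (negbTE px) (lls prev x) //.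
  by rewrite fx; case: (f prev); rewrite orbT.
have /and3P[xP hx _] := nx; split=> //; apply/and3P; split=> /=.
- exact: llC.
- apply: (tame_move noclaw tP) => //; first by [have /subsetP := CP; apply].
  + exact: (unresolvable_blocked true hC vf nres).
  + exact: (unresolvable_blocked false hC vf nres).
by have /subsetP/(_ h hC) hP := CP; rewrite hP adj_sym hx orbT.
Qed.

Lemma walk_terminates f r : r \in C -> valid P (C :\ r) f -> exists2 N, N <= 2 * #|G| &
  let s i := iter i walk_step (f, r, r) in
  [/\ forall i, i <= N -> walk_ok (s i), resolvable P C (s N).1.1 (s N).1.2 &
      forall i, i < N -> ~~ resolvable P C (s i).1.1 (s i).1.2].
Proof.
move=> rC vf; pose s i := iter i walk_step (f, r, r).
have ok0 : walk_ok (s 0) by rewrite /walk_ok /= rC vf eqxx.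
have okn i : (forall j, j < i -> ~~ resolvable P C (s j).1.1 (s j).1.2) -> walk_ok (s i).
  elim: i => // i IH no; rewrite /s iterS; apply: (proj1 (walk_next _ _)); last exact: no.
  by apply: IH => j ji; apply: no; apply: ltnW.
have [/existsP[i0 ri0]|/existsPn none] := boolP [exists i : 'I_(2 * #|G|).+1, resolvable P C (s i).1.1 (s i).1.2].
  have ex : exists i, (i <= 2 * #|G|) && resolvable P C (s i).1.1 (s i).1.2.
    by exists i0; rewrite ri0 andbT leq_ord.
  have [N /andP[NL rN] min] := ex_minnP ex.
  have no j : j < N -> ~~ resolvable P C (s j).1.1 (s j).1.2.
    move=> jN; apply: contraL jN => rj; rewrite -leqNgt.
    have [jL|/ltnW jL] := leqP j (2 * #|G|); first by apply: min; rewrite jL.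
    exact: leq_trans NL jL.
  by exists N => //; split=> // i iN; apply: okn => j ji; apply: no; lia.
(* A walk unresolved through index [2 * #|G|] meets the hypotheses of [walk_odd_hole], with one more
   move as its length. *)
exfalso.
have no j : j < (2 * #|G|).+1 -> ~~ resolvable P C (s j).1.1 (s j).1.2.
  by move=> jL; apply: (none (Ordinal jL)).
have ok i : i <= (2 * #|G|).+1 -> walk_ok (s i).
  by move=> iL; apply: okn => j ji; apply: no; lia.
have nx i : i < (2 * #|G|).+1 -> next_test (s i).2 (s i).1.2 (s i.+1).1.2.
  move=> iL; have := proj2 (walk_next (ok i (ltnW iL)) (no i iL)).
  by rewrite /s iterS; case: (iter i _ _) => [[]].
have prevE i : (s i.+1).2 = (s i).1.2 by rewrite /s iterS; case: (iter i _ _) => [[]].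
have cL i : i < (2 * #|G|).+1 -> adj (s i).1.2 (s i.+1).1.2.
  by move=> iL; have /and3P[] := nx i iL.
have /subsetP CP' := CP.
have LL i : i < (2 * #|G|).+1 -> line_like P C (s i).1.1 (s i).1.2.
  move=> iL; have /and3P[hC vi _] := ok i (ltnW iL).
  exact: (stuck_line_like noclaw tP CP hC vi (no i iL)).
suff [M [d hole]] : exists M d, odd_hole P M d by apply: nP hole.
apply: (walk_odd_hole LL _ cL) => //.
- by move=> i iL; have /and3P[hC _ _] := ok i iL; apply: CP'.
- move=> i iL; have /and3P[_ _] := nx _ iL; rewrite prevE.
  have /adj_neq/negPf -> := cL i (ltnW iL).
  by rewrite /same_or_adj negb_or andbC.
by move=> i iL; rewrite /s iterS; case: (iter i _ _) => [[]].
Qed.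
End WalkTermination.

(** * Running commands *)

Section Machine.
Variable W : nat.

Definition evals (s : state) (e : expr) (v : nat) : Prop := fits W s e /\ eval s e = v.

Definition runs (c : cmd) (s : state) (T : nat) (Q : state -> Prop) : Prop :=
  exists t s', [/\ exec W c s t s', t <= T & Q s'].

Lemma evals_lit s m : m < W -> evals s (Lit m) m.
Proof. by move=> mW; split=> //=; rewrite andbT. Qed.

Lemma evals_reg s x v : reg s x = v -> v < W -> evals s (Reg x) v.
Proof. by move=> <- vW; split=> //=; rewrite andbT. Qed.

Lemma evals_get s a i j v : evals s i j -> arr s a j = v -> v < W -> evals s (Get a i) v.
Proof. by case=> fi ej <- vW; split; rewrite /= ej // vW. Qed.

Lemma evals_add s e1 e2 v1 v2 :
  evals s e1 v1 -> evals s e2 v2 -> v1 + v2 < W -> evals s (Add e1 e2) (v1 + v2).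
Proof. by case=> f1 <- [f2 <-] vW; split; rewrite //= vW f1 f2. Qed.

Lemma evals_sub s e1 e2 v1 v2 :
  evals s e1 v1 -> evals s e2 v2 -> v1 < W -> evals s (Defs.Sub e1 e2) (v1 - v2).
Proof. by case=> f1 <- [f2 <-] vW; split; rewrite //= f1 f2 andbT; lia. Qed.

Lemma evals_mul s e1 e2 v1 v2 :
  evals s e1 v1 -> evals s e2 v2 -> v1 * v2 < W -> evals s (Mul e1 e2) (v1 * v2).
Proof. by case=> f1 <- [f2 <-] vW; split; rewrite //= vW f1 f2. Qed.

Lemma evals_lt s e1 e2 v1 v2 : 1 < W ->
  evals s e1 v1 -> evals s e2 v2 -> evals s (Lt e1 e2) (v1 < v2 : nat).
Proof. by move=> W1 [f1 <-] [f2 <-]; split; rewrite //= f1 f2 !andbT; lia. Qed.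

Lemma evals_eq s e1 e2 v1 v2 : 1 < W ->
  evals s e1 v1 -> evals s e2 v2 -> evals s (Eq e1 e2) (v1 == v2 : nat).
Proof. by move=> W1 [f1 <-] [f2 <-]; split; rewrite //= f1 f2 !andbT; case: eqP => _ /=; lia. Qed.

Lemma runs_weaken c s T T' (Q Q' : state -> Prop) :
  runs c s T Q -> T <= T' -> (forall s', Q s' -> Q' s') -> runs c s T' Q'.
Proof. by case=> t [s' [ex tT qs]] TT QQ; exists t, s'; split; [|exact: leq_trans tT TT|apply: QQ]. Qed.

Lemma runs_skip s (Q : state -> Prop) : Q s -> runs Skip s 1 Q.
Proof. by exists 1, s; split=> //; constructor. Qed.

Lemma runs_assign s x e v (Q : state -> Prop) :
  evals s e v -> Q (set_reg s x v) -> runs (Assign x e) s (cost e).+1 Q.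
Proof. by case=> fe <- q; exists (cost e).+1, (set_reg s x (eval s e)); split=> //; constructor. Qed.

Lemma runs_store s a i e j v (Q : state -> Prop) :
  evals s i j -> evals s e v -> Q (set_arr s a j v) ->
  runs (Store a i e) s (cost i + cost e).+1 Q.
Proof.
move=> [fi <-] [fe <-] q.
by exists (cost i + cost e).+1, (set_arr s a (eval s i) (eval s e)); split=> //; constructor.
Qed.

Lemma runs_seq c1 c2 s T1 T2 (R Q : state -> Prop) :
  runs c1 s T1 R -> (forall s', R s' -> runs c2 s' T2 Q) -> runs (Seq c1 c2) s (T1 + T2) Q.
Proof.
case=> t1 [s1 [e1 l1 r1]] /(_ s1 r1)[t2 [s2 [e2 l2 q2]]].
by exists (t1 + t2), s2; split=> //; [apply: exec_seq e1 e2 | apply: leq_add].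
Qed.

(** Adding the bounds of both branches, instead of taking their maximum, keeps [tc] a plain sum. *)
Lemma runs_if s e (b : bool) c1 c2 T1 T2 Q : evals s e b ->
  (b -> runs c1 s T1 Q) -> (~~ b -> runs c2 s T2 Q) ->
  runs (If e c1 c2) s ((cost e).+1 + (T1 + T2)) Q.
Proof.
move=> [fe ee] r1 r2.
have [t [s' [ex tT q]]] : runs (if b then c1 else c2) s (T1 + T2) Q.
  case: (b) r1 r2 => [/(_ isT) r1 _|_ /(_ isT) r2].
    by apply: runs_weaken r1 _ _ => //; rewrite leq_addr.
  by apply: runs_weaken r2 _ _ => //; rewrite leq_addl.
exists ((cost e).+1 + t), s'; split=> //; last by rewrite leq_add2l.
by apply: exec_if => //; rewrite ee; case: (b) ex.
Qed.

(** The invariant is indexed by completed rounds, and the loop condition must decide [i < N]; so [N]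
    is the exact number of rounds. *)
Lemma runs_while e c N K (I : nat -> state -> Prop) s :
  (forall i s, i <= N -> I i s -> evals s e (i < N : nat)) ->
  (forall i s, i < N -> I i s -> runs c s K (I i.+1)) ->
  I 0 s -> runs (While e c) s (N * ((cost e).+1 + K) + (cost e).+1) (I N).
Proof.
move=> cond body; have loop k i s' : i + k = N -> I i s' ->
    runs (While e c) s' (k * ((cost e).+1 + K) + (cost e).+1) (I N).
  elim: k i s' => [|k IH] i s' ik Ii.
    have iN : i = N by rewrite -ik addn0.
    have [fe ee] := cond i s' (eq_leq iN) Ii; rewrite iN ltnn in ee.
    exists (cost e).+1, s'; split; last by rewrite -iN.
      exact: exec_while_stop.
    by rewrite mul0n.
  have iN : i < N by lia.
  have [fe ee] := cond i s' (ltnW iN) Ii; rewrite iN in ee.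
  have [t1 [s1 [e1 l1 I1]]] := body i s' iN Ii.
  have [t2 [s2 [e2 l2 q2]]] : runs (While e c) s1 (k * ((cost e).+1 + K) + (cost e).+1) (I N).
    by apply: (IH i.+1) => //; lia.
  exists ((cost e).+1 + t1 + t2), s2; split=> //; last by rewrite mulSn; lia.
  by apply: exec_while_loop e1 e2 => //; rewrite ee.
by apply: loop; rewrite add0n.
Qed.

Definition For (x : nat) (c : cmd) : cmd :=
  Seq (Assign x (Lit 0))
      (While (Lt (Reg x) (Reg 0)) (Seq c (Assign x (Add (Reg x) (Lit 1))))).

(** Each round adds 4 for the test and 4 for the increment; the 6 is the initial assignment and the
    last test. *)
Lemma runs_for x c n K (I : nat -> state -> Prop) s : x != 0 -> n.+1 < W ->
  (forall i s v, I i s -> I i (set_reg s x v)) ->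
  (forall i s, I i s -> reg s 0 = n) ->
  (forall i s, i < n -> reg s x = i -> I i s ->
     runs c s K (fun s' => I i.+1 s' /\ reg s' x = i)) ->
  I 0 s -> runs (For x c) s (n * (K + 8) + 6) (I n).
Proof.
move=> x0 nW Ir In body I0.
pose J i s := I i s /\ reg s x = i.
have : runs (For x c) s (2 + (n * (4 + (K + 4)) + 4)) (J n).
  apply: (@runs_seq _ _ _ _ _ (J 0)).
    apply: runs_assign; first by apply: evals_lit; lia.
    by split; [apply: Ir | rewrite /= eqxx].
  move=> s' J0; apply: (@runs_while _ _ n (K + 4) J) => //.
    move=> i s1 iN [Ii ri]; apply: evals_lt; first by lia.
      by apply: evals_reg => //; lia.
    by apply: evals_reg; [exact: In Ii | lia].
  move=> i s1 iN [Ii ri]; apply: (runs_seq (body i s1 iN ri Ii)).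
  move=> s2 [Ii2 ri2]; apply: runs_assign.
    by apply: evals_add; [apply: (evals_reg ri2); lia | apply: evals_lit; lia | lia].
  by split; [apply: Ir | rewrite /= eqxx addn1].
by move/runs_weaken; apply; [lia | move=> s' []].
Qed.

Definition NotE e := Eq e (Lit 0).
Definition AndE e1 e2 := Mul e1 e2.
(** The intermediate sum may be 2, whence the assumption [2 < W]. *)
Definition OrE e1 e2 := Lt (Lit 0) (Add e1 e2).

Hypothesis W2 : 2 < W.

Lemma evals_not s e (b : bool) : evals s e b -> evals s (NotE e) (~~ b).
Proof.
move=> eb; have W1 : 1 < W by lia.
have h := evals_eq W1 eb (evals_lit s (ltnW W1)).
by case: b eb h.
Qed.

Lemma evals_and s e1 e2 (b1 b2 : bool) :
  evals s e1 b1 -> evals s e2 b2 -> evals s (AndE e1 e2) (b1 && b2).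
Proof.
move=> h1 h2; have := evals_mul h1 h2; case: b1 b2 h1 h2 => [] [] _ _ /=; apply; lia.
Qed.

Lemma evals_or s e1 e2 (b1 b2 : bool) :
  evals s e1 b1 -> evals s e2 b2 -> evals s (OrE e1 e2) (b1 || b2).
Proof.
move=> h1 h2; have W1 : 1 < W by lia.
have b12 : b1 + b2 < W by case: b1 b2 {h1 h2} => [] []; lia.
have := evals_lt W1 (evals_lit s (ltnW W1)) (evals_add h1 h2 b12).
by case: b1 b2 {h1 h2 b12} => [] [].
Qed.

Lemma evals_eqb s e1 e2 (b1 b2 : bool) :
  evals s e1 b1 -> evals s e2 b2 -> evals s (Eq e1 e2) (b1 == b2).
Proof.
have W1 : 1 < W by lia.
by move=> h1 h2; have := evals_eq W1 h1 h2; case: b1 b2 {h1 h2} => [] [].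
Qed.

End Machine.

(** * The program *)

(* Registers: 0 = n, 1 2 = loop indices, 3 = row length, 4 = stack height,
   5 = hole, 6 = previous position of the hole, 7 = success flag, 8 = root,
   9 ... 13 = scratch.  Arrays: 0 = adjacency matrix, 1 = colours,
   2 = neighbour lists (ten slots per vertex, slot 0 being the vertex itself;
   unused slots hold 0, and all tests filter slots by adjacency),
   3 = deleted, 4 = coloured (the hole included), 5 = stack of deleted vertices. *)

(* Worst-case cost of a command without loops; loops are accounted for separately. *)
Fixpoint tc (c : cmd) : nat :=
  match c with
  | Skip => 1
  | Assign _ e => (cost e).+1
  | Store _ i e => (cost i + cost e).+1
  | Seq c1 c2 => tc c1 + tc c2
  | If e c1 c2 => (cost e).+1 + (tc c1 + tc c2)
  | While _ _ => 0
  end.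

Definition slots := iota 0 10.

Definition SlotE e i := Get 2 (Add (Mul (Lit 10) e) (Lit i)).
Definition AdjE e1 e2 := Get 0 (Add (Mul e1 (Reg 0)) e2).
Definition AliveE e := NotE (Get 3 e).
Definition ExE (e : expr) (F : expr -> expr) : expr :=
  foldr (fun i acc => OrE (AndE (AndE (AliveE (SlotE e i)) (AdjE e (SlotE e i)))
                                (F (SlotE e i))) acc) (Lit 0) slots.
Arguments ExE : simpl never.
Definition IfE b e1 e2 := OrE (AndE b e1) (AndE (NotE b) e2).
Definition XorE e1 e2 := NotE (Eq e1 e2).
Definition SameAdjE x y := OrE (Eq x y) (AdjE x y).

Definition AndsE (l : seq expr) : expr := foldr AndE (Lit 1) l.

Definition PendantConfigE v a b c d e := AndsE
  [:: AdjE a v; AdjE a b; AdjE a c; AdjE v b; AdjE v c; AdjE v d; AdjE v e;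
      AdjE b c; AdjE c d; AdjE d e; AdjE e b;
      NotE (AdjE a d); NotE (AdjE a e); NotE (AdjE b d); NotE (AdjE c e)].

Definition WheelConfigE v u1 u2 u3 u4 u5 := AndsE
  [:: AdjE v u1; AdjE v u2; AdjE v u3; AdjE v u4; AdjE v u5;
      AdjE u1 u2; AdjE u2 u3; AdjE u3 u4; AdjE u4 u5; AdjE u5 u1;
      NotE (AdjE u1 u3); NotE (AdjE u2 u4); NotE (AdjE u3 u5); NotE (AdjE u4 u1); NotE (AdjE u5 u2)].

Definition ExPendantE a (B : expr -> expr -> expr -> expr) :=
  ExE a (fun v => ExE a (fun b => ExE a (fun c => ExE v (fun d => ExE v (fun e =>
    AndE (PendantConfigE v a b c d e) (B v b c)))))).

Definition PendantE a := ExPendantE a (fun _ _ _ => Lit 1).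

Definition GuardConfigE a b v x y p := AndsE
  [:: AdjE a x; AdjE a y; AdjE x y; AdjE x p; NotE (AdjE x v); NotE (AdjE y v);
      NotE (AdjE x b); NotE (AdjE y b); NotE (AdjE p a); NotE (AdjE p y);
      NotE (ExE x (fun w => NotE (OrE (Eq w a) (OrE (Eq w y) (Eq w p)))))].

Definition GuardE a x := AndE (AliveE x) (AndE (AdjE a x)
  (ExPendantE a (fun v b _ => ExE a (fun y => ExE x (fun p => GuardConfigE a b v x y p))))).

Definition WheelE v :=
  ExE v (fun u1 => ExE v (fun u2 => ExE v (fun u3 => ExE v (fun u4 => ExE v (fun u5 =>
    WheelConfigE v u1 u2 u3 u4 u5))))).

Definition DominatedE u v :=
  AndE (AdjE v u) (NotE (ExE u (fun w => NotE (OrE (Eq w v) (AdjE v w))))).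

Definition BlockE (col : expr -> expr) u q :=
  ExE u (fun x => ExE u (fun y => ExE u (fun z => AndsE
    [:: Get 4 x; Get 4 y; Get 4 z; Eq (col x) q; Eq (col y) q; Eq (col z) q;
        SameAdjE x y; SameAdjE y z; SameAdjE x z;
        NotE (ExE u (fun w => AndsE [:: AdjE w x; AdjE w y; AdjE w z]))]))).

Definition RecolourE (c : bool) p q x :=
  IfE (Eq x (Reg 5)) (Lit c) (XorE (Get 1 x) (OrE (Eq x p) (Eq x q))).

Definition TryE (c : bool) p q :=
  let col := RecolourE c p q in
  AndsE [:: SameAdjE (Reg 5) p; SameAdjE p q; Get 4 p; Get 4 q; NotE (BlockE col (Reg 5) (col (Reg 5)));
            NotE (BlockE col p (col p)); NotE (BlockE col q (col q))].

Definition NextE x :=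
  AndsE [:: AliveE x; AdjE (Reg 5) x; OrE (Eq (Reg 6) (Reg 5)) (NotE (SameAdjE (Reg 6) x))].

Definition FirstOf (I : Type) (l : seq I) (cond : I -> expr) (act : I -> cmd) (other : cmd) :=
  foldr (fun i acc => If (cond i) (act i) acc) other l.

Definition Push : cmd :=
  Seq (Store 5 (Reg 4) (Reg 9))
      (Seq (Assign 4 (Add (Reg 4) (Lit 1))) (Store 3 (Reg 9) (Lit 1))).

Definition PendantBody : cmd :=
  If (AndE (AliveE (Reg 1)) (PendantE (Reg 1)))
     (Seq (FirstOf slots (fun i => GuardE (Reg 1) (SlotE (Reg 1) i))
             (fun i => Seq (Assign 9 (SlotE (Reg 1) i)) Push) Skip)
          (Seq (Assign 9 (Reg 1)) Push))
     Skip.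

Definition WheelBody : cmd :=
  If (AndE (AliveE (Reg 1)) (WheelE (Reg 1)))
     (Seq (FirstOf slots (fun i => AndE (AliveE (SlotE (Reg 1) i)) (DominatedE (SlotE (Reg 1) i) (Reg 1)))
             (fun i => Assign 9 (SlotE (Reg 1) i)) (Assign 9 (Reg 1)))
          Push)
     Skip.

Definition tries : seq (bool * nat * nat) :=
  [seq (cp.1, cp.2, j) | cp <- [seq (c, i) | c <- [:: true; false], i <- slots], j <- slots].

Definition TryP (t : bool * nat * nat) := SlotE (Reg 5) t.1.2.
Definition TryQ (t : bool * nat * nat) := SlotE (TryP t) t.2.

(** The new colours of [p] and [q] go through registers 12 and 13, because they are computed from
    the old colours and must precede every store. *)
Definition TryAll : cmd :=
  FirstOf tries (fun t => TryE t.1.1 (TryP t) (TryQ t))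
    (fun t => Seq (Assign 10 (TryP t)) (Seq (Assign 11 (TryQ t))
       (Seq (Assign 12 (RecolourE t.1.1 (Reg 10) (Reg 11) (Reg 10)))
       (Seq (Assign 13 (RecolourE t.1.1 (Reg 10) (Reg 11) (Reg 11)))
       (Seq (Store 1 (Reg 10) (Reg 12)) (Seq (Store 1 (Reg 11) (Reg 13))
       (Seq (Store 1 (Reg 5) (Lit t.1.1)) (Assign 7 (Lit 1)))))))))
    Skip.

Definition Move : cmd :=
  FirstOf slots (fun i => NextE (SlotE (Reg 5) i))
    (fun i => Seq (Assign 10 (SlotE (Reg 5) i))
       (Seq (Store 1 (Reg 5) (Get 1 (Reg 10))) (Seq (Assign 6 (Reg 5)) (Assign 5 (Reg 10)))))
    Skip.

Definition WalkBody : cmd := Seq TryAll (If (NotE (Reg 7)) Move Skip).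

Definition RootInit : cmd :=
  Seq (Store 4 (Reg 8) (Lit 1)) (Seq (Assign 5 (Reg 8)) (Seq (Assign 6 (Reg 8)) (Assign 7 (Lit 0)))).

Definition RootBody : cmd :=
  If (AliveE (Reg 8))
     (Seq RootInit
          (While (NotE (Reg 7)) WalkBody))
     Skip.

Definition PopBody : cmd :=
  Seq (Seq (Assign 4 (Defs.Sub (Reg 4) (Lit 1))) (Seq (Assign 5 (Get 5 (Reg 4)))
      (Seq (Store 3 (Reg 5) (Lit 0)) (Seq (Store 4 (Reg 5) (Lit 1)) (Assign 7 (Lit 0))))))
      TryAll.

Definition RowBody : cmd :=
  If (AdjE (Reg 1) (Reg 2))
     (Seq (Store 2 (Add (Mul (Lit 10) (Reg 1)) (Reg 3)) (Reg 2))
          (Assign 3 (Add (Reg 3) (Lit 1))))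
     Skip.

Definition BuildBody : cmd :=
  Seq (Seq (Store 2 (Mul (Lit 10) (Reg 1)) (Reg 1)) (Assign 3 (Lit 1))) (For 2 RowBody).

Definition algorithm : cmd :=
  Seq (For 1 BuildBody) (Seq (For 1 PendantBody) (Seq (For 1 WheelBody)
    (Seq (For 8 RootBody) (While (Lt (Lit 0) (Reg 4)) PopBody)))).

(** * Expressions compute the local tests *)

Section Evaluation.
Variables (n : nat) (E : rel 'I_n) (Esym : symmetric E) (Eirr : irreflexive E).
Variable W : nat.
Hypothesis bigW : 64 * (n + 2) ^ 2 <= W.

Let G := SGraph Esym Eirr.
Implicit Types (h u v w x y z : G) (P C : {set G}) (f : G -> bool).

Let W2 : 2 < W. Proof. by rewrite (leq_trans _ bigW) // -[in leqRHS]mulnn; lia. Qed.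
Let W64 : 64 < W. Proof. by rewrite (leq_trans _ bigW) // -[in leqRHS]mulnn; lia. Qed.
Let Wn : 10 * n + 20 < W. Proof. by rewrite (leq_trans _ bigW) // -[in leqRHS]mulnn; nia. Qed.

Lemma vertex_lt x : nat_of_ord x < W.
Proof. by have := ltn_ord x; lia. Qed.

(** With the vertex itself in slot 0, scanning the slots also covers the choices [p = h] and
    [q = p]. *)
Definition slot_table (slot : G -> nat -> G) :=
  (forall x, slot x 0 = x) /\ (forall x y, adj x y -> exists2 i, i < 10 & slot x i = y).

Definition graph_rep (slot : G -> nat -> G) (s : state) :=
  [/\ reg s 0 = n, forall x y : G, arr s 0 (nat_of_ord x * n + nat_of_ord y) = adj x y
    & forall x i, i < 10 -> arr s 2 (10 * nat_of_ord x + i) = slot x i].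

(** Storing deletion instead of presence lets zeroed memory represent the full graph. *)
Definition alive_rep P (s : state) := forall x, arr s 3 (nat_of_ord x) = (x \notin P).
Definition coloured_rep C (s : state) := forall x, arr s 4 (nat_of_ord x) = (x \in C).
Definition colour_rep f (s : state) := forall x, arr s 1 (nat_of_ord x) = f x.

Section State.
Variables (slot : G -> nat -> G) (s : state) (P C : {set G}) (f : G -> bool).
Hypotheses (st : slot_table slot) (gr : graph_rep slot s) (ar : alive_rep P s).

Definition denotes (e : expr) (x : G) := evals W s e (nat_of_ord x).
Definition tests (e : expr) (b : bool) := evals W s e b.

Lemma denotes_reg r x : reg s r = x -> denotes (Reg r) x.
Proof. by move=> rx; apply: evals_reg => //; apply: vertex_lt. Qed.

Lemma tests_lit (b : bool) : tests (Lit b) b.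
Proof. by apply: evals_lit; case: b; lia. Qed.

Lemma tests_not e b : tests e b -> tests (NotE e) (~~ b).
Proof. exact: evals_not. Qed.

Lemma tests_and e1 e2 b1 b2 : tests e1 b1 -> tests e2 b2 -> tests (AndE e1 e2) (b1 && b2).
Proof. exact: evals_and. Qed.

Lemma tests_or e1 e2 b1 b2 : tests e1 b1 -> tests e2 b2 -> tests (OrE e1 e2) (b1 || b2).
Proof. exact: evals_or. Qed.

Lemma tests_eqb e1 e2 b1 b2 : tests e1 b1 -> tests e2 b2 -> tests (Eq e1 e2) (b1 == b2).
Proof. exact: evals_eqb. Qed.

Lemma tests_eqv e1 e2 x y : denotes e1 x -> denotes e2 y -> tests (Eq e1 e2) (x == y).
Proof. by move=> h1 h2; apply: (evals_eq (ltnW W2) h1 h2). Qed.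

Lemma tests_ands_nil : tests (AndsE [::]) true.
Proof. exact: (tests_lit true). Qed.

Lemma tests_ands_cons e l b1 b2 :
  tests e b1 -> tests (AndsE l) b2 -> tests (AndsE (e :: l)) (b1 && b2).
Proof. exact: tests_and. Qed.

Lemma tests_adj e1 e2 x y : denotes e1 x -> denotes e2 y -> tests (AdjE e1 e2) (adj x y).
Proof.
have [r0 mx _] := gr => h1 h2; apply: (evals_get _ (mx x y)); last by case: (adj x y); lia.
have := ltn_ord x; have := ltn_ord y => ly lx.
apply: evals_add => //; last by nia.
by apply: evals_mul => //; [apply: evals_reg => //; lia | nia].
Qed.

Lemma denotes_slot e x i : i < 10 -> denotes e x -> denotes (SlotE e i) (slot x i).
Proof.
have [_ _ sl] := gr => i10 h; apply: (evals_get _ (sl x i i10)); last exact: vertex_lt.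
have := ltn_ord x => lx.
apply: evals_add; [|by apply: evals_lit; lia|by lia].
by apply: evals_mul => //; [apply: evals_lit; lia | lia].
Qed.

Lemma tests_alive e x : denotes e x -> tests (AliveE e) (x \in P).
Proof.
move=> h; rewrite -[x \in P]negbK; apply: tests_not.
by apply: (evals_get h (ar x)); case: (_ \notin _); lia.
Qed.

Lemma tests_ex e u F (B : pred G) : denotes e u ->
  (forall e' x, denotes e' x -> tests (F e') (B x)) -> tests (ExE e F) (exN P u B).
Proof.
move=> h H.
have -> : exN P u B = has (fun i => ((slot u i \in P) && adj u (slot u i)) && B (slot u i)) slots.
  apply/exNP/hasP => [[x [xP ux Bx]]|[i _ /andP[/andP[xP ux] Bx]]].
    have [i i10 e'] := st.2 u x ux.
    by exists i; rewrite ?mem_iota // e' xP ux Bx.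
  by exists (slot u i).
have : {subset slots <= gtn 10} by move=> i; rewrite mem_iota.
rewrite /ExE; elim: slots => [|i l IH] il /=; first exact: (tests_lit false).
have i10 : i < 10 by apply: il; rewrite inE eqxx.
have hs := denotes_slot i10 h.
apply: tests_or; last by apply: IH => j jl; apply: il; rewrite inE jl orbT.
apply: tests_and; last exact: H.
by apply: tests_and; [apply: tests_alive | apply: tests_adj].
Qed.

Lemma eq_exN u (B B' : pred G) : B =1 B' -> exN P u B = exN P u B'.
Proof. by move=> e; apply: eq_existsb => x; rewrite e. Qed.

Lemma tests_same_adj e1 e2 x y : denotes e1 x -> denotes e2 y ->
  tests (SameAdjE e1 e2) (same_or_adj x y).
Proof. by move=> h1 h2; apply: tests_or; [apply: tests_eqv | apply: tests_adj]. Qed.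

Ltac tests_auto :=
  lazymatch goal with
  | |- tests (AndsE [::]) _ => exact: tests_ands_nil
  | |- tests (AndsE (_ :: _)) _ => apply: tests_ands_cons; tests_auto
  | |- tests (NotE _) _ => apply: tests_not; tests_auto
  | |- tests (AdjE _ _) _ => apply: tests_adj; eassumption
  | |- tests (Eq _ _) _ => apply: tests_eqv; eassumption
  | |- tests (OrE _ _) _ => apply: tests_or; tests_auto
  | |- tests (AliveE _) _ => apply: tests_alive; eassumption
  | |- tests (SameAdjE _ _) _ => apply: tests_same_adj; eassumption
  | |- tests (AndE _ _) _ => apply: tests_and; tests_auto
  | |- tests (Lit 1) _ => exact: (tests_lit true)
  | |- tests (ExE _ _) _ => apply: tests_ex; [eassumption | intros; tests_auto]
  | |- _ => idtac
  end.

Lemma eq_tests e b b' : b = b' -> tests e b -> tests e b'.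
Proof. by move->. Qed.

Lemma tests_pendant_config ev ea eb ec ed ee v a b c d e :
  denotes ev v -> denotes ea a -> denotes eb b -> denotes ec c -> denotes ed d -> denotes ee e ->
  tests (PendantConfigE ev ea eb ec ed ee) (pendant_config v a b c d e).
Proof.
move=> hv ha hb hc hd he; rewrite /PendantConfigE.
apply: eq_tests; last by tests_auto.
by rewrite /pendant_config andbT.
Qed.

Lemma tests_wheel_config ev e1 e2 e3 e4 e5 v u1 u2 u3 u4 u5 :
  denotes ev v -> denotes e1 u1 -> denotes e2 u2 -> denotes e3 u3 -> denotes e4 u4 -> denotes e5 u5 ->
  tests (WheelConfigE ev e1 e2 e3 e4 e5) (wheel_config v u1 u2 u3 u4 u5).
Proof.
move=> hv h1 h2 h3 h4 h5; rewrite /WheelConfigE.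
apply: eq_tests; last by tests_auto.
by rewrite /wheel_config andbT.
Qed.

Lemma tests_ex_pendant ea a F (B : G -> G -> pred G) : denotes ea a ->
  (forall ev eb ec v b c, denotes ev v -> denotes eb b -> denotes ec c ->
     tests (F ev eb ec) (B v b c)) ->
  tests (ExPendantE ea F) (exPendant P a B).
Proof.
move=> ha H; rewrite /ExPendantE /exPendant.
apply: tests_ex => // ev v hv; apply: tests_ex => // eb b hb; apply: tests_ex => // ec c hc.
apply: tests_ex => // ed d hd; apply: tests_ex => // ee e he.
by apply: tests_and; [apply: tests_pendant_config | apply: H].
Qed.

Lemma tests_pendant ea a : denotes ea a -> tests (PendantE ea) (pendant_test P a).
Proof. by move=> ha; apply: tests_ex_pendant => // *; apply: (tests_lit true). Qed.

Lemma forall_exN u (B : pred G) :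
  [forall w in P, adj u w ==> B w] = ~~ exN P u (fun w => ~~ B w).
Proof.
rewrite -[LHS]negbK; congr (~~ _); apply/forall_inPn/exNP => [[w wP]|[w [wP uw nB]]].
  by rewrite negb_imply => /andP[uw nB]; exists w.
by exists w; rewrite // negb_imply uw.
Qed.

Lemma tests_guard ea ex a x : denotes ea a -> denotes ex x -> tests (GuardE ea ex) (guard_test P a x).
Proof.
move=> ha hx; rewrite /GuardE /guard_test.
apply: tests_and; first exact: tests_alive.
apply: tests_and; first exact: tests_adj.
apply: tests_ex_pendant => // ev eb _ v b _ hv hb _.
apply: tests_ex => // ey y hy; apply: tests_ex => // ep p hp.
rewrite /GuardConfigE; apply: eq_tests; last by tests_auto.
by rewrite /guard forall_exN andbT.
Qed.

Lemma tests_wheel ev v : denotes ev v -> tests (WheelE ev) (wheel_test P v).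
Proof.
move=> hv; rewrite /WheelE /wheel_test.
apply: tests_ex => // e1 u1 h1; apply: tests_ex => // e2 u2 h2; apply: tests_ex => // e3 u3 h3.
apply: tests_ex => // e4 u4 h4; apply: tests_ex => // e5 u5 h5.
exact: tests_wheel_config.
Qed.

Lemma tests_dominated eu ev u v : denotes eu u -> denotes ev v ->
  tests (DominatedE eu ev) (dominated P u v).
Proof.
move=> hu hv; rewrite /DominatedE; apply: eq_tests; last by tests_auto.
by rewrite /dominated forall_exN.
Qed.

Lemma tests_block col g eu u q b : coloured_rep C s -> denotes eu u -> tests q b ->
  (forall e x, denotes e x -> tests (col e) (g x)) ->
  tests (BlockE col eu q) (block_test P C g u b).
Proof.
move=> cr hu hq hc; rewrite /BlockE /block_test.
have hC e x : denotes e x -> tests (Get 4 e) (x \in C).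
  by move=> h; apply: (evals_get h (cr x)); case: (_ \in _); lia.
apply: tests_ex => // ex x hx; apply: tests_ex => // ey y hy; apply: tests_ex => // ez z hz.
apply: eq_tests; last first.
  do 3![apply: tests_ands_cons; first by apply: hC; eassumption].
  do 3![apply: tests_ands_cons; first by apply: tests_eqb; [apply: hc; eassumption | exact: hq]].
  by tests_auto.
rewrite andbT; congr [&& _, _, _, _, _, _, _, _, _ & ~~ _].
by apply: eq_exN => w; rewrite andbT.
Qed.

Lemma tests_recolour h c ep eq e p q x : reg s 5 = nat_of_ord h -> colour_rep f s ->
  denotes ep p -> denotes eq q -> denotes e x ->
  tests (RecolourE c ep eq e) (recolour f h c p q x).
Proof.
move=> r5 cf hp hq hx; rewrite /RecolourE /recolour.
have hf : tests (Get 1 e) (f x) by apply: (evals_get hx (cf x)); case: (f x); lia.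
have hh := denotes_reg r5.
apply: (eq_tests (b := ((x == h) && c) || (~~ (x == h) && ~~ (f x == ((x == p) || (x == q)))))).
  by case: (x == h); rewrite /= ?andbT ?orbF //; case: (f x); case: (_ || _).
apply: tests_or; apply: tests_and; try exact: tests_lit; try exact: tests_eqv.
  by apply: tests_not; exact: tests_eqv.
apply: tests_not; apply: tests_eqb => //.
by apply: tests_or; exact: tests_eqv.
Qed.

Lemma tests_try (h : G) c ep eq p q : reg s 5 = nat_of_ord h -> colour_rep f s -> coloured_rep C s ->
  denotes ep p -> denotes eq q ->
  let g := recolour f h c p q in
  tests (TryE c ep eq) [&& same_or_adj h p, same_or_adj p q, p \in C, q \in C, ~~ block_test P C g h (g h),
                           ~~ block_test P C g p (g p) & ~~ block_test P C g q (g q)].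
Proof.
move=> r5 cf cr hp hq g; rewrite /TryE.
have hh := denotes_reg r5.
have hC e x : denotes e x -> tests (Get 4 e) (x \in C).
  by move=> h'; apply: (evals_get h' (cr x)); case: (_ \in _); lia.
have hc e x : denotes e x -> tests (RecolourE c ep eq e) (g x) by move=> hx; apply: tests_recolour.
have hb e x : denotes e x ->
    tests (NotE (BlockE (RecolourE c ep eq) e (RecolourE c ep eq e))) (~~ block_test P C g x (g x)).
  by move=> hx; apply: tests_not; apply: tests_block => //; apply: hc.
apply: eq_tests; last first.
  apply: tests_ands_cons; first exact: tests_same_adj hh hp.
  apply: tests_ands_cons; first exact: tests_same_adj hp hq.
  apply: tests_ands_cons; first exact: hC hp.
  apply: tests_ands_cons; first exact: hC hq.
  apply: tests_ands_cons; first exact: hb hh.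
  apply: tests_ands_cons; first exact: hb hp.
  apply: tests_ands_cons; first exact: hb hq.
  exact: tests_ands_nil.
by rewrite andbT.
Qed.

Lemma tests_next h prev ex x : reg s 5 = nat_of_ord h -> reg s 6 = nat_of_ord prev ->
  denotes ex x -> tests (NextE ex) (next_test P prev h x).
Proof.
move=> r5 r6 hx; have hh := denotes_reg r5; have hp := denotes_reg r6.
rewrite /NextE; apply: eq_tests; last by tests_auto.
by rewrite /next_test andbT.
Qed.

End State.
End Evaluation.

Lemma runs_pick W (I : eqType) (l : seq I) (i0 : I) cond act other (b : pred I) s Q :
  (forall i, i \in l -> evals W s (cond i) (b i)) ->
  (has b l -> runs W (act (nth i0 l (find b l))) s (tc (act (nth i0 l (find b l)))) Q) ->
  (~~ has b l -> runs W other s (tc other) Q) ->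
  runs W (FirstOf l cond act other) s (tc (FirstOf l cond act other)) Q.
Proof.
elim: l => [|i l IH] /= hc ha ho; first exact: ho.
apply: (@runs_if _ _ _ (b i)); first by apply: hc; rewrite inE eqxx.
  by move=> bi; move: ha; rewrite bi /=; apply.
move=> /negPf nb; rewrite nb /= in ha ho.
by apply: IH => // j jl; apply: hc; rewrite inE jl orbT.
Qed.

(** * Correctness of the passes *)

Section Execution.
Variables (n : nat) (E : rel 'I_n) (Esym : symmetric E) (Eirr : irreflexive E).
Let G := SGraph Esym Eirr.
Hypotheses (noclaw : ~ contains_induced claw G) (noK5 : ~ minor (complete 5) G).
Implicit Types (u v w x y z a h p q : G) (r : nat) (P C : {set G}) (f g : G -> bool) (stk : seq G) (s : state).

(** Each [z] can be reinserted for every valid colouring of the set left by its deletion, since the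
    later passes and pops produce a colouring not known when [z] is pushed. *)
Fixpoint good_stack stk P : Prop :=
  if stk is z :: stk' then
    [/\ z \notin P, reinsertable (z |: P) z & good_stack stk' (z |: P)]
  else P = setT.

Lemma good_stack_size stk P : good_stack stk P -> #|P| + size stk = n.
Proof.
elim: stk P => [|z stk IH] P /=; first by move=> ->; rewrite cardsT card_ord addn0.
by case=> zP _ /IH; rewrite cardsU1 zP /=; lia.
Qed.

Variable W : nat.
Hypothesis bigW : 64 * (n + 2) ^ 2 <= W.
Variable slot : G -> nat -> G.
Hypothesis st : slot_table slot.

Let W2 : 2 < W. Proof. by rewrite (leq_trans _ bigW) // -[in leqRHS]mulnn; lia. Qed.
Let W64 : 64 < W. Proof. by rewrite (leq_trans _ bigW) // -[in leqRHS]mulnn; lia. Qed.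
Let Wn : 10 * n + 20 < W. Proof. by rewrite (leq_trans _ bigW) // -[in leqRHS]mulnn; nia. Qed.
Let Wb (b : bool) : b < W. Proof. by case: b; lia. Qed.

Fixpoint stack_rep stk s : Prop :=
  if stk is z :: stk' then arr s 5 (size stk') = nat_of_ord z /\ stack_rep stk' s else True.

Definition rep P C f stk s :=
  [/\ graph_rep slot s, alive_rep P s, coloured_rep C s, colour_rep f s &
      reg s 4 = size stk /\ stack_rep stk s].

Lemma rep_reg P C f stk s r k : r != 0 -> r != 4 -> rep P C f stk s ->
  rep P C f stk (set_reg s r k).
Proof.
move=> r0 r4 [[g0 gm gs] ar cr fr [s4 sr]]; split=> //.
- by split=> //=; rewrite eq_sym (negbTE r0).
split; first by rewrite /= eq_sym (negbTE r4).
by elim: (stk) sr => //= z t IH [sz /IH].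
Qed.

Lemma stack_rep_ext stk s s' : (forall i, i < size stk -> arr s' 5 i = arr s 5 i) ->
  stack_rep stk s -> stack_rep stk s'.
Proof.
elim: stk => //= z t IH H [sz sr]; split; first by rewrite H.
by apply: IH => // i it; apply: H; apply: ltnW.
Qed.

Lemma rep_colour P C f stk s h (c : bool) : rep P C f stk s ->
  rep P C (upd f h c) stk (set_arr s 1 (nat_of_ord h) c).
Proof.
move=> [[g0 gm gs] ar cr fr [s4 sr]]; split=> //.
  by move=> x; rewrite /= val_eqE /upd; case: eqP => // _; apply: fr.
by split=> //; apply: stack_rep_ext sr.
Qed.

Lemma rep_colouring P C f g stk s : f =1 g -> rep P C f stk s -> rep P C g stk s.
Proof. by move=> fg [gr ar cr fr sr]; split=> // x; rewrite fr fg. Qed.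

Lemma rep_mark P C f stk s z : rep P C f stk s ->
  rep P (z |: C) f stk (set_arr s 4 (nat_of_ord z) 1).
Proof.
move=> [[g0 gm gs] ar cr fr [s4 sr]]; split=> //.
  by move=> x; rewrite /= val_eqE !inE; case: eqP => // _; apply: cr.
by split=> //; apply: stack_rep_ext sr.
Qed.

Lemma rep_revive P C f stk s z : rep P C f stk s ->
  rep (z |: P) C f stk (set_arr s 3 (nat_of_ord z) 0).
Proof.
move=> [[g0 gm gs] ar cr fr [s4 sr]]; split=> //.
  by move=> x; rewrite /= val_eqE !inE; case: eqP => // _; apply: ar.
by split=> //; apply: stack_rep_ext sr.
Qed.

Lemma runs_push P C f stk s z Q : rep P C f stk s -> reg s 9 = nat_of_ord z -> size stk <= n ->
  (forall s', rep (P :\ z) C f (z :: stk) s' -> (forall r, r != 4 -> reg s' r = reg s r) -> Q s') ->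
  runs W Push s (tc Push) Q.
Proof.
move=> [[g0 gm gs] ar cr fr [s4 sr]] r9 szn HQ.
have r9' s' : reg s' 9 = reg s 9 -> evals W s' (Reg 9) (nat_of_ord z).
  by move=> e; apply: evals_reg; [rewrite e | apply: vertex_lt bigW _].
apply: (@runs_seq _ _ _ _ _ _ (fun s' => s' = set_arr s 5 (size stk) (nat_of_ord z))).
  by apply: runs_store; [apply: evals_reg s4 _; lia | exact: r9' | ].
move=> _ ->; apply: (@runs_seq _ _ _ _ _ _ (fun s' => s' = set_reg (set_arr s 5 (size stk) (nat_of_ord z)) 4 (size stk + 1))).
  apply: runs_assign; last by [].
  by apply: evals_add; [apply: evals_reg => //; lia | apply: evals_lit; lia | lia].
move=> _ ->; apply: runs_store; [exact: r9' | by apply: evals_lit; lia |].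
apply: HQ; last by move=> r r4 /=; rewrite (negbTE r4).
split=> //.
  by move=> x; rewrite /= val_eqE !inE negb_and negbK; case: eqP => // _; apply: ar.
split; first by rewrite /= addn1.
rewrite /= eqxx; split=> //; apply: stack_rep_ext sr => i it /=.
by rewrite (ltn_eqF it).
Qed.

Lemma rep_state P C f stk s : rep P C f stk s -> graph_rep slot s /\ alive_rep P s.
Proof. by case. Qed.

(** Nothing is coloured during the deletions: [set0] and the constant [false] are what zeroed arrays
    4 and 1 represent. The last clause persists by [pendant_test_sub]. *)
Definition pendant_inv (a : nat) s := exists P stk,
  [/\ rep P set0 (fun=> false) stk s, good_stack stk P, no_odd_hole P &
      forall x, x \in P -> x < a -> ~~ pendant_test P x].

Lemma slots_lt i : i \in slots -> i < 10.
Proof. by rewrite mem_iota. Qed.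

Lemma slotsP u y : adj u y -> exists2 i, i \in slots & slot u i = y.
Proof. by move=> /st.2[i i10 e]; exists i; rewrite // mem_iota. Qed.

Lemma good_push stk P z : good_stack stk P -> reinsertable P z -> good_stack (z :: stk) (P :\ z).
Proof. by move=> gs rz; have zP := rz.1; rewrite /= setD1K // !inE eqxx. Qed.

Lemma runs_pendant_body (i : nat) s : i < n -> reg s 1 = i -> pendant_inv i s ->
  runs W PendantBody s (tc PendantBody) (fun s' => pendant_inv i.+1 s' /\ reg s' 1 = i).
Proof.
move=> iL r1 [P [stk [rp gs nP old]]].
pose a : G := Ordinal iL; have r1a : reg s 1 = nat_of_ord a by [].
have [gr ar] := rep_state rp.
have da : denotes W s (Reg 1) a by apply: (denotes_reg bigW r1a).
have keep P' : P' \subset P -> ~~ pendant_test P' a -> forall x, x \in P' -> x < i.+1 -> ~~ pendant_test P' x.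
  move=> sP na x xP'; rewrite ltnS leq_eqVlt => /orP[/eqP xi|xi].
    by have -> : x = a by apply: val_inj.
  by apply: contra (old x (subsetP sP x xP') xi); apply: pendant_test_sub.
have keep' P' : P' \subset P -> a \notin P' -> forall x, x \in P' -> x < i.+1 -> ~~ pendant_test P' x.
  move=> sP na x xP'; rewrite ltnS leq_eqVlt => /orP[/eqP xi|xi].
    by have xa : x = a by [apply: val_inj]; rewrite xa (negbTE na) in xP'.
  by apply: contra (old x (subsetP sP x xP') xi); apply: pendant_test_sub.
have szn := good_stack_size gs.
apply: (@runs_if _ _ _ ((a \in P) && pendant_test P a)).
- apply: (tests_and bigW).
    exact: (tests_alive bigW ar da).
  exact: (tests_pendant bigW st gr ar da).
- case/andP => aP pa.
  apply: (@runs_seq _ _ _ _ _ _ (fun s' => reg s' 1 = i /\ exists P' stk',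
     [/\ rep P' set0 (fun=> false) stk' s', good_stack stk' P', P' \subset P, reinsertable P' a
       & no_odd_hole (P' :\ a)])).
    apply: (@runs_pick _ _ _ 0 _ _ _ (fun j => guard_test P a (slot a j))).
    + move=> j /slots_lt j10; apply: (tests_guard bigW st gr ar da).
      exact: (denotes_slot bigW gr j10 da).
    + rewrite has_find; set j := nth _ _ _ => jh.
      have gj : guard_test P a (slot a j) by apply: (@nth_find _ 0 (fun j => guard_test P a (slot a j))); rewrite has_find.
      have j10 : j < 10 by apply: slots_lt; apply: mem_nth.
      have [xa nx rx rea nxa] := guard_step noclaw noK5 aP nP gj.
      apply: (@runs_seq _ _ _ _ _ _ (fun s' => s' = set_reg s 9 (nat_of_ord (slot a j)))).
        by apply: runs_assign; [exact: (denotes_slot bigW gr j10 da) | ].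
      move=> _ ->; apply: (runs_push (P := P) (C := set0) (f := fun=> false) (stk := stk) (z := slot a j)).
      * exact: rep_reg.
      * by [].
      * by lia.
      move=> s' rp' rg; split; first by rewrite rg.
      exists (P :\ slot a j), (slot a j :: stk); split=> //; first exact: good_push.
      exact: subD1set.
    move=> nh; apply: runs_skip; split=> //; exists P, stk.
    have [//|ra na] := pendant_step noclaw noK5 aP nP pa.
      move=> x; apply/negP => gx; move/negP: nh; apply.
      have /and3P[_ ax _] := gx.
      by have [j js e] := slotsP ax; apply/hasP; exists j; [exact: js | rewrite e; exact: gx].
    by split.
  move=> s1 [r1' [P' [stk' [rp' gs' sP ra na]]]].
  apply: (@runs_seq _ _ _ _ _ _ (fun s' => s' = set_reg s1 9 (nat_of_ord a))).
    by apply: runs_assign; [exact: (denotes_reg bigW (x := a) r1') | ].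
  move=> _ ->; apply: (runs_push (P := P') (C := set0) (f := fun=> false) (stk := stk') (z := a)).
  + exact: rep_reg.
  + by [].
  + by have := good_stack_size gs'; lia.
  move=> s' rp2 rg; split; last by rewrite rg.
  exists (P' :\ a), (a :: stk'); split=> //; first exact: good_push.
  apply: keep'; first exact: subset_trans (subD1set _ _) sP.
  by rewrite !inE eqxx.
rewrite negb_and => na; apply: runs_skip; split=> //; exists P, stk; split=> //.
by case/orP: na => na; [apply: keep' | apply: keep].
Qed.

Definition wheel_inv (v : nat) s := exists P stk,
  [/\ rep P set0 (fun=> false) stk s, good_stack stk P, no_odd_hole P, pendant_free P &
      forall x, x \in P -> x < v -> ~~ wheel_test P x].

Lemma pendant_free_sub P P' : P' \subset P -> pendant_free P -> pendant_free P'.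
Proof. by move=> /subsetP s pf v a b c d e *; apply: pf; apply: s. Qed.

Lemma runs_wheel_body (i : nat) s : i < n -> reg s 1 = i -> wheel_inv i s ->
  runs W WheelBody s (tc WheelBody) (fun s' => wheel_inv i.+1 s' /\ reg s' 1 = i).
Proof.
move=> iL r1 [P [stk [rp gs nP pf old]]].
pose a : G := Ordinal iL; have r1a : reg s 1 = nat_of_ord a by [].
have [gr ar] := rep_state rp.
have da : denotes W s (Reg 1) a by apply: (denotes_reg bigW r1a).
have keep P' : P' \subset P -> (a \in P' -> ~~ wheel_test P' a) ->
    forall x, x \in P' -> x < i.+1 -> ~~ wheel_test P' x.
  move=> sP na x xP'; rewrite ltnS leq_eqVlt => /orP[/eqP xi|xi].
    by have xa : x = a by [apply: val_inj]; rewrite xa in xP' *; apply: na.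
  by apply: contra (old x (subsetP sP x xP') xi); apply: wheel_test_sub.
have szn := good_stack_size gs.
apply: (@runs_if _ _ _ ((a \in P) && wheel_test P a)).
- apply: (tests_and bigW).
    exact: (tests_alive bigW ar da).
  exact: (tests_wheel bigW st gr ar da).
- case/andP => aP wa.
  (* Whether [z] is a dominated rim vertex or the hub [a] itself, [a] is no longer the hub of a
     5-wheel afterwards, so one deletion per index suffices. *)
  apply: (@runs_seq _ _ _ _ _ _ (fun s' => exists z, [/\ s' = set_reg s 9 (nat_of_ord z),
     reinsertable P z, no_odd_hole (P :\ z) & a \in P :\ z -> ~~ wheel_test (P :\ z) a])).
    apply: (@runs_pick _ _ _ 0 _ _ _ (fun j => (slot a j \in P) && dominated P (slot a j) a)).
    + move=> j /slots_lt j10; have dj : denotes W s (SlotE (Reg 1) j) (slot a j) by apply: (denotes_slot bigW gr j10 da).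
      apply: (tests_and bigW).
        exact: (tests_alive bigW ar dj).
      exact: (tests_dominated bigW st gr ar).
    + rewrite has_find; set j := nth _ _ _ => jh.
      have /andP[jP dj] : (slot a j \in P) && dominated P (slot a j) a.
        by apply: (@nth_find _ 0 (fun j => (slot a j \in P) && dominated P (slot a j) a)); rewrite has_find.
      have j10 : j < 10 by apply: slots_lt; apply: mem_nth.
      apply: runs_assign; first exact: (denotes_slot bigW gr j10 da).
      have [rz nz] := dominated_step noclaw jP aP nP wa dj.
      exists (slot a j); split=> // _; apply: (wheel_test_del noclaw noK5) => //.
      by case/andP: dj.
    move=> nh; apply: runs_assign; first exact: da.
    have [|ra na] := wheel_step noclaw noK5 aP nP pf wa.
      move=> u uP; apply/negP => du; move/negP: nh; apply.
      have /andP[au _] := du.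
      by have [j js e] := slotsP au; apply/hasP; exists j; [exact: js | rewrite e uP; exact: du].
    by exists a; split=> //; rewrite !inE eqxx.
  move=> _ [z [-> rz nz wz]].
  apply: (runs_push (P := P) (C := set0) (f := fun=> false) (stk := stk) (z := z)).
  + exact: rep_reg.
  + by [].
  + by lia.
  move=> s' rp2 rg; split; last by rewrite rg.
  have sP : P :\ z \subset P by apply: subD1set.
  exists (P :\ z), (z :: stk); split=> //; first exact: good_push.
    exact: pendant_free_sub sP pf.
  exact: keep.
rewrite negb_and => na; apply: runs_skip; split=> //; exists P, stk; split=> //.
by apply: keep => // aP; rewrite aP in na.
Qed.

Lemma mem_tries c i j : i < 10 -> j < 10 -> (c, i, j) \in tries.
Proof.
move=> i10 j10; apply/allpairsP; exists (c, i, j); split; rewrite ?mem_iota //.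
by apply/allpairsP; exists (c, i); rewrite mem_iota; case: (c).
Qed.

Lemma tries_lt t : t \in tries -> t.1.2 < 10 /\ t.2 < 10.
Proof.
case/allpairsP => [[cp j] [/allpairsP[[c i] [_ i10 ->]] j10 ->]] /=.
by move: i10 j10; rewrite !mem_iota.
Qed.

Definition try_test P C f h (t : bool * nat * nat) :=
  let p := slot h t.1.2 in let q := slot p t.2 in let g := recolour f h t.1.1 p q in
  [&& same_or_adj h p, same_or_adj p q, p \in C, q \in C, ~~ block_test P C g h (g h),
      ~~ block_test P C g p (g p) & ~~ block_test P C g q (g q)].

Lemma try_test_sound P C f h t : h \in C -> C \subset P -> valid P (C :\ h) f ->
  try_test P C f h t ->
  let p := slot h t.1.2 in let q := slot p t.2 in valid P C (recolour f h t.1.1 p q).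
Proof.
move=> hC /subsetP CP vf; rewrite /try_test -!block_testE //.
set p := slot h _; set q := slot p _ => /and5P[_ _ pC qC /and3P[bh bp bq]].
apply: (valid_change (D := [set x | [|| x == h, x == p | x == q]]) vf).
- apply/subsetP => x; rewrite !inE => /andP[]; rewrite negb_or => /andP[-> _] ->.
  by [].
- by move=> x; rewrite !inE /recolour => /andP[]; case: (x == h) => //= /negPf-> _; rewrite addbF.
by move=> u _ _; rewrite inE => /or3P[] /eqP->.
Qed.

Lemma try_test_complete P C f h : h \in C -> C \subset P -> resolvable P C f h ->
  has (try_test P C f h) tries.
Proof.
move=> hC /subsetP CP /resolvableP[c [p [q [pC qC hp pq /validP vg]]]].
have near a b : (b == a) || adj a b -> exists2 i, i < 10 & slot a i = b.
  by case/orP => [/eqP->|/st.2 //]; exists 0; rewrite ?st.1.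
have [i i10 ei] := near h p hp; have [j j10 ej] := near p q pq.
apply/hasP; exists (c, i, j); first exact: mem_tries.
by rewrite /try_test /= ei ej pC qC -!block_testE // !vg ?CP // /same_or_adj (eq_sym h) hp (eq_sym p) pq.
Qed.

Lemma runs_try P C f stk s h : rep P C f stk s -> reg s 5 = nat_of_ord h -> reg s 7 = 0 ->
  h \in C -> C \subset P -> valid P (C :\ h) f ->
  runs W TryAll s (tc TryAll) (fun s' =>
    if resolvable P C f h then
      [/\ reg s' 7 = 1, reg s' 8 = reg s 8 & exists2 g, rep P C g stk s' & valid P C g]
    else s' = s).
Proof.
move=> rp r5 r7 hC CP vf; have [gr ar cr fr sr] := rp.
have dh : denotes W s (Reg 5) h by apply: (denotes_reg bigW r5).
have dP t : t \in tries -> denotes W s (TryP t) (slot h t.1.2).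
  by case/tries_lt => l1 l2; apply: (denotes_slot bigW gr l1 dh).
have dQ t : t \in tries -> denotes W s (TryQ t) (slot (slot h t.1.2) t.2).
  by move=> tt; case/tries_lt: (tt) => l1 l2; apply: (denotes_slot bigW gr l2 (dP t tt)).
apply: (@runs_pick _ _ _ (true, 0, 0) _ _ _ (try_test P C f h)).
- by move=> t tt; apply: (tests_try bigW st gr ar _ r5 fr cr (dP t tt) (dQ t tt)).
- move=> ht; set t := nth _ _ _.
  have tt : t \in tries by apply: mem_nth; rewrite -has_find.
  have ok : try_test P C f h t by apply: nth_find.
  have vg := try_test_sound hC CP vf ok.
  have /and5P[hp pq pC qC _] := ok.
  have res : resolvable P C f h.
    apply/resolvableP; exists t.1.1, (slot h t.1.2), (slot (slot h t.1.2) t.2).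
    by split=> //; rewrite eq_sym.
  rewrite res; move: vg => /=; set p := slot h _; set q := slot p _; set g := recolour _ _ _ _ _ => vg.
  pose s1 := set_reg s 10 (nat_of_ord p); pose s2 := set_reg s1 11 (nat_of_ord q).
  pose s3 := set_reg s2 12 (g p); pose s4 := set_reg s3 13 (g q).
  have rp2 : rep P C f stk s2 by do 2!apply: rep_reg => //.
  have rp3 : rep P C f stk s3 by apply: rep_reg.
  have rp4 : rep P C f stk s4 by apply: rep_reg.
  have dv r x s' : reg s' r = nat_of_ord x -> denotes W s' (Reg r) x := @denotes_reg _ _ _ _ _ bigW s' r x.
  apply: (@runs_seq _ _ _ _ _ _ (fun s' => s' = s1)).
    by apply: runs_assign; [exact: dP | ].
  move=> _ ->; apply: (@runs_seq _ _ _ _ _ _ (fun s' => s' = s2)).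
    apply: runs_assign; last by [].
    have [gr1 _ _ _ _] : rep P C f stk s1 by apply: rep_reg.
    have [l1 l2] := tries_lt tt.
    by apply: (denotes_slot bigW gr1 l2); apply: (denotes_slot bigW gr1 l1); apply: dv.
  move=> _ ->; have [gr2 ar2 cr2 fr2 _] := rp2.
  apply: (@runs_seq _ _ _ _ _ _ (fun s' => s' = s3)).
    apply: runs_assign; last by [].
    by apply: (tests_recolour bigW (f := f) (h := h) t.1.1) => //; apply: dv.
  move=> _ ->; have [gr3 ar3 cr3 fr3 _] := rp3.
  apply: (@runs_seq _ _ _ _ _ _ (fun s' => s' = s4)).
    apply: runs_assign; last by [].
    by apply: (tests_recolour bigW (f := f) (h := h) t.1.1) => //; apply: dv.
  move=> _ ->.
  have bv r (b : bool) s' : reg s' r = b -> evals W s' (Reg r) b.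
    by move=> e; apply: (evals_reg e).
  apply: (@runs_seq _ _ _ _ _ _ (fun s' => s' = set_arr s4 1 (nat_of_ord p) (g p))).
    by apply: runs_store; [exact: dv | exact: bv | ].
  move=> _ ->.
  apply: (@runs_seq _ _ _ _ _ _ (fun s' => s' = set_arr (set_arr s4 1 (nat_of_ord p) (g p)) 1 (nat_of_ord q) (g q))).
    by apply: runs_store; [exact: dv | exact: bv | ].
  move=> _ ->; set s6 := set_arr _ _ _ _.
  apply: (@runs_seq _ _ _ _ _ _ (fun s' => s' = set_arr s6 1 (nat_of_ord h) t.1.1)).
    by apply: runs_store; [exact: (dv 5 h s6 r5) | exact: (evals_lit _ (Wb t.1.1)) | ].
  move=> _ ->; apply: runs_assign; first exact: (evals_lit _ (Wb true)).
  split=> //; exists g => //; apply: rep_reg => //.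
  (* The three stores yield [g] even if [h], [p] and [q] coincide, because each writes the value of
     [g] at its vertex. *)
  apply: (rep_colouring (f := upd (upd (upd f p (g p)) q (g q)) h t.1.1)).
    move=> x; rewrite /upd /g /recolour; have [//|xh] := eqVneq x h.
    have [xq|xq] := eqVneq x q; first by rewrite -xq (negbTE xh) !eqxx.
    have [xp|xp] := eqVneq x p; last by rewrite addbF.
    by rewrite -xp (negbTE xh) !eqxx.
  by do 3!apply: rep_colour.
move=> nh; apply: runs_skip; case: ifP => // res.
by rewrite (try_test_complete hC CP res) in nh.
Qed.

Definition next_vertex P prev h : G :=
  slot h (nth 0 slots (find (fun i => next_test P prev h (slot h i)) slots)).

Lemma has_next P prev h x : next_test P prev h x ->
  has (fun i => next_test P prev h (slot h i)) slots.
Proof.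
by move=> nx; have /and3P[_ hx _] := nx; have [i il e] := slotsP hx; apply/hasP; exists i; rewrite ?e.
Qed.

Lemma next_vertexP P prev h x : next_test P prev h x ->
  next_test P prev h (next_vertex P prev h).
Proof.
by move=> /has_next; apply: (@nth_find _ 0 (fun i => next_test P prev h (slot h i))).
Qed.

Lemma runs_move P C f stk s h prev x : rep P C f stk s ->
  reg s 5 = nat_of_ord h -> reg s 6 = nat_of_ord prev -> next_test P prev h x ->
  runs W Move s (tc Move) (fun s' => let y := next_vertex P prev h in
    [/\ rep P C (upd f h (f y)) stk s', reg s' 5 = nat_of_ord y, reg s' 6 = nat_of_ord h,
        reg s' 7 = reg s 7 & reg s' 8 = reg s 8]).
Proof.
move=> rp r5 r6 nx; have [gr ar cr fr sr] := rp.
have dh : denotes W s (Reg 5) h by apply: (denotes_reg bigW r5).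
apply: (@runs_pick _ _ _ 0 _ _ _ (fun i => next_test P prev h (slot h i))).
- move=> i /slots_lt i10; apply: (tests_next bigW gr ar r5 r6).
  exact: (denotes_slot bigW gr i10 dh).
- move=> hf; rewrite /next_vertex; set i := nth _ _ _.
  have i10 : i < 10 by apply: slots_lt; apply: mem_nth; rewrite -has_find.
  set y := slot h i.
  have dv r z s' : reg s' r = nat_of_ord z -> denotes W s' (Reg r) z := @denotes_reg _ _ _ _ _ bigW s' r z.
  apply: (@runs_seq _ _ _ _ _ _ (fun s' => s' = set_reg s 10 (nat_of_ord y))).
    by apply: runs_assign; [exact: (denotes_slot bigW gr i10 dh) | ].
  move=> _ ->; set s1 := set_reg _ _ _.
  apply: (@runs_seq _ _ _ _ _ _ (fun s' => s' = set_arr s1 1 (nat_of_ord h) (f y))).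
    apply: runs_store; [exact: (dv 5 h s1 r5) | | by []].
    by apply: (evals_get (dv 10 y s1 erefl)); [exact: fr | exact: Wb].
  move=> _ ->; set s2 := set_arr _ _ _ _.
  have rp2 : rep P C (upd f h (f y)) stk s2 by apply: rep_colour; apply: rep_reg.
  apply: (@runs_seq _ _ _ _ _ _ (fun s' => s' = set_reg s2 6 (nat_of_ord h))).
    by apply: runs_assign; [exact: (dv 5 h s2 r5) | ].
  move=> _ ->; apply: runs_assign; first exact: (dv 10 y (set_reg s2 6 (nat_of_ord h)) erefl).
  by split=> //; do 2!apply: rep_reg => //.
by rewrite (has_next nx).
Qed.

Definition walk_cost := (cost (NotE (Reg 7))).+1 + tc WalkBody.

Lemma runs_walk P C f stk s (r : G) : tame P -> no_odd_hole P -> C \subset P ->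
  r \in C -> valid P (C :\ r) f -> rep P C f stk s ->
  reg s 5 = nat_of_ord r -> reg s 6 = nat_of_ord r -> reg s 7 = 0 ->
  runs W (While (NotE (Reg 7)) WalkBody) s ((2 * n + 1) * walk_cost + 4)
    (fun s' => (exists2 g, rep P C g stk s' & valid P C g) /\ reg s' 8 = reg s 8).
Proof.
move=> tP nP CP rC vf rp r5 r6 r7.
have [N NL [ok rN nr]] := walk_terminates noclaw tP nP CP (@next_vertexP P) rC vf.
pose t i := iter i (walk_step (next_vertex P)) (f, r, r).
have {}ok : forall i, i <= N -> walk_ok P C (t i) := ok.
have {}rN : resolvable P C (t N).1.1 (t N).1.2 := rN.
have {}nr : forall i, i < N -> ~~ resolvable P C (t i).1.1 (t i).1.2 := nr.
(* Rounds [0] to [N - 1] move the hole and round [N] succeeds; so there are [N.+1] rounds, and the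
   flag is set only at index [N.+1]. *)
pose I i s' := reg s' 8 = reg s 8 /\ if i <= N then
   [/\ rep P C (t i).1.1 stk s', reg s' 5 = nat_of_ord (t i).1.2,
       reg s' 6 = nat_of_ord (t i).2 & reg s' 7 = 0]
  else reg s' 7 = 1 /\ exists2 g, rep P C g stk s' & valid P C g.
have : runs W (While (NotE (Reg 7)) WalkBody) s
   (N.+1 * ((cost (NotE (Reg 7))).+1 + tc WalkBody) + (cost (NotE (Reg 7))).+1) (I N.+1).
  apply: (runs_while (I := I)).
  - move=> i s' _ [_]; rewrite ltnS; case: ifP => iN.
      by case=> _ _ _ r7'; have := evals_not W2 (b := false) (evals_reg r7' (Wb false)).
    by case=> r7' _; have := evals_not W2 (b := true) (evals_reg r7' (Wb true)).
  - move=> i s'; rewrite ltnS => iN [r8]; rewrite iN => -[rp' r5' r6' r7'].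
    have /and3P[hC vi _] := ok i iN.
    apply: (runs_seq (runs_try rp' r5' r7' hC CP vi)) => s1.
    have [Ni|Ni] := eqVneq i N.
      rewrite Ni rN => -[r71 r81 gg]; apply: (@runs_if _ _ _ false).
      + exact: (evals_not W2 (b := true) (evals_reg r71 (Wb true))).
      + by [].
      move=> _; apply: runs_skip; split; first by rewrite r81.
      by rewrite ltnn.
    have lt : i < N by rewrite ltn_neqAle Ni.
    rewrite (negbTE (nr i lt)) => ->; apply: (@runs_if _ _ _ true).
    + exact: (evals_not W2 (b := false) (evals_reg r7' (Wb false))).
    + move=> _; have [_ nx] := walk_next noclaw tP CP (@next_vertexP P) (ok i iN) (nr i lt).
      apply: runs_weaken (runs_move rp' r5' r6' nx) (leqnn _) _ => s2 [rp2 r52 r62 r72 r82].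
      split; first by rewrite r82.
      rewrite lt; move: rp2 r52 r62; rewrite /t iterS /walk_step.
      by case: (iter i _ _) => [[f' h'] p'] /= rp2 r52 r62; split; rewrite ?r72.
    by [].
  by split.
move/runs_weaken; apply.
  by rewrite -/walk_cost leq_add // leq_mul2r; have := card_ord n; rewrite /= in NL *; lia.
by move=> s' [r8]; rewrite ltnn => -[_ gg].
Qed.

(** Roots are taken in increasing order, so this is the coloured part when root [k] is reached. *)
Definition below P k := [set x in P | nat_of_ord x < k].

Lemma belowS P k (kL : k < n) :
  below P k.+1 = if Ordinal kL \in P then (Ordinal kL : G) |: below P k else below P k.
Proof.
apply/setP => x; rewrite !inE ltnS leq_eqVlt.
have -> : (nat_of_ord x == k) = (x == Ordinal kL) by [].
by case: ifP => xP; rewrite !inE; case: eqP => //= ->; rewrite ?xP ?ltnn ?andbF.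
Qed.

Definition root_inv P stk k s := exists2 f, rep P (below P k) f stk s & valid P (below P k) f.

Definition root_cost := (2 * n + 1) * walk_cost + tc RootBody + 4.

Lemma runs_root_body P stk k s : tame P -> no_odd_hole P -> k < n -> reg s 8 = k ->
  root_inv P stk k s ->
  runs W RootBody s root_cost (fun s' => root_inv P stk k.+1 s' /\ reg s' 8 = k).
Proof.
move=> tP nP kL r8 [f rp vf]; have [gr ar] := rep_state rp.
pose r : G := Ordinal kL.
have r8r : reg s 8 = nat_of_ord r by [].
have dr : denotes W s (Reg 8) r by apply: (denotes_reg bigW r8r).
have : runs W RootBody s ((cost (AliveE (Reg 8))).+1 + ((tc RootInit + ((2 * n + 1) * walk_cost + 4)) + 1))
   (fun s' => root_inv P stk k.+1 s' /\ reg s' 8 = k).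
  apply: (runs_if (b := r \in P)).
  - exact: (tests_alive bigW ar dr).
  - move=> rP; set C := r |: below P k.
    have Ck : below P k.+1 = C by rewrite (belowS _ kL) rP.
    have CP : C \subset P by rewrite -Ck; apply/subsetP => x; rewrite inE => /andP[].
    have rC : r \in C by rewrite !inE eqxx.
    have Cr : C :\ r = below P k by rewrite /C setU1K // inE ltnn andbF.
    apply: (@runs_seq _ _ _ _ _ _ (fun s' => [/\ rep P C f stk s', reg s' 5 = nat_of_ord r,
       reg s' 6 = nat_of_ord r, reg s' 7 = 0 & reg s' 8 = k])).
      have rp1 := rep_mark r rp; set s1 := set_arr s _ _ _ in rp1.
      apply: (@runs_seq _ _ _ _ _ _ (fun s' => s' = s1)).
        by apply: runs_store; [exact: dr | exact: (evals_lit _ (Wb true)) | ].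
      move=> _ ->; apply: (@runs_seq _ _ _ _ _ _ (fun s' => s' = set_reg s1 5 k)).
        by apply: runs_assign; [exact: (@denotes_reg _ _ _ _ _ bigW s1 8 r) | ].
      move=> _ ->; apply: (@runs_seq _ _ _ _ _ _ (fun s' => s' = set_reg (set_reg s1 5 k) 6 k)).
        by apply: runs_assign; [exact: (@denotes_reg _ _ _ _ _ bigW _ 8 r) | ].
      move=> _ ->; apply: runs_assign; first exact: (evals_lit _ (Wb false)).
      by split=> //; do 3!apply: rep_reg => //.
    move=> s1 [rp1 r51 r61 r71 r81].
    have vf' : valid P (C :\ r) f by rewrite Cr.
    apply: runs_weaken (runs_walk tP nP CP rC vf' rp1 r51 r61 r71) (leqnn _) _ => s2 [[g rg vg] r82].
    by split; [exists g; rewrite Ck | rewrite r82].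
  move=> rP; apply: runs_skip; split=> //; exists f; rewrite (belowS _ kL) (negbTE rP) //.
(* [tc RootBody] counts its inner loop as 0; the term with [walk_cost] accounts for it. *)
move/runs_weaken; apply=> //; rewrite /root_cost.
have -> : tc RootBody = (cost (AliveE (Reg 8))).+1 + (tc RootInit + 0 + 1) by [].
by move: (tc RootInit) (cost _) (_ * walk_cost) => a b c; lia.
Qed.

Lemma runs_pop_body P stk f s z : z \notin P -> reinsertable (z |: P) z ->
  rep P P f (z :: stk) s -> valid P P f -> size stk < n ->
  runs W PopBody s (tc PopBody)
    (fun s' => exists2 g, rep (z |: P) (z |: P) g stk s' & valid (z |: P) (z |: P) g).
Proof.
move=> zP [_ rz] rp vf szn; have [gr ar cr fr [s4 [sz sr]]] := rp.
have vf' : valid (z |: P) ((z |: P) :\ z) f by apply: valid_reinsert; rewrite setU1K.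
have res : resolvable (z |: P) (z |: P) f z by apply: rz; rewrite setU1K.
apply: (@runs_seq _ _ _ _ _ _ (fun s' => [/\ rep (z |: P) (z |: P) f stk s',
   reg s' 5 = nat_of_ord z & reg s' 7 = 0])).
  have sL : size stk < W by lia.
  have sL' : (size stk).+1 < W by lia.
  pose s1 := set_reg s 4 (size stk).
  have rp1 : rep P P f stk s1.
    have [g0 gm gs] := gr; split=> //; split=> //.
    by apply: stack_rep_ext sr.
  apply: (@runs_seq _ _ _ _ _ _ (fun s' => s' = s1)).
    apply: runs_assign; first exact: (evals_sub (evals_reg s4 sL') (evals_lit _ (ltnW W2)) sL').
    by rewrite /s1 /= subn1.
  move=> _ ->; apply: (@runs_seq _ _ _ _ _ _ (fun s' => s' = set_reg s1 5 (nat_of_ord z))).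
    apply: runs_assign; last by [].
    apply: (evals_get (j := size stk)); [exact: evals_reg | exact: sz | exact: (vertex_lt bigW)].
  move=> _ ->; set s2 := set_reg s1 _ _.
  have rp2 : rep P P f stk s2 by apply: rep_reg.
  have d5 s' : reg s' 5 = nat_of_ord z -> denotes W s' (Reg 5) z by move=> e; apply: (denotes_reg bigW e).
  apply: (@runs_seq _ _ _ _ _ _ (fun s' => s' = set_arr s2 3 (nat_of_ord z) 0)).
    by apply: runs_store; [exact: d5 | exact: (evals_lit _ (Wb false)) | ].
  move=> _ ->; have rp3 := rep_revive z rp2; set s3 := set_arr s2 _ _ _ in rp3 *.
  apply: (@runs_seq _ _ _ _ _ _ (fun s' => s' = set_arr s3 4 (nat_of_ord z) 1)).
    by apply: runs_store; [exact: d5 | exact: (evals_lit _ (Wb true)) | ].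
  move=> _ ->; have rp4 := rep_mark z rp3.
  apply: runs_assign; first exact: (evals_lit _ (Wb false)).
  by split=> //; apply: rep_reg.
move=> s1 [rp1 r51 r71]; have zC : z \in z |: P by rewrite !inE eqxx.
apply: runs_weaken (runs_try rp1 r51 r71 zC (subxx _) vf') (leqnn _) _ => s2.
by rewrite res => -[_ _].
Qed.

End Execution.

(** * Translation to clique colourings and cycle components *)

Lemma valid_clique_coloring (G : sgraph) (f : G -> bool) :
  valid setT setT f -> clique_coloring2 (fun x => if f x then green else red).
Proof.
move=> /validP vf K /maxsetP[Kc Kmax] K1 [c mono].
have [x xK] : exists x, x \in K by apply/card_gt0P; lia.
have fE y : y \in K -> f y = f x.
  by move=> yK; have := mono x xK; rewrite -(mono y yK); case: (f x); case: (f y).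
have adjK y z : y \in K -> z \in K -> y != z -> adj y z.
  move=> yK zK yz; move/forall_inP/(_ y yK)/forall_inP/(_ z zK): Kc.
  by rewrite yz.
have /negP := vf x (in_setT x) (in_setT x); apply; apply/blockedP; exists (K :\ x).
apply/blockP; split.
- by apply/card_gt0P; move: K1; rewrite (cardsD1 x) xK.
- move=> y; rewrite !inE => /andP[yx yK]; split=> //; last exact: fE.
  by apply: adjK; rewrite // eq_sym.
- by move=> y z; rewrite !inE => /andP[_ yK] /andP[_ zK]; apply: adjK.
move=> w _ xw; have [/exists_inP[k kK wk]|/exists_inPn no] := boolP [exists k in K :\ x, ~~ adj w k].
  by exists k.
have wK k : k \in K -> adj w k.
  move=> kK; have [->|kx] := eqVneq k x; first by rewrite adj_sym.
  by apply/negPn; apply: no; rewrite !inE kx.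
have wnK : w \notin K by apply/negP => /wK; rewrite adj_irr.
have : w |: K = K.
  apply: Kmax; last exact: subsetUr.
  apply/forall_inP => y; rewrite !inE => yK; apply/forall_inP => z; rewrite !inE => zK.
  apply/implyP => yz; case/orP: yK yz => [/eqP->|yK]; case/orP: zK => [/eqP->|zK] yz.
  - by rewrite eqxx in yz.
  - exact: wK.
  - by rewrite adj_sym; apply: wK.
  exact: adjK.
by move=> e; move: wnK; rewrite -e !inE eqxx.
Qed.

(** The hole is closed under adjacency, hence a full component, and its indexing is the isomorphism
    with the cycle graph. *)
Lemma odd_hole_component (G : sgraph) M (c : nat -> G) : odd_hole setT M c ->
  odd_cycle (component (c 0)) /\ 3 < #|component (c 0)|.
Proof.
move=> hole; have [oM M3 ci _ cadj] := hole; have M0 : 0 < M by lia.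
have conn x : connect adj (c 0) x = [exists i : 'I_M, c i == x].
  apply/idP/existsP => [|[i /eqP<-]].
    case/connectP => p; elim/last_ind: p x => [|p y IH] x /=.
      by move=> _ ->; exists (Ordinal M0).
    rewrite rcons_path last_rcons => /andP[pp ly] ->.
    have [i /eqP ei] := IH _ pp erefl; rewrite -ei in ly.
    have [j jM ej] := odd_hole_closed hole (ltn_ord i) (in_setT y) ly.
    by exists (Ordinal jM); rewrite /= ej.
  case: i => i iM /=; elim: i iM => // i IH iM.
  apply: connect_trans (IH (ltnW iM)) _; apply: connect1.
  by rewrite cadj ?inE ?(ltnW iM) // modn_small // eqxx.
pose V := component (c 0).
have ex (u : V) : {i : 'I_M | c i == val u}.
  by apply: sigW; apply/existsP; rewrite -conn; have := valP u; rewrite inE.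
have inC (i : 'I_M) : c i \in [set x | connect adj (c 0) x].
  by rewrite inE conn; apply/existsP; exists i.
pose h (u : V) : cycle_graph M := sval (ex u).
pose k (i : cycle_graph M) : V := exist _ (c i) (inC i).
have hk : cancel h k by move=> u; apply/val_inj/eqP; exact: svalP (ex u).
have kh : cancel k h.
  move=> i; apply/val_inj; apply: ci; rewrite ?inE ?ltn_ord //.
  by apply/eqP; have := svalP (ex (k i)).
have bij : bijective h by exists k.
have card : #|V| = M by rewrite (bij_eq_card bij) card_ord.
split; last by rewrite card.
exists M; split=> //; first by lia.
exists h; split=> // x y; rewrite -{2}[x]hk -{2}[y]hk.
move: (h x) (h y) => i j.
rewrite /= /induced_adj /= cadj ?inE ?ltn_ord //.
have cE a b : a < M -> b < M -> (c a == c b) = (a == b).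
  by move=> aM bM; apply/eqP/eqP => [/ci|->//]; apply.
rewrite !cE ?ltn_mod ?ltn_ord // /cycle_adj -!val_eqE /=.
have pred : ((j : nat) == (i + M.-1) %% M) = ((i : nat) == j.+1 %% M).
  apply/eqP/eqP => ->.
    by rewrite -addn1 modnDml -addnA addn1 prednK // modnDr modn_small.
  by rewrite modnDml addSnnS prednK // modnDr modn_small.
rewrite pred; have [->|//] := eqVneq (i : nat) j.
rewrite orbb /=; apply/esym/negbTE; have := ltn_ord j; rewrite leq_eqVlt => /orP[/eqP e|lt].
  by rewrite e modnn; lia.
by rewrite modn_small //; lia.
Qed.

(** * Building the neighbour lists *)

Section Build.
Variables (n : nat) (E : rel 'I_n) (Esym : symmetric E) (Eirr : irreflexive E).
Let G := SGraph Esym Eirr.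
Hypotheses (noclaw : ~ contains_induced claw G) (noK5 : ~ minor (complete 5) G).
Implicit Types (u x y : G) (s : state).

Definition nat_adj x (w : nat) : bool := [exists y : G, (nat_of_ord y == w) && adj x y].

Lemma nat_adjE x y : nat_adj x (nat_of_ord y) = adj x y.
Proof.
apply/existsP/idP => [[z /andP[/eqP/val_inj-> //]]|xy].
by exists y; rewrite eqxx.
Qed.

(** The contents of the row of [x] once columns [0] to [v - 1] have been scanned. *)
Definition nbrow x (v : nat) : seq nat := nat_of_ord x :: [seq w <- iota 0 v | nat_adj x w].

Arguments nbrow : simpl never.

Lemma nbrowS x v : nbrow x v.+1 = if nat_adj x v then rcons (nbrow x v) v else nbrow x v.
Proof.
by rewrite /nbrow -[v.+1]addn1 iotaD add0n filter_cat /=; case: ifP; rewrite ?cats0 ?cats1.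
Qed.

Lemma size_nbrow x v : v <= n -> size (nbrow x v) <= 10.
Proof.
move=> vn; rewrite /nbrow /= ltnS; apply: leq_trans (degree_bound noclaw noK5 x).
have -> : #|[set y | adj x y]| = size [seq w <- iota 0 n | nat_adj x w].
  rewrite -val_enum_ord filter_map size_map.
  have /card_uniqP <- : uniq [seq y <- enum 'I_n | preim val (nat_adj x) y].
    by rewrite filter_uniq ?enum_uniq.
  by apply: eq_card => y; rewrite inE mem_filter mem_enum andbT /= nat_adjE.
rewrite -[in leqRHS](subnKC vn) iotaD filter_cat size_cat; exact: leq_addr.
Qed.

Definition slot x (i : nat) : G := insubd x (nth 0 (nbrow x n) i).

Lemma slotE x i : nat_of_ord (slot x i) = nth 0 (nbrow x n) i.
Proof.
rewrite /slot; apply: insubdK.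
have [il|il] := ltnP i (size (nbrow x n)); last first.
  by rewrite nth_default //; have := ltn_ord x; rewrite /in_mem /=; lia.
have := mem_nth 0 il; rewrite inE => /orP[/eqP->|]; first exact: (ltn_ord x).
by rewrite mem_filter mem_iota => /andP[].
Qed.

Lemma slot_tableP : slot_table slot.
Proof.
split=> [x|x y xy]; first by apply/val_inj; rewrite /= slotE.
have yin : nat_of_ord y \in nbrow x n.
  by rewrite inE mem_filter nat_adjE xy mem_iota ltn_ord orbT.
exists (index (nat_of_ord y) (nbrow x n)).
  by apply: leq_trans (size_nbrow x (leqnn n)); rewrite index_mem.
by apply/val_inj; rewrite /= slotE nth_index.
Qed.

Definition fresh s := [/\ reg s 0 = n, reg s 4 = 0,
  forall x y : G, arr s 0 (nat_of_ord x * n + nat_of_ord y) = adj x y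
  & forall a k, a != 0 -> a != 2 -> arr s a k = 0].

Definition row_rep x v s := forall i, i < 10 -> arr s 2 (10 * nat_of_ord x + i) = nth 0 (nbrow x v) i.
Definition empty_row x s := forall i, i < 10 -> arr s 2 (10 * nat_of_ord x + i) = 0.

Definition build_inv (k : nat) s := fresh s /\ forall x, 
  if nat_of_ord x < k then row_rep x n s else empty_row x s.

Definition row_inv x (v : nat) s := [/\ fresh s, reg s 1 = nat_of_ord x,
  reg s 3 = size (nbrow x v), row_rep x v s &
  forall y, y != x -> if nat_of_ord y < nat_of_ord x then row_rep y n s else empty_row y s].

Lemma fresh_reg s r v : r != 0 -> r != 4 -> fresh s -> fresh (set_reg s r v).
Proof.
by move=> r0 r4 [s0 s4 mx z]; split=> //=; rewrite eq_sym ?(negbTE r0) ?(negbTE r4).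
Qed.

Lemma fresh_arr s k v : fresh s -> fresh (set_arr s 2 k v).
Proof. by case=> s0 s4 mx z; split=> //= a j a0 a2; rewrite (negbTE a2) z. Qed.

Lemma row_index x y i j : i < 10 -> j < 10 ->
  (10 * nat_of_ord x + i == 10 * nat_of_ord y + j) = (x == y) && (i == j).
Proof.
move=> i10 j10; rewrite -val_eqE /=; apply/eqP/andP => [e|[/eqP-> /eqP->] //].
by split; apply/eqP; lia.
Qed.

Lemma input_fresh : build_inv 0 (input E).
Proof.
split; last by move=> x i _.
split=> //; last by move=> a k a0 _ /=; rewrite (negbTE a0).
move=> x y /=; congr nat_of_bool; apply/existsP/idP => [[x' /existsP[y' /andP[/eqP e xy]]]|xy].
  have n0 : 0 < n by have := ltn_ord x; lia.
  have ex : x = x'.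
    apply/val_inj => /=; have := congr1 (divn^~ n) e.
    by rewrite /= !divnMDl // !divn_small ?ltn_ord // !addn0.
  have ey : y = y' by apply/val_inj => /=; move: e; rewrite ex; lia.
  by rewrite ex ey.
by exists x; apply/existsP; exists y; rewrite eqxx.
Qed.

Variable W : nat.
Hypothesis bigW : 64 * (n + 2) ^ 2 <= W.

Let Wn : 10 * n + 20 < W. Proof. by rewrite (leq_trans _ bigW) // -[in leqRHS]mulnn; nia. Qed.

Lemma runs_row_body x v s : v < n -> reg s 2 = v -> row_inv x v s ->
  runs W RowBody s (tc RowBody) (fun s' => row_inv x v.+1 s' /\ reg s' 2 = v).
Proof.
move=> vn r2 [fr r1 r3 rx ro]; have [s0 s4 mx z] := fr.
pose y : G := Ordinal vn.
have lx := ltn_ord x.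
have e1 : evals W s (Reg 1) (nat_of_ord x) by apply: evals_reg => //; lia.
have e2 : evals W s (Reg 2) (nat_of_ord y) by apply: evals_reg => //=; lia.
apply: (@runs_if _ _ _ (adj x y)).
- apply: (evals_get (j := nat_of_ord x * n + nat_of_ord y)); last by case: (adj x y); lia.
    have h1 : nat_of_ord x * n + v < W by rewrite (leq_trans _ bigW) // -[in leqRHS]mulnn; nia.
    apply: evals_add => //; apply: evals_mul => //; last by apply: leq_ltn_trans h1; lia.
    by apply: evals_reg => //; lia.
  exact: mx.
- move=> xy; have na : nat_adj x v by have := nat_adjE x y; rewrite xy.
  have sz : (size (nbrow x v)).+1 <= 10.
    by have := size_nbrow x vn; rewrite nbrowS na size_rcons.
  apply: (@runs_seq _ _ _ _ _ _ (fun s' => s' = set_arr s 2 (10 * nat_of_ord x + size (nbrow x v)) v)).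
    apply: runs_store; [|exact: e2|by []].
    apply: evals_add; [|by apply: evals_reg => //; lia|by lia].
    by apply: evals_mul => //; [apply: evals_lit; lia | lia].
  move=> _ ->; set s1 := set_arr _ _ _ _.
  have szW : size (nbrow x v) + 1 < W by move: sz Wn; clear; lia.
  have h3 : evals W s1 (Reg 3) (size (nbrow x v)) by apply: (evals_reg r3); move: szW; clear; lia.
  have h1 : evals W s1 (Lit 1) 1 by apply: evals_lit; move: Wn; clear; lia.
  apply: (runs_assign (evals_add h3 h1 szW)).
  split=> //; split=> //.
  + by apply: fresh_reg => //; apply: fresh_arr.
  + by rewrite nbrowS na size_rcons /= addn1.
  + move=> i i10 /=; rewrite row_index // eqxx /= nbrowS na nth_rcons.
    case: ltngtP => [lt|gt|e] //; rewrite rx //.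
    by rewrite nth_default //; apply: ltnW.
  move=> t tx; have := ro t tx.
  by case: ifP => _ rt i i10 /=; rewrite row_index // (negbTE tx) rt.
move=> nxy; have na : nat_adj x v = false by have := nat_adjE x y; rewrite (negbTE nxy).
by apply: runs_skip; split=> //; split=> //; rewrite ?r3 ?nbrowS ?na // /row_rep nbrowS na.
Qed.

Definition build_cost := tc (Seq (Store 2 (Mul (Lit 10) (Reg 1)) (Reg 1)) (Assign 3 (Lit 1)))
  + (n * (tc RowBody + 8) + 6).

Lemma runs_build_body k s : k < n -> reg s 1 = k -> build_inv k s ->
  runs W BuildBody s build_cost (fun s' => build_inv k.+1 s' /\ reg s' 1 = k).
Proof.
move=> kn r1 [fr rows]; pose x : G := Ordinal kn.
have [s0 s4 mx z] := fr.
have e1 s' : reg s' 1 = k -> evals W s' (Reg 1) (nat_of_ord x).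
  by move=> e; apply: evals_reg => //=; lia.
apply: (@runs_seq _ _ _ _ _ _ (row_inv x 0)).
  apply: (@runs_seq _ _ _ _ _ _ (fun s' => s' = set_arr s 2 (10 * k) k)).
    apply: runs_store; [|exact: e1|by []].
    by apply: evals_mul; [apply: evals_lit; lia | exact: e1 | lia].
  move=> _ ->; apply: runs_assign; first by apply: evals_lit; lia.
  have ek i : i < 10 -> forall y, (10 * nat_of_ord y + i == 10 * k) = (y == x) && (i == 0).
    by move=> i10 y; rewrite -(@row_index y x i 0) // addn0.
  split=> //.
  - by apply: fresh_reg => //; apply: fresh_arr.
  - move=> i i10 /=; have := ek i i10 x; rewrite /= => ->; rewrite eqxx /=; case: i i10 => [//|i] i10 /=.
    by have := rows x; rewrite ltnn nth_nil => ->.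
  move=> y yx; have := rows y; rewrite /=.
  by case: ifP => _ ry i i10 /=; rewrite ek // (negbTE yx) ry.
move=> s1 ri; have nW : n.+1 < W by lia.
apply: runs_weaken (@runs_for W 2 RowBody n (tc RowBody) (row_inv x) s1 _ nW _ _ _ ri) (leqnn _) _ => //.
- by move=> i s2 [[s20 _ _ _] _ _ _ _].
- by move=> i s2 iN r2 rI; apply: runs_row_body.
move=> s2 [fr2 r12 r32 rx ro]; split; last exact: r12.
split=> // y; have [->|yx] := eqVneq y x; first by rewrite ltnSn.
have nk : nat_of_ord y != k by move: yx; rewrite -val_eqE.
have -> : (nat_of_ord y < k.+1) = (nat_of_ord y < k) by rewrite ltnS leq_eqVlt (negbTE nk).
exact: ro y yx.
Qed.

End Build.

(** * Running time and assembly of the passes *)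

Definition running_time (n : nat) : nat :=
  (n * (build_cost n + 8) + 6) + ((n * (tc PendantBody + 8) + 6) + ((n * (tc WheelBody + 8) + 6) +
  ((n * (root_cost n + 8) + 6) + (n * (4 + tc PopBody) + 4)))).

Lemma running_time_quadratic : bigO running_time (fun n => n ^ 2).
Proof.
rewrite /bigO /running_time /build_cost /root_cost.
move: (tc (Seq _ _)) (tc RowBody) (tc PendantBody) (tc WheelBody) walk_cost (tc RootBody) (tc PopBody).
move=> a b c d e f g.
(* A root costs at most [2 n + 1 <= 3 n] walk rounds, whence [3 * e]; the 200 absorbs the overhead
   of the loops. *)
exists (a + b + c + d + 3 * e + f + g + 200), 1 => n n1; rewrite expnS expn1.
nia.
Qed.

Section Correctness.
Variables (n : nat) (E : rel 'I_n) (Esym : symmetric E) (Eirr : irreflexive E).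
Let G := SGraph Esym Eirr.
Hypotheses (noclaw : ~ contains_induced claw G) (noK5 : ~ minor (complete 5) G).
Hypothesis noholes : no_odd_hole [set: G].
Variable W : nat.
Hypothesis bigW : 64 * (n + 2) ^ 2 <= W.

Let Wn : 10 * n + 20 < W. Proof. by rewrite (leq_trans _ bigW) // -[in leqRHS]mulnn; nia. Qed.
Let W2 : 2 < W. Proof. by lia. Qed.

Lemma algorithm_correct :
  runs W algorithm (input E) (running_time n)
    (fun s => exists2 f : G -> bool, colour_rep f s & valid setT setT f).
Proof.
have nW : n.+1 < W by lia.
have st := slot_tableP noclaw noK5.
apply: (@runs_seq _ _ _ _ _ _ (build_inv Esym Eirr n)).
  have Ir i s v : build_inv Esym Eirr i s -> build_inv Esym Eirr i (set_reg s 1 v).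
    by case=> fr rows; split=> //; apply: fresh_reg.
  have In i s : build_inv Esym Eirr i s -> reg s 0 = n by case=> -[].
  apply: (runs_for (x := 1) isT nW Ir In).
  - by move=> i s iN r1 bi; apply: (runs_build_body noclaw noK5 bigW).
  exact: input_fresh.
move=> s1 [[s10 s14 mx z] rows].
have inv0 : pendant_inv (slot (Esym := Esym) (Eirr := Eirr)) 0 s1.
  exists setT, [::]; split=> //; split=> //.
  - split=> // x i i10; rewrite slotE; have := rows x; rewrite ltn_ord; exact.
  - by move=> x; rewrite z // inE.
  - by move=> x; rewrite z // inE.
  by move=> x; rewrite z.
apply: (@runs_seq _ _ _ _ _ _ (pendant_inv (slot (Esym := Esym) (Eirr := Eirr)) n)).
  set J := pendant_inv _.
  have Ir i s v : J i s -> J i (set_reg s 1 v).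
    by case=> P [stk [rp gs nP old]]; exists P, stk; split=> //; apply: rep_reg.
  have In i s : J i s -> reg s 0 = n by case=> P [stk [[[]]]].
  apply: (runs_for (x := 1) isT nW Ir In) => //.
  by move=> i s iN r1 bi; exact: (runs_pendant_body noclaw noK5 bigW st iN r1 bi).
move=> s2 [P [stk [rp gs nP old]]].
have inv1 : wheel_inv (slot (Esym := Esym) (Eirr := Eirr)) 0 s2.
  exists P, stk; split=> //; apply: pendant_free_test => a aP; apply: old => //; exact: ltn_ord.
apply: (@runs_seq _ _ _ _ _ _ (wheel_inv (slot (Esym := Esym) (Eirr := Eirr)) n)).
  set J := wheel_inv _.
  have Ir i s v : J i s -> J i (set_reg s 1 v).
    by case=> P' [stk' [rp' gs' nP' pf old']]; exists P', stk'; split=> //; apply: rep_reg.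
  have In i s : J i s -> reg s 0 = n by case=> P' [stk' [[[]]]].
  apply: (runs_for (x := 1) isT nW Ir In) => //.
  by move=> i s iN r1 bi; exact: (runs_wheel_body noclaw noK5 bigW st iN r1 bi).
move=> s3 [P' [stk' [rp' gs' nP' pf old']]].
have tP : tame P'.
  by split=> //; apply: wheel_free_test => a aP; apply: old' => //; exact: ltn_ord.
have p0 : below P' 0 = set0 by apply/setP => x; rewrite !inE andbF.
have pn : below P' n = P' by apply/setP => x; rewrite !inE ltn_ord andbT.
have inv2 : root_inv (slot (Esym := Esym) (Eirr := Eirr)) P' stk' 0 s3.
  exists (fun=> false); rewrite p0 //.
  by apply/validP => u _; rewrite inE.
apply: (@runs_seq _ _ _ _ _ _ (root_inv (slot (Esym := Esym) (Eirr := Eirr)) P' stk' n)).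
  set J := root_inv _ _ _.
  have Ir i s v : J i s -> J i (set_reg s 8 v).
    by case=> f rpf vf; exists f => //; apply: rep_reg.
  have In i s : J i s -> reg s 0 = n by case=> f [[]].
  apply: (runs_for (x := 8) isT nW Ir In) => //.
  by move=> i s iN r1 bi; exact: (runs_root_body noclaw noK5 bigW st tP nP' iN r1 bi).
move=> s4 [f]; rewrite pn => rp4 vf.
(* The number of pops equals the stack height after the deletions, and [i] of them have been
   done. *)
pose I i s := exists P stk f, [/\ size stk + i = size stk', good_stack stk P,
  rep (slot (Esym := Esym) (Eirr := Eirr)) P P f stk s & valid P P f].
have szn := good_stack_size gs'.
have : runs W (While (Lt (Lit 0) (Reg 4)) PopBody) s4
    (size stk' * ((cost (Lt (Lit 0) (Reg 4))).+1 + tc PopBody) + (cost (Lt (Lit 0) (Reg 4))).+1)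
    (I (size stk')).
  apply: (runs_while (I := I)).
  - move=> i s iN [Q [sk [g [sz gsk rpk vg]]]]; have [_ _ _ _ [r4 _]] := rpk.
    have -> : (i < size stk') = (0 < size sk) by lia.
    have skn := good_stack_size gsk.
    apply: evals_lt; [lia | apply: evals_lit; lia | apply: (evals_reg r4); lia].
  - move=> i s iN [Q [sk [g [sz gsk rpk vg]]]].
    case: sk sz gsk rpk => [|y sk] sz gsk rpk; first by move: iN; rewrite -sz ltnn.
    have skn := good_stack_size gsk; have [yQ ry gsk'] := gsk.
    have skl : size sk < n by apply: leq_trans (leq_addl #|Q| _) _; rewrite skn.
    apply: runs_weaken (runs_pop_body noK5 bigW st yQ ry rpk vg skl) (leqnn _) _.
    move=> s' [g' rp2 vg']; exists (y |: Q), sk, g'; split=> //.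
    by rewrite addnS -addSn.
  by exists P', stk', f; rewrite addn0.
move/runs_weaken; apply.
  move: (tc PopBody) => t; rewrite leq_add // leq_mul //; first by lia.
move=> s' [Q [sk [g [sz gsk [_ _ _ cg _] vg]]]].
have sk0 : sk = [::] by apply: size0nil; lia.
by move: gsk vg; rewrite sk0 /= => -> vg; exists g.
Qed.

End Correctness.

Theorem theorem3p5 :
  exists (p : cmd) (k : nat) (T : nat -> nat),
    bigO T (fun n => n ^ 2) /\
    forall (n : nat) (E : rel 'I_n) (Esym : symmetric E) (Eirr : irreflexive E),
      let G := SGraph Esym Eirr in
      ~ contains_induced claw G ->
      ~ minor (complete 5) G ->
      ~ odd_cycle G ->
      (forall v : G, odd_cycle (component v) -> #|component v| <= 3) ->
      exists (t : nat) (s : state) (phi : G -> color),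
        [/\ exec ((n + 2) ^ k) p (input E) t s,
            t <= T n,
            outputs s phi
          & clique_coloring2 phi].
Proof.
exists algorithm, 8, running_time; split; first exact: running_time_quadratic.
move=> n E Esym Eirr G noclaw noK5 _ comp.
have noholes : no_odd_hole [set: G].
  (* An odd hole of the whole graph is a component that is an odd cycle with more than three
     vertices, which [comp] excludes. *)
  by move=> M c /odd_hole_component[/comp]; lia.
(* The exponent is 6 + 2: as [n + 2] is at least 2, its sixth power covers the factor 64. *)
have bigW : 64 * (n + 2) ^ 2 <= (n + 2) ^ 8.
  by rewrite (expnD _ 6 2) leq_mul2r (@leq_exp2r 2 (n + 2) 6) // leq_addl orbT.
have [t [s [ex tT [f cf vf]]]] := algorithm_correct noclaw noK5 noholes bigW.
exists t, s, (fun x => if f x then green else red); split=> //.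
  by move=> x; rewrite cf; case: (f x).
exact: valid_clique_coloring.
Qed.
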